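(* Let $\phi:\mathbb{R}^d\to\mathbb{R}$ be twice differentiable, $\mu$-strongly convex ($\mu>0$), $L$-smooth, with $\widehat{L}$-Lipschitz continuous Hessian ($\widehat L>0$), and with minimizer $\mathbf{x}^*$. Let $f=\phi+\zeta$ with $|f(\mathbf{x})-\phi(\mathbf{x})|\le\sigma$ for all $\mathbf{x}\in\mathbb{R}^d$, $\sigma\ge0$. Let $\alpha>0$, and for $t=0,\dots,T-1$ let $S_t\in\mathbb{R}^{d\times\ell}$ be an oblivious $(\frac14,k,\frac{\delta}{T})$-sketching matrix for the matrix product with columns $\mathbf{s}_t^{(1)},\dots,\mathbf{s}_t^{(\ell)}$. Let $$\mathbf{x}_{t+1}=\mathbf{x}_t-\eta_t\,\mathbf{g}(\mathbf{x}_t),\qquad\mathbf{g}(\mathbf{x}_t)=\sum_{i=1}^{\ell}\frac{f(\mathbf{x}_t+\alpha\mathbf{s}_t^{(i)})-f(\mathbf{x}_t-\alpha\mathbf{s}_t^{(i)})}{2\alpha}\,\mathbf{s}_t^{(i)}.$$ Let $C_1=\max_{\mathbf{x}}\left\{5\|\nabla^2\phi(\mathbf{x})\|_2+\frac{\mathrm{tr}(\nabla^2\phi(\mathbf{x}))}{k}\right\}$, $C_2=\sqrt{\frac54+\frac{d}{4k}}$, let $C_3$ be the constant given in the context, and let $$C_4=\mu^{-1}\left(\frac{20\ell\sigma^2}{\alpha^2}+\frac{5C_3^3\widehat{L}^2\alpha^4}{9}\right)+\frac{8C_2^3\widehat{L}}{3C_1^2\mu}\left(\frac{C_3^{9/2}\widehat{L}^3\alpha^6}{6^3}+\frac{\ell^{3/2}\sigma^3}{\alpha^3}\right).$$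 (1) If $\mathbf{x}_t$ satisfies $(\phi(\mathbf{x}_t)-\phi(\mathbf{x}^* ))^{1/2}>\frac{3\sqrt2\,C_1^2}{16\sqrt{L}\,\widehat{L}\,C_2^3}$ and the step size is $\eta_t=\left(5+\frac dk\right)^{-1}L^{-1}$, then with probability at least $1-\delta/T$, $$\phi(\mathbf{x}_{t+1})-\phi(\mathbf{x}^* )\le\left(1-\frac{\mu}{4L}\left(5+\frac dk\right)^{-1}\right)\left(\phi(\mathbf{x}_t)-\phi(\mathbf{x}^* )\right)+\frac{3}{2L}\left(5+\frac dk\right)^{-1}\left(\frac{\widehat{L}^2\alpha^4}{36}\|S_t\|_F^6+\frac{\ell\sigma^2}{\alpha^2}\right).$$ (2) If $\mathbf{x}_t$ satisfies $(\phi(\mathbf{x}_t)-\phi(\mathbf{x}^* ))^{1/2}\le\frac{3\sqrt2\,C_1^2}{16\sqrt{L}\,\widehat{L}\,C_2^3}$ and the step size is $\eta_t=\frac{1}{2C_1}$, then with probability at least $1-\delta/T$, $$\phi(\mathbf{x}_{t+1})-\phi(\mathbf{x}^* )-C_4\le\left(1-\frac{\mu}{8C_1}\right)\left(\phi(\mathbf{x}_t)-\phi(\mathbf{x}^* )-C_4\right).$$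
   Context: $\|\cdot\|$ is the Euclidean norm, $\|\cdot\|_2$ spectral, $\|\cdot\|_F$ Frobenius. $\mu$-strongly convex: $\phi(\mathbf{y})\ge\phi(\mathbf{x})+\langle\nabla\phi(\mathbf{x}),\mathbf{y}-\mathbf{x}\rangle+\frac\mu2\|\mathbf{y}-\mathbf{x}\|^2$ for all $\mathbf{x},\mathbf{y}$. $L$-smooth: $\phi(\mathbf{y})\le\phi(\mathbf{x})+\langle\nabla\phi(\mathbf{x}),\mathbf{y}-\mathbf{x}\rangle+\frac L2\|\mathbf{y}-\mathbf{x}\|^2$ for all $\mathbf{x},\mathbf{y}$. $\widehat{L}$-Lipschitz Hessian: $\|\nabla^2\phi(\mathbf{x})-\nabla^2\phi(\mathbf{y})\|_2\le\widehat{L}\|\mathbf{x}-\mathbf{y}\|$ for all $\mathbf{x},\mathbf{y}$. Sketching matrix: for $0<\gamma\le1$, $k\ge1$, $\delta>0$, a random matrix $S\in\mathbb{R}^{d\times\ell}$ is an oblivious $(\gamma,k,\delta)$-random sketching matrix for the matrix product if, for any given matrix $B\in\mathbb{R}^{d\times d}$ ($S$ being independent of $B$), with probability at least $1-\delta$, $\|B^\top SS^\top B-B^\top B\|_2\le\gamma\left(\|B\|_2^2+\frac{\|B\|_F^2}{k}\right)$. The matrix $S_t$ is freshly generated at iteration $t$, independently of $\mathbf{x}_t$. Constant $C_3$ (a bound on $\|S_t\|_F^2$): $C_3=d$ if $S_t$ is a Rademacher sketching matrix (i.i.d. entries uniform on $\{\pm1\}$, scaled by $1/\sqrt\ell$)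 or an SRHT matrix ($S_t^\top=\frac{1}{\sqrt\ell}PH_dD$ with $H_d$ the $d\times d$ Walsh–Hadamard matrix with $\pm1$ entries, $D$ diagonal with independent uniform $\pm1$ entries, $P\in\mathbb{R}^{\ell\times d}$ a uniform row-sampling matrix), for which $\|S_t\|_F^2=d$; and $C_3=\frac{5\ell}{4}+\frac{d\ell}{4k}$ for any other sketching matrix. *)

(* Defs.v *)
(* MathComp / MathComp-Analysis *)
From HB Require Import structures.
From mathcomp Require Import all_boot all_order all_algebra.
From mathcomp Require Import all_classical all_reals all_analysis.

Set Implicit Arguments.
Unset Strict Implicit.
Unset Printing Implicit Defensive.

Import Order.TTheory GRing.Theory Num.Theory.
Import numFieldNormedType.Exports.

Local Open Scope classical_set_scope.
Local Open Scope ring_scope.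

Section Norms.
Variable R : realType.

Definition dotv n (u v : 'cV[R]_n) : R := \sum_(i < n) u i 0 * v i 0.

(* The canonical norm `|u| of the library is the max norm. *)
Definition enorm n (u : 'cV[R]_n) : R := Num.sqrt (dotv u u).

Definition specnorm m n (A : 'M[R]_(m, n)) : R :=
  sup [set enorm (A *m u) | u in [set u : 'cV[R]_n | enorm u <= 1]].

Definition fnorm m n (A : 'M[R]_(m, n)) : R :=
  Num.sqrt (\sum_(i < m) \sum_(j < n) A i j ^+ 2).

End Norms.

Section Regularity.
Variables (R : realType) (d : nat).
Implicit Type phi : 'cV[R]_d -> R.

Definition grad phi (x : 'cV[R]_d) : 'cV[R]_d :=
  \col_(i < d) 'D_(delta_mx i 0) phi x.

Definition hess phi (x : 'cV[R]_d) : 'M[R]_d :=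
  \matrix_(i < d, j < d) 'D_(delta_mx j 0) (fun y => grad phi y i 0) x.

(* Frechet differentiability; it does not depend on the norm on R^d. *)
Definition twice_differentiable phi : Prop :=
  (forall x, differentiable phi x) /\ (forall x, differentiable (grad phi) x).

Definition strongly_convex phi (mu : R) : Prop :=
  forall x y,
    phi y >= phi x + dotv (grad phi x) (y - x) + mu / 2 * enorm (y - x) ^+ 2.

Definition smooth phi (L : R) : Prop :=
  forall x y,
    phi y <= phi x + dotv (grad phi x) (y - x) + L / 2 * enorm (y - x) ^+ 2.

Definition lipschitz_hessian phi (Lh : R) : Prop :=
  forall x y, specnorm (hess phi x - hess phi y) <= Lh * enorm (x - y).

End Regularity.

Section Randomness.
Context {disp : measure_display} {W : measurableType disp} {R : realType}.
Variable P : probability W R.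

Definition borel_set (T : topologicalType) (A : set T) : Prop :=
  <<s [set U : set T | open U] >> A.

Definition borel_rv (T : topologicalType) (X : W -> T) : Prop :=
  forall A, borel_set A -> measurable (X @^-1` A).

Definition independent_rv (T U : topologicalType) (X : W -> T) (Y : W -> U)
    : Prop :=
  forall A B, borel_set A -> borel_set B ->
    P (X @^-1` A `&` Y @^-1` B) = (P (X @^-1` A) * P (Y @^-1` B))%E.

(* Almost surely on the event {X \in D}, the conditional probability of Q given
   X is at least p.  When X is the constant x and x \in D, this is
   p <= P(Q). *)
Definition cond_prob_ge (T : topologicalType) (X : W -> T) (D : set T) (p : R)
    (Q : set W) : Prop :=
  forall A, borel_set A -> A `<=` D ->
    (p%:E * P (X @^-1` A) <= P (X @^-1` A `&` Q))%E.

Definition finite_rv (T : finType) (X : W -> T) : Prop :=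
  forall a, measurable (X @^-1` [set a]).

Definition uniform_on (T : finType) (A : {set T}) (X : W -> T) : Prop :=
  finite_rv X /\
  forall a, P (X @^-1` [set a]) = ((a \in A)%:R / #|A|%:R)%:E.

Definition mutually_independent (I T : finType) (X : I -> W -> T) : Prop :=
  forall (J : {set I}) (A : I -> set T),
    P (\bigcap_(i in [set` J]) (X i @^-1` A i)) =
    (\prod_(i in J) P (X i @^-1` A i))%E.

Definition iid_uniform (I T : finType) (X : I -> W -> T) : Prop :=
  (forall i, uniform_on [set: T]%SET (X i)) /\ mutually_independent X.

Definition sgn (b : bool) : R := (-1) ^+ b.

Definition oblivious_sketch (d l : nat) (S : W -> 'M[R]_(d, l))
    (gamma k delta : R) : Prop :=
  borel_rv S /\
  forall B : 'M[R]_d,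
    ((1 - delta)%:E <=
     P [set w | (specnorm (B^T *m S w *m (S w)^T *m B - B^T *m B) <=
                 gamma * (specnorm B ^+ 2 + fnorm B ^+ 2 / k))%R])%E.

Definition rademacher_sketch (d l : nat) (S : W -> 'M[R]_(d, l)) : Prop :=
  exists2 eps : 'I_d * 'I_l -> W -> bool, iid_uniform eps &
    forall w, S w =
      (Num.sqrt (l%:R : R))^-1 *: \matrix_(i, j) sgn (eps (i, j) w).

(* Sylvester's matrix H_1 = (1), H_(2m) = ((H_m, H_m), (H_m, - H_m)), in closed
   form: the (i, j) entry is (-1)^(i . j), with i . j the inner product of the
   binary expansions.  Meaningful when d is a power of 2. *)
Definition walsh_hadamard (d : nat) : 'M[R]_d :=
  \matrix_(i < d, j < d)
    (-1) ^+ (\sum_(b < d) (odd (i %/ 2 ^ b) && odd (j %/ 2 ^ b)))%N.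

(* r lists the sampled rows, drawn uniformly either with replacement or
   without. *)
Definition uniform_row_sampling (d l : nat) (r : W -> {ffun 'I_l -> 'I_d})
    : Prop :=
  iid_uniform (fun i w => r w i) /\ finite_rv r \/
  uniform_on [set g : {ffun 'I_l -> 'I_d} | injectiveb g]%SET r.

Definition srht_sketch (d l : nat) (S : W -> 'M[R]_(d, l)) : Prop :=
  (exists n, d = (2 ^ n)%N) /\
  exists (eps : W -> {ffun 'I_d -> bool}) (r : W -> {ffun 'I_l -> 'I_d}),
    [/\ iid_uniform (fun i w => eps w i),
        uniform_row_sampling r,
        (forall a b, P (eps @^-1` [set a] `&` r @^-1` [set b]) =
                     (P (eps @^-1` [set a]) * P (r @^-1` [set b]))%E) &
        forall w, (S w)^T =
          (Num.sqrt (l%:R : R))^-1 *: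
            ((\matrix_(i < l, j < d) (r w i == j)%:R) *m walsh_hadamard d
             *m diag_mx (\row_(j < d) sgn (eps w j)))].

End Randomness.

Section Method.
Variables (R : realType) (d l : nat).

Definition zo_grad (f : 'cV[R]_d -> R) (alpha : R) (S : 'M[R]_(d, l))
    (x : 'cV[R]_d) : 'cV[R]_d :=
  \sum_(i < l)
    ((f (x + alpha *: col i S) - f (x - alpha *: col i S)) / (2 * alpha))
      *: col i S.

(* The supremum over x is finite for a convex smooth phi. *)
Definition C1 (phi : 'cV[R]_d -> R) (k : R) : R :=
  sup [set 5 * specnorm (hess phi x) + \tr (hess phi x) / k | x in setT].

Definition C2 (k : R) : R := Num.sqrt (5 / 4 + d%:R / (4 * k)).

Definition C3 (disp : measure_display) (W : measurableType disp)
    (P : probability W R) (S : W -> 'M[R]_(d, l)) (k : R) : R :=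
  if `[< rademacher_sketch P S \/ srht_sketch P S >] then d%:R
  else 5 * l%:R / 4 + d%:R * l%:R / (4 * k).

Definition C4 (mu Lh alpha sigma c1 c2 c3 : R) : R :=
  mu^-1 * (20 * l%:R * sigma ^+ 2 / alpha ^+ 2
           + 5 * c3 ^+ 3 * Lh ^+ 2 * alpha ^+ 4 / 9)
  + 8 * c2 ^+ 3 * Lh / (3 * c1 ^+ 2 * mu)
    * (c3 `^ (9 / 2) * Lh ^+ 3 * alpha ^+ 6 / 6 ^+ 3
       + l%:R `^ (3 / 2) * sigma ^+ 3 / alpha ^+ 3).

End Method.

Arguments C2 {R} d k.
Arguments C4 {R} l mu Lh alpha sigma c1 c2 c3.

(* Main.v *)
Require Import Defs.
From HB Require Import structures.
From mathcomp Require Import all_boot all_order all_algebra.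
From mathcomp Require Import all_classical all_reals all_analysis measurable_realfun.
From mathcomp Require Import ring lra.

Set Implicit Arguments.
Unset Strict Implicit.
Unset Printing Implicit Defensive.

Import Order.TTheory GRing.Theory Num.Theory.
Import numFieldNormedType.Exports.

Local Open Scope classical_set_scope.
Local Open Scope ring_scope.

(** Write [g] for the gradient of [phi] at the current point.  One step moves
    along [S q] with [q = S^T g + r], where [r] collects the errors of the
    central differences: a Taylor remainder of size [Lh alpha^2 |s_i|^3 / 6] in
    the coordinate of the column [s_i] ([central_difference]) and a noise of size
    [sigma / alpha].  The decrease of [phi] is governed by [<S^T g, q>] minus a
    curvature cost quadratic in [S q] and, near the minimum, a cubic Taylor cost.

    The sketching hypothesis controls [S] only through one matrix [B] at a time,
    and the announced probability leaves room for a single use.  That use has to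
    control at once the length of [u = S^T v], [v] being the direction of [g],
    the curvature of [S q] and the length of the columns of [S].  The matrix is
    chosen so that [B B^T = v v^T + N], where [N] is a positive form that kills
    [v], a multiple of the Hessian compressed to the complement of [v] plus a
    multiple of the projection on this complement.  The event attached to [B]
    then compares, for all [s] and [x], the square of [s u + S^T N x] with its
    expected value ([sketch_sandwich]).  Two consequences are used:
    [sandwich_upper], by which [S] does not enlarge the form [N] beyond a
    constant, and [sandwich_lower], by which [u] is not short, and the longer the
    larger [S^T N S] is on it.  Everything else within a step is deterministic.

    Far from the minimum [N] is a multiple of the projection and the bound follows
    at once ([case1_event], [descent_case1]).  Near the minimum the weights
    in [N] depend on whether the gradient dominates the errors.  If it does
    ([small_step]), put [D = 1 - S^T N S / b] and [E = D - xi u u^T], which are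
    positive semidefinite; the decrease is at least half of
    [|u|^2 - |r|^2 + q^T E q] ([small_absorb]).  The diagonal of [E] also bounds
    the columns of [S], so that columns long enough to create a large bias
    reduce the loss due to [E].  If the gradient is dominated ([large_step]),
    errors only have to be absorbed in the additive constant.  A sketch with a
    single column cannot satisfy the event when [d >= 2] ([sketch_one_column]).

    The matrix [B] depends on the current point, which is random.  By independence
    the event has the right conditional probability when the point ranges over a
    grid; the grid is refined, and the conclusion, a closed condition on the
    point, passes to the limit on the superior limit of the events
    ([conditioning]).

    On the analytic side, cocoercivity makes the gradient Lipschitz
    ([grad_lipschitz]), so that the Hessian is bounded and the supremum defining
    [C1] is finite ([C1_ge]).  The Hessian enters only through its quadratic
    form and is replaced by its symmetric part. *)

(** * Euclidean geometry and quadratic forms *)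

Section LinAlg.
Variable R : realType.
Implicit Types (m n : nat).

Lemma dotvC n (u v : 'cV[R]_n) : dotv u v = dotv v u.
Proof. by apply: eq_bigr => i _; rewrite mulrC. Qed.

Lemma dotvDr n (u v w : 'cV[R]_n) : dotv u (v + w) = dotv u v + dotv u w.
Proof. by rewrite -big_split; apply: eq_bigr => i _; rewrite mxE mulrDr. Qed.

Lemma dotvDl n (u v w : 'cV[R]_n) : dotv (v + w) u = dotv v u + dotv w u.
Proof. by rewrite dotvC dotvDr !(dotvC u). Qed.

Lemma dotvZr n a (u v : 'cV[R]_n) : dotv u (a *: v) = a * dotv u v.
Proof. by rewrite /dotv mulr_sumr; apply: eq_bigr => i _; rewrite mxE mulrCA. Qed.

Lemma dotvZl n a (u v : 'cV[R]_n) : dotv (a *: v) u = a * dotv v u.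
Proof. by rewrite dotvC dotvZr dotvC. Qed.

Lemma dotvNr n (u v : 'cV[R]_n) : dotv u (- v) = - dotv u v.
Proof. by rewrite -scaleN1r dotvZr mulN1r. Qed.

Lemma dotvNl n (u v : 'cV[R]_n) : dotv (- v) u = - dotv v u.
Proof. by rewrite dotvC dotvNr dotvC. Qed.

Lemma dotvBr n (u v w : 'cV[R]_n) : dotv u (v - w) = dotv u v - dotv u w.
Proof. by rewrite dotvDr dotvNr. Qed.

Lemma dotvBl n (u v w : 'cV[R]_n) : dotv (v - w) u = dotv v u - dotv w u.
Proof. by rewrite dotvDl dotvNl. Qed.

Lemma dotv0r n (u : 'cV[R]_n) : dotv u 0 = 0.
Proof. by rewrite -(scale0r 0) dotvZr mul0r. Qed.

Lemma dotv0l n (u : 'cV[R]_n) : dotv 0 u = 0.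
Proof. by rewrite dotvC dotv0r. Qed.

Lemma dotv_ge0 n (u : 'cV[R]_n) : 0 <= dotv u u.
Proof. by apply: sumr_ge0 => i _; rewrite -expr2 sqr_ge0. Qed.

Lemma dotv_eq0 n (u : 'cV[R]_n) : dotv u u = 0 -> u = 0.
Proof.
move=> /eqP; rewrite psumr_eq0 => [|i _]; last by rewrite -expr2 sqr_ge0.
move=> /allP h; apply/colP => i; rewrite mxE.
by have := h i (mem_index_enum i); rewrite -expr2 sqrf_eq0 => /eqP.
Qed.

Lemma dotv_trmx m n (A : 'M[R]_(m, n)) (u : 'cV[R]_m) (v : 'cV[R]_n) :
  dotv u (A *m v) = dotv (A^T *m u) v.
Proof.
have e (p : nat) (x y : 'cV[R]_p) : dotv x y = (x^T *m y) 0 0.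
  by rewrite mxE; apply: eq_bigr => i _; rewrite mxE.
by rewrite !e trmx_mul trmxK mulmxA.
Qed.

Definition qf n (M : 'M[R]_n) (u : 'cV[R]_n) := dotv u (M *m u).

Definition psd n (M : 'M[R]_n) := M^T = M /\ forall u, 0 <= qf M u.

Lemma dotv_sym n (M : 'M[R]_n) u v : M^T = M -> dotv u (M *m v) = dotv v (M *m u).
Proof. by move=> h; rewrite dotv_trmx h dotvC. Qed.

Lemma qfD n (M : 'M[R]_n) u v : M^T = M ->
  qf M (u + v) = qf M u + qf M v + 2 * dotv u (M *m v).
Proof.
move=> h; rewrite /qf mulmxDr !dotvDl !dotvDr (dotv_sym v u h).
by ring.
Qed.

Lemma qfZ n (M : 'M[R]_n) a u : qf M (a *: u) = a ^+ 2 * qf M u.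
Proof. by rewrite /qf -scalemxAr dotvZl dotvZr mulrA expr2. Qed.

Lemma qf_addl n (M N : 'M[R]_n) u : qf (M + N) u = qf M u + qf N u.
Proof. by rewrite /qf mulmxDl dotvDr. Qed.

Lemma qf_scalel n a (M : 'M[R]_n) u : qf (a *: M) u = a * qf M u.
Proof. by rewrite /qf -scalemxAl dotvZr. Qed.

Lemma qf_opp n (M : 'M[R]_n) u : qf (- M) u = - qf M u.
Proof. by rewrite /qf mulNmx dotvNr. Qed.

Lemma qf1 n (u : 'cV[R]_n) : qf 1%:M u = dotv u u.
Proof. by rewrite /qf mul1mx. Qed.

Lemma mulmx_outer n (u v : 'cV[R]_n) : u *m u^T *m v = dotv u v *: u.
Proof.
rewrite -mulmxA; apply/colP => i; rewrite !mxE big_ord1 !mxE mulrC; congr (_ * _).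
by apply: eq_bigr => j _; rewrite mxE.
Qed.

Lemma qf_outer n (u v : 'cV[R]_n) : qf (u *m u^T) v = dotv u v ^+ 2.
Proof. by rewrite /qf mulmx_outer dotvZr (dotvC v) expr2. Qed.

Lemma outer_sym n (u : 'cV[R]_n) : (u *m u^T)^T = u *m u^T.
Proof. by rewrite trmx_mul trmxK. Qed.

Lemma qf_congr m n (S : 'M[R]_(m, n)) M u : qf (S^T *m M *m S) u = qf M (S *m u).
Proof. by rewrite /qf -!mulmxA dotv_trmx trmxK. Qed.

(** The discriminant of [t |-> qf M (u + t v)] is nonpositive. *)
Lemma psd_CS n (M : 'M[R]_n) u v : psd M ->
  dotv u (M *m v) ^+ 2 <= qf M u * qf M v.
Proof.
move=> [hs hp]; set b := dotv _ _.
have hh t : 0 <= qf M u + t ^+ 2 * qf M v + 2 * t * b.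
  have := hp (u + t *: v); rewrite qfD // qfZ -scalemxAr dotvZr -/b.
  by rewrite mulrA.
have [hv|hv] := eqVneq (qf M v) 0.
  have h1 := hh ((- qf M u - 1) * b / 2).
  have [->|b0] := eqVneq b 0; first by rewrite expr0n /= mulr_ge0.
  have := hp u => hu.
  have hb : 0 < b ^+ 2 by rewrite exprn_even_gt0.
  (* a value of t at which the affine function t |-> qf M u + 2 t b equals -1 *)
  have h2 := hh (- (qf M u + 1) / (2 * b)).
  exfalso.
  move: h2; rewrite hv mulr0 addr0.
  have -> : qf M u + 2 * (- (qf M u + 1) / (2 * b)) * b = -1 by field.
  by rewrite ler0N1.
have hv0 : 0 < qf M v by rewrite lt_def hv hp.
have := hh (- b / qf M v).
have -> : qf M u + (- b / qf M v) ^+ 2 * qf M v + 2 * (- b / qf M v) * b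
   = (qf M u * qf M v - b ^+ 2) / qf M v by field.
by rewrite pmulr_lge0 ?invr_gt0 // subr_ge0.
Qed.

Lemma psd1 n : psd (1%:M : 'M[R]_n).
Proof. by split=> [|u]; rewrite ?trmx1 // qf1 dotv_ge0. Qed.

Lemma dotv_CS n (u v : 'cV[R]_n) : dotv u v ^+ 2 <= dotv u u * dotv v v.
Proof. by have := psd_CS u v (psd1 n); rewrite !qf1 mul1mx. Qed.

Lemma enorm_ge0 n (u : 'cV[R]_n) : 0 <= enorm u.
Proof. exact: sqrtr_ge0. Qed.

Lemma enorm_sqr n (u : 'cV[R]_n) : enorm u ^+ 2 = dotv u u.
Proof. by rewrite sqr_sqrtr // dotv_ge0. Qed.

Lemma le_of_sqr_le (x y : R) : 0 <= y -> x ^+ 2 <= y ^+ 2 -> x <= y.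
Proof.
move=> hy h; apply: le_trans (ler_norm x) _.
by rewrite -(ler_pXn2r (n := 2)) ?nnegrE // real_normK // num_real.
Qed.

Lemma dotv_le n (u v : 'cV[R]_n) : dotv u v <= enorm u * enorm v.
Proof.
apply: le_of_sqr_le; first by rewrite mulr_ge0 ?enorm_ge0.
by rewrite exprMn !enorm_sqr dotv_CS.
Qed.

Lemma dotv_abs_le n (u v : 'cV[R]_n) : `|dotv u v| <= enorm u * enorm v.
Proof.
rewrite ler_norml dotv_le andbT lerNl -dotvNl.
apply: le_trans (dotv_le _ _) _.
by rewrite /enorm dotvNl dotvNr opprK.
Qed.

Lemma enormZ n a (u : 'cV[R]_n) : enorm (a *: u) = `|a| * enorm u.
Proof. by rewrite /enorm dotvZl dotvZr mulrA -expr2 sqrtrM ?sqr_ge0 // sqrtr_sqr. Qed.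

Lemma enorm0 n : enorm (0 : 'cV[R]_n) = 0.
Proof. by rewrite /enorm dotv0r sqrtr0. Qed.

Lemma enormN n (u : 'cV[R]_n) : enorm (- u) = enorm u.
Proof. by rewrite /enorm dotvNl dotvNr opprK. Qed.

Lemma enorm_eq0 n (u : 'cV[R]_n) : enorm u = 0 -> u = 0.
Proof. by move=> h; apply: dotv_eq0; rewrite -enorm_sqr h expr0n. Qed.

Lemma enormD n (u v : 'cV[R]_n) : enorm (u + v) <= enorm u + enorm v.
Proof.
apply: le_of_sqr_le; first by rewrite addr_ge0 ?enorm_ge0.
rewrite enorm_sqr dotvDl !dotvDr (dotvC v u) sqrrD !enorm_sqr.
have := dotv_le u v; rewrite mulr2n; lra.
Qed.

Lemma enorm_unit n (u : 'cV[R]_n) : u != 0 ->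
  dotv ((enorm u)^-1 *: u) ((enorm u)^-1 *: u) = 1.
Proof.
move=> h; have hn : enorm u != 0 by apply: contra_neq h; exact: enorm_eq0.
by rewrite dotvZl dotvZr -enorm_sqr; field.
Qed.

(** A form with largest eigenvalue at most [m] satisfies [M^2 <= m M]; the
    proof is Cauchy-Schwarz for the form [M] itself, without eigenvalues. *)
Lemma psd_sqr_le n (M : 'M[R]_n) (m : R) u : psd M ->
  (forall x, qf M x <= m * dotv x x) ->
  dotv (M *m u) (M *m u) <= m * qf M u.
Proof.
move=> hM hm; set w := M *m u.
have hw : dotv w w ^+ 2 <= qf M u * (m * dotv w w).
  have h1 := psd_CS w u hM; rewrite -/w in h1.
  apply: le_trans h1 _; rewrite mulrC ler_wpM2l //; exact: hM.2.
have [h0|h0] := eqVneq (dotv w w) 0.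
  have hu : 0 <= qf M u by exact: hM.2.
  rewrite h0; have [m0|m0] := leP 0 m; first exact: mulr_ge0.
  suff -> : qf M u = 0 by rewrite mulr0.
  by rewrite /qf -/w (dotv_eq0 h0) dotv0r.
have h1 : 0 < dotv w w by rewrite lt_def h0 dotv_ge0.
rewrite -(ler_pM2r h1) -expr2; apply: le_trans hw _.
by rewrite mulrA (mulrC m).
Qed.

Lemma delta_dotv n (i : 'I_n) (u : 'cV[R]_n) : dotv (delta_mx i 0) u = u i 0.
Proof.
rewrite /dotv (bigD1 i) //= mxE !eqxx mul1r big1 ?addr0 // => j hj.
by rewrite mxE (negbTE hj) mul0r.
Qed.

Lemma qf_delta n (M : 'M[R]_n) (i : 'I_n) : qf M (delta_mx i 0) = M i i.
Proof. by rewrite /qf delta_dotv -colE mxE. Qed.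

Lemma psd_diag n (M : 'M[R]_n) (i : 'I_n) : psd M -> 0 <= M i i.
Proof. by move=> h; rewrite -qf_delta h.2. Qed.

(** Cauchy-Schwarz for the form [M] bounds each coordinate of [M u] by a
    diagonal entry. *)
Lemma psd_sqr_tr n (M : 'M[R]_n) u : psd M ->
  dotv (M *m u) (M *m u) <= \tr M * qf M u.
Proof.
move=> hM; rewrite /mxtrace mulr_suml ler_sum // => i _.
have := psd_CS (delta_mx i 0) u hM; rewrite delta_dotv qf_delta expr2.
by [].
Qed.

Lemma qf_sum n (M : 'M[R]_n) (u : 'cV[R]_n) :
  qf M u = \sum_i \sum_j u i 0 * M i j * u j 0.
Proof.
rewrite /qf /dotv; apply: eq_bigr => i _; rewrite mxE mulr_sumr.
by apply: eq_bigr => j _; rewrite mulrA.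
Qed.

Lemma psd_entry n (M : 'M[R]_n) (i j : 'I_n) (a b : R) : psd M ->
  2 * (a * M i j * b) <= a ^+ 2 * M i i + b ^+ 2 * M j j.
Proof.
move=> hM.
have := hM.2 (a *: delta_mx i 0 - b *: delta_mx j 0).
rewrite qfD ?hM.1 // -scaleNr !qfZ !qf_delta -scalemxAr dotvZl dotvZr delta_dotv.
rewrite -colE mxE sqrrN.
have -> : 2 * (a * (- b * M i j)) = - (2 * (a * M i j * b)) by ring.
by rewrite subr_ge0.
Qed.

(** Each off-diagonal term is at most the mean of two diagonal ones, and each
    diagonal term is counted [n] times. *)
Lemma psd_qf_diag n (M : 'M[R]_n) (u : 'cV[R]_n) : psd M ->
  qf M u <= n%:R * \sum_i M i i * u i 0 ^+ 2.
Proof.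
move=> hM; rewrite -(ler_pM2l (ltr0Sn R 1)) qf_sum [X in X <= _]mulr_sumr.
have h : \sum_(i < n) 2 * (\sum_j u i 0 * M i j * u j 0) <=
   \sum_(i < n) \sum_(j < n) (u i 0 ^+ 2 * M i i + u j 0 ^+ 2 * M j j).
  apply: ler_sum => i _; rewrite mulr_sumr; apply: ler_sum => j _.
  exact: psd_entry.
apply: le_trans h _.
have e : \sum_(i < n) \sum_(j < n) (u i 0 ^+ 2 * M i i + u j 0 ^+ 2 * M j j)
    = 2 * (n%:R * \sum_i M i i * u i 0 ^+ 2).
  under eq_bigr do rewrite big_split /= sumr_const card_ord.
  rewrite big_split /= sumr_const card_ord sumrMnl mulr_natl mulr_natl.
  by rewrite mulr2n; congr (_ *+ _ + _ *+ _); apply: eq_bigr => i _; rewrite mulrC.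
by rewrite e.
Qed.

End LinAlg.

(** * Spectral norm and Cholesky factorization *)

Section SpecNorm.
Variable R : realType.

Lemma fnorm_sqr m n (A : 'M[R]_(m, n)) :
  fnorm A ^+ 2 = \sum_i \sum_j A i j ^+ 2.
Proof.
rewrite sqr_sqrtr // sumr_ge0 // => i _; rewrite sumr_ge0 // => j _.
exact: sqr_ge0.
Qed.

Lemma fnorm_sqr_tr m n (A : 'M[R]_(m, n)) : fnorm A ^+ 2 = \tr (A *m A^T).
Proof.
rewrite fnorm_sqr; apply: eq_bigr => i _; rewrite mxE.
by apply: eq_bigr => j _; rewrite mxE expr2.
Qed.

Lemma fnorm_sqr_col m n (A : 'M[R]_(m, n)) :
  fnorm A ^+ 2 = \sum_j dotv (col j A) (col j A).
Proof.
rewrite fnorm_sqr exchange_big /=; apply: eq_bigr => j _.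
by apply: eq_bigr => i _; rewrite mxE expr2.
Qed.

Lemma mulmx_fnorm m n (A : 'M[R]_(m, n)) u :
  dotv (A *m u) (A *m u) <= fnorm A ^+ 2 * dotv u u.
Proof.
rewrite fnorm_sqr mulr_suml ler_sum // => i _.
have -> : (A *m u) i 0 = dotv (row i A)^T u.
  by rewrite mxE; apply: eq_bigr => j _; rewrite !mxE.
rewrite -expr2; apply: le_trans (dotv_CS _ _) _.
rewrite ler_wpM2r ?dotv_ge0 // le_eqVlt; apply/orP; left; apply/eqP.
by apply: eq_bigr => j _; rewrite !mxE expr2.
Qed.

Lemma specnorm_has_sup m n (A : 'M[R]_(m, n)) :
  has_sup [set enorm (A *m u) | u in [set u : 'cV[R]_n | enorm u <= 1]].
Proof.
split; first by exists (enorm (A *m 0)), 0 => //=; rewrite enorm0.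
exists (fnorm A) => _ [u /= hu <-].
apply: le_of_sqr_le; first exact: sqrtr_ge0.
rewrite enorm_sqr; apply: le_trans (mulmx_fnorm _ _) _.
rewrite ler_piMr ?sqr_ge0 // -enorm_sqr expr_le1 //; exact: enorm_ge0.
Qed.

Lemma specnorm_ub m n (A : 'M[R]_(m, n)) u :
  enorm (A *m u) <= specnorm A * enorm u.
Proof.
have [->|u0] := eqVneq u 0; first by rewrite mulmx0 !enorm0 mulr0.
have hn : enorm u != 0 by apply: contra_neq u0; exact: enorm_eq0.
have hp : 0 < enorm u by rewrite lt_def hn enorm_ge0.
rewrite -ler_pdivrMr //.
have -> : enorm (A *m u) / enorm u = enorm (A *m ((enorm u)^-1 *: u)).
  by rewrite -scalemxAr enormZ ger0_norm ?invr_ge0 ?enorm_ge0 // mulrC.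
apply: ub_le_sup; first exact: (specnorm_has_sup A).2.
exists ((enorm u)^-1 *: u) => //=.
by rewrite enormZ ger0_norm ?invr_ge0 ?enorm_ge0 // mulVf.
Qed.

Lemma specnorm_ge0 m n (A : 'M[R]_(m, n)) : 0 <= specnorm A.
Proof.
apply: le_trans (_ : enorm (A *m 0) <= _); first exact: enorm_ge0.
by apply: ub_le_sup; [exact: (specnorm_has_sup A).2|exists 0 => //=; rewrite enorm0].
Qed.

Lemma specnorm_le m n (A : 'M[R]_(m, n)) (c : R) : 0 <= c ->
  (forall u, dotv (A *m u) (A *m u) <= c ^+ 2 * dotv u u) -> specnorm A <= c.
Proof.
move=> c0 h; apply: ge_sup; first exact: (specnorm_has_sup A).1.
move=> _ [u /= hu <-]; apply: le_of_sqr_le => //.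
rewrite enorm_sqr; apply: le_trans (h u) _.
rewrite ler_piMr ?sqr_ge0 // -enorm_sqr expr_le1 //; exact: enorm_ge0.
Qed.

Lemma specnorm_dotv n (A : 'M[R]_n) u w :
  `|dotv u (A *m w)| <= specnorm A * enorm u * enorm w.
Proof.
apply: le_trans (dotv_abs_le _ _) _.
rewrite mulrC mulrAC ler_wpM2r ?enorm_ge0 //; exact: specnorm_ub.
Qed.

Lemma specnorm_qf n (A : 'M[R]_n) u : `|qf A u| <= specnorm A * dotv u u.
Proof. by rewrite -enorm_sqr expr2 mulrA; exact: specnorm_dotv. Qed.

Lemma dotv_col m n (x x' : 'cV[R]_m) (y y' : 'cV[R]_n) :
  dotv (col_mx x y) (col_mx x' y') = dotv x x' + dotv y y'.
Proof.
rewrite /dotv big_split_ord; congr (_ + _); apply: eq_bigr => i _.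
  by rewrite !col_mxEu.
by rewrite !col_mxEd.
Qed.

(** Peel off the first row and column and recurse on the Schur complement. *)
Lemma cholesky n (M : 'M[R]_n) : M^T = M ->
  (forall u, u != 0 -> 0 < qf M u) -> exists B : 'M[R]_n, M = B *m B^T.
Proof.
elim: n M => [|n IH] M hs hp.
  by exists 0; rewrite [M]flatmx0 [RHS]flatmx0.
change 'M[R]_(1 + n) in M.
pose a := M 0 0; pose c : 'cV[R]_n := dlsubmx M; pose M1 : 'M[R]_n := drsubmx M.
have hM : M = block_mx a%:M c^T c M1.
  rewrite -[M]submxK; congr (block_mx _ _ _ _).
    by apply/matrixP => i j; rewrite !ord1 !mxE /a eqxx mulr1n; congr (M _ _);
      apply/val_inj.
  by rewrite /c trmx_dlsub hs.
have hM1 : M1^T = M1 by rewrite /M1 trmx_drsub hs.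
have qfM (t : R) (u : 'cV[R]_n) :
    qf M (col_mx t%:M u) = a * t ^+ 2 + 2 * t * dotv c u + qf M1 u.
  rewrite /qf hM mul_block_col -scalar_mxM mul_mx_scalar dotv_col.
  have e1 (x : 'cV[R]_1) : dotv t%:M x = t * x 0 0.
    by rewrite /dotv big_ord1 !mxE eqxx mulr1n.
  have e2 : (c^T *m u) 0 0 = dotv c u.
    by rewrite mxE; apply: eq_bigr => i _; rewrite mxE.
  rewrite e1 mxE e2 !mxE eqxx mulr1n dotvDr dotvZr (dotvC u c).
  by ring.
have a0 : 0 < a.
  have := hp (col_mx (1%:M : 'M[R]_1) (0 : 'cV[R]_n)); rewrite qfM expr1n dotv0r mulr0 addr0 /qf dotv0l.
  rewrite mulr1 addr0; apply.
  apply/eqP => /colP /(_ 0) /eqP; rewrite mxE; case: splitP => // j _.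
  by rewrite !mxE ord1 eqxx oner_eq0.
have [] := IH (M1 - a^-1 *: (c *m c^T)).
- by rewrite linearB /= linearZ /= outer_sym hM1.
- move=> u u0.
  (* the first coordinate that minimizes the form, given u *)
  have := hp (col_mx ((- dotv c u / a)%:M : 'M[R]_1) u); rewrite qfM => h.
  rewrite qf_addl qf_opp qf_scalel qf_outer.
  have -> : qf M1 u - a^-1 * dotv c u ^+ 2 =
     a * (- dotv c u / a) ^+ 2 + 2 * (- dotv c u / a) * dotv c u + qf M1 u.
    by field; rewrite gt_eqF.
  apply: h; apply: contra_neq u0 => h0.
  by rewrite -(col_mxKd ((- dotv c u / a)%:M : 'M[R]_1) u) h0 linear0.
move=> B1 hB1; pose s := Num.sqrt a.
have hs2 : s ^+ 2 = a by rewrite sqr_sqrtr // ltW.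
have s0 : s != 0 by rewrite sqrtr_eq0 -ltNge.
pose B := block_mx (s%:M : 'M[R]_1) (0 : 'rV[R]_n) (s^-1 *: c) B1.
suff e : B *m B^T = M by exists B; rewrite e.
rewrite /B tr_block_mx mulmx_block !trmx0 !mulmx0 !mul0mx !addr0 -hB1 tr_scalar_mx.
rewrite -scalar_mxM -expr2 hs2 hM; congr block_mx.
- by rewrite linearZ /= mul_scalar_mx scalerA divff // scale1r.
- by rewrite mul_mx_scalar scalerA divff // scale1r.
- rewrite linearZ /= -scalemxAl -scalemxAr scalerA -expr2 exprVn hs2.
  by rewrite addrC subrK.
Qed.

End SpecNorm.

(** * The sketching event for a rank one perturbation *)

Section Sketch.
Variables (R : realType) (d l : nat).
Implicit Types (S : 'M[R]_(d, l)) (v x : 'cV[R]_d) (N : 'M[R]_d).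

(** The vector [s v + N x] is [(v v^T + N) y] for a suitable [y], and [s] and
    [x] may be chosen freely because [N] kills [v].  Testing the sketching event
    on [B^T y] with [B B^T = v v^T + N] turns it into this two-parameter bound. *)
Definition sandwich S v N (beta : R) := forall (s : R) x,
  let w := s *: (S^T *m v) + S^T *m (N *m x) in
  `|dotv w w - (s ^+ 2 + dotv (N *m x) (N *m x))| <= beta * (s ^+ 2 + qf N x).

Lemma specnorm_factor (B M : 'M[R]_d) (c : R) : M = B *m B^T -> 0 <= c ->
  (forall x, qf M x <= c * dotv x x) -> specnorm B ^+ 2 <= c.
Proof.
move=> hM c0 h.
suff : specnorm B <= Num.sqrt c.
  rewrite -(ler_pXn2r (n := 2)) ?nnegrE ?specnorm_ge0 ?sqrtr_ge0 //.
  by rewrite sqr_sqrtr.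
apply: specnorm_le => [|u]; first exact: sqrtr_ge0.
rewrite sqr_sqrtr //; set y := B *m u.
have h1 : dotv y y = dotv u (B^T *m y) by rewrite dotv_trmx trmxK.
have h2 : dotv (B^T *m y) (B^T *m y) = qf M y.
  by rewrite /qf hM -mulmxA (dotv_trmx _ y).
have h3 : dotv y y ^+ 2 <= dotv u u * (c * dotv y y).
  rewrite {1}h1; apply: le_trans (dotv_CS _ _) _.
  by rewrite ler_wpM2l ?dotv_ge0 // h2.
have [->|h0] := eqVneq (dotv y y) 0; first by rewrite mulr_ge0 ?dotv_ge0.
have hp : 0 < dotv y y by rewrite lt_def h0 dotv_ge0.
rewrite -(ler_pM2r hp) -expr2; apply: le_trans h3 _.
by rewrite le_eqVlt; apply/orP; left; apply/eqP; ring.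
Qed.

(** A Cholesky factor of [v v^T + N] is the only matrix to which the sketching
    hypothesis is applied.  Its spectral norm and its Frobenius norm are read off
    from the largest value [mu0] and the trace of the form. *)
Lemma sketch_sandwich v N (mu0 beta k : R) : dotv v v = 1 -> psd N ->
  N *m v = 0 -> (forall x, dotv v x = 0 -> x != 0 -> 0 < qf N x) ->
  0 <= mu0 -> (forall x, qf (v *m v^T + N) x <= mu0 * dotv x x) ->
  0 < k -> 1 / 4 * (mu0 + (1 + \tr N) / k) <= beta ->
  exists B : 'M[R]_d, forall S,
    specnorm (B^T *m S *m S^T *m B - B^T *m B) <=
      1 / 4 * (specnorm B ^+ 2 + fnorm B ^+ 2 / k) ->
    sandwich S v N beta.
Proof.
move=> hv hN hNv hpos mu00 hmu k0 hbeta; set M := v *m v^T + N.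
have hMs : M^T = M by rewrite /M linearD /= outer_sym hN.1.
have qM x : qf M x = dotv v x ^+ 2 + qf N x by rewrite qf_addl qf_outer.
have [B hB] : exists B : 'M[R]_d, M = B *m B^T.
  apply: cholesky => // u u0; rewrite qM.
  have [h|h] := eqVneq (dotv v u) 0; first by rewrite h expr0n add0r hpos.
  by rewrite ltr_pwDl ?hN.2 // exprn_even_gt0.
exists B => S hS s x /=; set w := s *: (S^T *m v) + _.
(* v v^T + N maps this vector to s v + N x *)
pose y := (s - dotv v x) *: v + x.
have hMy : M *m y = s *: v + N *m x.
  rewrite /M /y mulmxDl !mulmxDr -!scalemxAr !mulmx_outer hv hNv.
  by rewrite scaler0 add0r scale1r -scalerDl subrK.
have hqy : qf M y = s ^+ 2 + qf N x.
  rewrite /qf hMy /y dotvDl !dotvDr !dotvZl !dotvZr hv (dotvC x v).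
  have -> : dotv v (N *m x) = 0 by rewrite (dotv_sym _ _ hN.1) hNv dotv0r.
  by rewrite -/(qf N x); ring.
pose z := B^T *m y.
have hz : dotv z z = s ^+ 2 + qf N x by rewrite -hqy /qf hB -mulmxA (dotv_trmx _ y).
have hBz : B *m z = M *m y by rewrite /z mulmxA -hB.
have := specnorm_qf (B^T *m S *m S^T *m B - B^T *m B) z.
have -> : qf (B^T *m S *m S^T *m B - B^T *m B) z =
   dotv w w - (s ^+ 2 + dotv (N *m x) (N *m x)).
  rewrite qf_addl qf_opp; congr (_ - _).
    rewrite /qf -!mulmxA dotv_trmx trmxK dotv_trmx hBz hMy.
    by rewrite mulmxDr -scalemxAr.
  rewrite /qf -!mulmxA dotv_trmx trmxK hBz hMy dotvDl !dotvDr !dotvZl !dotvZr hv.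
  have -> : dotv v (N *m x) = 0 by rewrite (dotv_sym _ _ hN.1) hNv dotv0r.
  have -> : dotv (N *m x) v = 0 by rewrite dotvC (dotv_sym _ _ hN.1) hNv dotv0r.
  by ring.
move=> /le_trans; apply; rewrite hz ler_wpM2r //.
  by rewrite addr_ge0 ?sqr_ge0 ?hN.2.
apply: le_trans hS _; apply: le_trans hbeta.
rewrite ler_wpM2l //; apply: lerD.
  exact: specnorm_factor hB mu00 hmu.
rewrite fnorm_sqr_tr -hB /M mxtraceD.
apply: ler_wpM2r; first by rewrite invr_ge0 ltW.
rewrite lerD2r.
rewrite mxtrace_mulC /mxtrace big_ord1 mxE -hv le_eqVlt; apply/orP; left.
by apply/eqP; apply: eq_bigr => i _; rewrite mxE.
Qed.

Section Facts.
Variables (S : 'M[R]_(d, l)) (v : 'cV[R]_d) (N : 'M[R]_d) (beta b m : R).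
Hypotheses (hN : psd N) (hS : sandwich S v N beta) (b0 : 0 < b).
Hypotheses (hm : forall x, dotv (N *m x) (N *m x) <= m * qf N x).
Hypotheses (m0 : 0 <= m) (hb : beta + m <= b).
Let u := S^T *m v.

(** With [w = S^T (g t v + N S r / b)], where [t = u.r], the left hand side is
    [w.r]; the upper half of the sandwich gives [|w|^2 <= w.r], and Cauchy-Schwarz
    concludes. *)
Lemma sandwich_upper (g : R) r : 0 <= g -> g * (1 + beta) <= 1 ->
  g * dotv u r ^+ 2 + b^-1 * qf N (S *m r) <= dotv r r.
Proof.
move=> g0 hg; set t := dotv u r; set Q := _ + _.
have q0 : 0 <= qf N (S *m r) by exact: hN.2.
have Q0 : 0 <= Q by rewrite addr_ge0 // mulr_ge0 ?sqr_ge0 // invr_ge0 ltW.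
have := hS (g * t) (b^-1 *: (S *m r)) => /=; rewrite -/u.
set w := (g * t) *: u + _; rewrite ler_norml => /andP[_ hw].
have hwr : dotv w r = Q.
  rewrite /w dotvDl dotvZl -/t (dotvC _ r) dotv_trmx trmxK -scalemxAr dotvZr.
  by rewrite /Q /qf; ring.
have hww : dotv w w <= Q.
  have h1 := hm (b^-1 *: (S *m r)).
  move: hw h1; rewrite qfZ => hw h1.
  have h2 : dotv w w <= (g * t) ^+ 2 * (1 + beta) + (beta + m) * (b^-1 ^+ 2 * qf N (S *m r)).
    by move: hw h1; set A := dotv _ _; set B := dotv _ _; lra.
  apply: le_trans h2 _; rewrite /Q; apply: lerD.
    have -> : (g * t) ^+ 2 * (1 + beta) = (g * (1 + beta)) * (g * t ^+ 2) by ring.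
    by rewrite ler_piMl // mulr_ge0 ?sqr_ge0.
  have -> : (beta + m) * (b^-1 ^+ 2 * qf N (S *m r)) =
     ((beta + m) / b) * (b^-1 * qf N (S *m r)) by field; rewrite gt_eqF.
  rewrite ler_piMl //; first by rewrite mulr_ge0 // invr_ge0 ltW.
  by rewrite ler_pdivrMr // mul1r.
have h3 := dotv_CS w r; rewrite hwr in h3.
have h4 : Q * Q <= Q * dotv r r.
  rewrite -expr2; apply: le_trans h3 _; by rewrite ler_wpM2r ?dotv_ge0.
have [h|h] := eqVneq Q 0; first by rewrite h dotv_ge0.
by rewrite -(ler_pM2l (_ : 0 < Q)) // lt_def h Q0.
Qed.

(** At [x = - S u / (2 b)] the vector [u + S^T N x] is [(u + D u) / 2], and the
    lower half of the sandwich bounds its length from below. *)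
Lemma sandwich_lower (D : 'M[R]_l) : D = 1%:M - b^-1 *: (S^T *m N *m S) ->
  4 * (1 - beta) <= 2 * dotv u u + qf D u + dotv (D *m u) (D *m u).
Proof.
move=> hD.
have := hS 1 (- (2 * b)^-1 *: (S *m u)) => /=; rewrite -/u scale1r.
set x := - _ *: _; set w := u + _; rewrite ler_norml => /andP[hw _].
have ew : w = 2^-1 *: (u + D *m u).
  rewrite /w /x hD mulmxBl mul1mx -scalemxAl -!scalemxAr -!mulmxA.
  set y := S^T *m _; apply/colP => i; rewrite !mxE.
  by field; rewrite gt_eqF.
have hww : dotv w w = (dotv u u + 2 * qf D u + dotv (D *m u) (D *m u)) / 4.
  rewrite ew dotvZl dotvZr dotvDl !dotvDr (dotvC (D *m u) u) -/(qf D u).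
  by field.
have hq : qf N (S *m u) = b * (dotv u u - qf D u).
  rewrite hD qf_addl qf_opp qf1 qf_scalel qf_congr.
  by field; rewrite gt_eqF.
have hqx : qf N x = (dotv u u - qf D u) / (4 * b).
  rewrite /x qfZ hq; field; by rewrite gt_eqF.
have hu0 : 0 <= dotv u u - qf D u.
  have := hN.2 (S *m u); rewrite hq pmulr_rge0 //.
have hx0 := dotv_ge0 (N *m x).
have hbb : beta * qf N x <= (dotv u u - qf D u) / 4.
  rewrite hqx.
  have -> : beta * ((dotv u u - qf D u) / (4 * b)) =
    (beta / b) * ((dotv u u - qf D u) / 4) by field; rewrite gt_eqF.
  rewrite ler_piMl //; first by rewrite divr_ge0.
  by rewrite ler_pdivrMr // mul1r; apply: le_trans hb; rewrite lerDl.
move: hw; rewrite hww expr1n; lra.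
Qed.

End Facts.
End Sketch.

(** * Polynomial inequalities *)

Section Polynomials.
Variable R : realType.
Implicit Types a c e k t x y : R.

Lemma cubic_le_affine t : 0 <= t -> t <= 14/25 ->
  (1 - t) ^+ 3 * (1 + 2 * t) <= 103/100 - 3/2 * t.
Proof.
move=> h0 h1.
have -> : 103/100 - 3/2 * t = (1 - t) ^+ 3 * (1 + 2 * t)
    + (3/100 - t/2 + 3 * t ^+ 2 - 5 * t ^+ 3 + 2 * t ^+ 4) by field.
rewrite lerDl.
have [h|h] := lerP t (3/20).
  have h2 : 0 <= t ^+ 2 * (3/20 - t) by apply: mulr_ge0; [exact: sqr_ge0|lra].
  have h4 : 0 <= (t ^+ 2) ^+ 2 by exact: sqr_ge0.
  have h3 := sqr_ge0 (t - 11/100); nra.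
have h2 : 0 <= (t - 3/20) * (14/25 - t) by apply: mulr_ge0; lra.
nra.
Qed.

Lemma cubic_le_fifth t : 14/25 <= t -> t <= 1 ->
  (1 - t) ^+ 3 * (1 + 2 * t) <= 1/5.
Proof.
move=> h0 h1.
have h2 : (1 - t) * (1 + 2 * t) <= 14/15 by nra.
have h3 : (1 - t) ^+ 2 <= 1/5 by nra.
have h4 : 0 <= (1 - t) * (1 + 2 * t) by apply: mulr_ge0; lra.
by rewrite exprSr -mulrA; have := ler_pM (sqr_ge0 _) h4 h3 h2; lra.
Qed.

Lemma cubic3_le1 t : 0 <= t -> t <= 1 -> (1 - t) ^+ 3 * (1 + 3 * t) <= 1.
Proof.
move=> h0 h1.
have -> : (1 - t) ^+ 3 * (1 + 3 * t) = 1 - t ^+ 2 * (6 - 8 * t + 3 * t ^+ 2) by ring.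
rewrite gerBl mulr_ge0 ?sqr_ge0 //.
have := sqr_ge0 (1 - t); have := sqr_ge0 t; nra.
Qed.

Lemma cubic2_le1 t : 0 <= t -> t <= 1 ->
  (1 - t) ^+ 3 * (1 + 2 * t) <= 1.
Proof.
move=> h0 h1; apply: le_trans (cubic3_le1 h0 h1).
by apply: ler_wpM2l; [apply: exprn_ge0; lra|lra].
Qed.

Lemma cubic_sum_le x y : 0 <= x -> x <= 1 -> 0 <= y -> y <= 1 -> 14/25 <= x + y ->
  (1 - x) ^+ 3 * (1 + 2 * x) + (1 - y) ^+ 3 * (1 + 2 * y) <= 61/50.
Proof.
move=> x0 x1 y0 y1 h.
have b1 := cubic2_le1 x0 x1; have b2 := cubic2_le1 y0 y1.
have [hx|hx] := lerP x (14/25); last by have := cubic_le_fifth (ltW hx) x1; lra.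
have [hy|hy] := lerP y (14/25); last by have := cubic_le_fifth (ltW hy) y1; lra.
by have := cubic_le_affine x0 hx; have := cubic_le_affine y0 hy; lra.
Qed.

Lemma cubic_weight_le t : 8/45 <= t -> t <= 33/50 ->
  (2 + t + t ^+ 2) * (2/27 + 3/20 * (1 - t) ^+ 3) <= 9/25.
Proof.
move=> h0 h1.
have hp : 0 <= (t - 8/45) * (33/50 - t) by apply: mulr_ge0; lra.
have hL : (1 - t) ^+ 3 <= 3/4 - 15/14 * t.
  have h2 : 0 <= ((t - 8/45) * (33/50 - t)) * (1 - t) by apply: mulr_ge0; lra.
  nra.
have h2 : 0 <= 2 + t + t ^+ 2 by rewrite addr_ge0 ?sqr_ge0; lra.
apply: le_trans (_ : (2 + t + t ^+ 2) * (2/27 + 3/20 * (3/4 - 15/14 * t)) <= _).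
  by apply: ler_wpM2l => //; lra.
have h3 : 0 <= ((t - 8/45) * (33/50 - t)) * t by apply: mulr_ge0; lra.
nra.
Qed.

(** Here [a] and [e] stand for [|u|^2] and the value of the form [E] at [u],
    and [k] for the inverse square of [C2].  The constant exceeds [1/8] by
    [1/200], a slack spent on the bias. *)
Lemma gain_bound a e k c xi : 0 <= k -> k <= 4/5 ->
  xi = 50/91 + 2/25 * k -> 9/50 + 27/100 * k <= c ->
  0 <= a -> 0 <= e -> e + xi * a ^+ 2 <= a -> 2 * c <= a + (e + xi * a ^+ 2) ->
  13/100 <= a / 2 + e / 4.
Proof.
move=> k0 k1 hxi hc a0 e0 h1 h2.
have [h|h] := lerP (13/50) a; first by lra.
have ha : 9/50 <= a by lra.
suff : 13/100 <= c / 2 + a / 4 - xi * a ^+ 2 / 4 by lra.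
have h3 : 0 <= (a - 9/50) * (13/50 - a) by apply: mulr_ge0; lra.
have h4 : k * a ^+ 2 <= k * (13/50) by apply: ler_wpM2l => //; nra.
rewrite hxi; clear -h h3 h4 ha hc k0; nra.
Qed.

Lemma sqr_sum_le3 x y : 0 <= x <= 1 -> 0 <= y <= 1 ->
  x ^+ 2 + x * y + y ^+ 2 <= 3.
Proof.
move=> /andP[x0 x1] /andP[y0 y1].
have h (p q : R) : 0 <= p -> p <= 1 -> 0 <= q -> q <= 1 -> p * q <= 1.
  by move=> *; rewrite mulr_ile1.
have := h _ _ x0 x1 x0 x1; have := h _ _ x0 x1 y0 y1; have := h _ _ y0 y1 y0 y1.
rewrite !expr2; lra.
Qed.

(** Two columns are the tight case: both [t'], the amount by which the columns
    are shortened, and [a = |u|^2] are coupled through the trace [t] of [D].  If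
    [a] is small, the lower sandwich forces [t] to be large, hence the columns to
    be short, hence the bias to be small.  The inequality is affine in
    the squared bias, hence follows from the extreme values [0] and [1/25]. *)
Lemma two_columns_bound a t k c t' X2 : 0 <= k -> k <= 4/5 ->
  9/50 + 27/100 * k <= c -> 0 <= a -> 50/91 * a <= t ->
  t = t' + 4/15 * k * a -> 0 <= t' -> t' <= 14/25 ->
  4 * c <= a * (2 + t + t ^+ 2) -> 0 <= X2 -> X2 <= 1/25 ->
  1/8 - 5 * X2 <= a/2 - 67/18 * X2 * (1 + (1 - t') ^+ 3).
Proof.
move=> k0 k1 hc a0 hta ht t'0 t'1 hE X0 X1.
have hka : 0 <= k * a by exact: mulr_ge0.
have t0 : 0 <= t by lra.
have A1 : 1/4 <= a.
  rewrite leNgt; apply/negP => ha.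
  have h0 : k * a <= k * (1/4) by apply: ler_wpM2l => //; lra.
  have h1 : t <= 14/25 + 7/100 * k by lra.
  have h2 : t ^+ 2 <= (14/25 + 7/100 * k) ^+ 2.
    by rewrite ler_pXn2r // nnegrE; lra.
  have hk2 : k ^+ 2 <= 4/5 * k by rewrite expr2; apply: ler_wpM2r.
  have h3 : 2 + t + t ^+ 2 <= 2 + 7/8 + 16/100 * k.
    apply: le_trans (_ : 2 + (14/25 + 7/100 * k) + (14/25 + 7/100 * k) ^+ 2 <= _).
      by lra.
    by rewrite sqrrD exprMn; lra.
  have : a * (2 + t + t ^+ 2) <= 1/4 * (2 + 7/8 + 16/100 * k).
    apply: ler_pM => //; last by lra.
    by rewrite addr_ge0 ?sqr_ge0; lra.
  lra.
have c3 : 0 <= (1 - t') ^+ 3 by apply: exprn_ge0; lra.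
have c3' : (1 - t') ^+ 3 <= 1 by apply: exprn_ile1; lra.
have A2 : 2/27 + 3/20 * (1 - t') ^+ 3 <= a/2.
  have [h|h] := lerP (9/20) a; first by lra.
  have h0 : k * a <= k * (9/20) by apply: ler_wpM2l => //; lra.
  have hl : 4/15 * k * a <= 12/100 * k by lra.
  have t1 : t <= 33/50 by lra.
  have h1 : (1 - t') ^+ 3 <= (1 - t) ^+ 3 + 3 * (12/100 * k).
    set e := 4/15 * k * a in hl ht; have e0 : 0 <= e by rewrite /e; lra.
    have -> : (1 - t') ^+ 3 = (1 - t) ^+ 3 +
        e * ((1 - t') ^+ 2 + (1 - t') * (1 - t) + (1 - t) ^+ 2) by rewrite ht; ring.
    have h2 : (1 - t') ^+ 2 + (1 - t') * (1 - t) + (1 - t) ^+ 2 <= 3.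
      by apply: sqr_sum_le3; apply/andP; split; lra.
    have h3 : e * ((1 - t') ^+ 2 + (1 - t') * (1 - t) + (1 - t) ^+ 2) <= e * 3.
      by apply: ler_wpM2l.
    lra.
  have p0 : 0 < 2 + t + t ^+ 2 by have := sqr_ge0 t; lra.
  have tl : 8/45 <= t.
    rewrite leNgt; apply/negP => ht1.
    have h2 : t ^+ 2 <= (8/45) ^+ 2 by rewrite ler_pXn2r ?nnegrE //; lra.
    have h3 : a * (2 + t + t ^+ 2) <= a * (221/100) by apply: ler_wpM2l => //; lra.
    lra.
  have h2 := cubic_weight_le tl t1.
  have ht2 : t ^+ 2 <= (33/50) ^+ 2 by rewrite ler_pXn2r ?nnegrE //; lra.
  have h3 : 2 + t + t ^+ 2 <= 31/10 by lra.
  rewrite -(ler_pM2l p0).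
  have h4 : (2 + t + t ^+ 2) * (27/50 * k) <= 31/10 * (27/50 * k).
    by apply: ler_wpM2r => //; lra.
  have h5 : (2 + t + t ^+ 2) * (2/27 + 3/20 * (1 - t') ^+ 3) <=
    (2 + t + t ^+ 2) * (2/27 + 3/20 * (1 - t) ^+ 3 + 27/50 * k / 10).
    by apply: ler_wpM2l; [exact: ltW|clear -h1; lra].
  clear -h2 h4 h5 hE hc k0.
  set q := 2 + t + t ^+ 2 in h2 h4 h5 hE *.
  set z := (1 - t) ^+ 3 in h2 h5; set z' := (1 - t') ^+ 3 in h5 *.
  lra.
set Z := (1 - t') ^+ 3 in c3 c3' A2 *.
have h1 : 0 <= X2 * (a/2 - 2/27 - 3/20 * Z) by apply: mulr_ge0; lra.
have h2 : 0 <= (1/25 - X2) * (a/2 - 1/8) by apply: mulr_ge0; lra.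
have h3 : 0 <= X2 * Z by apply: mulr_ge0.
clear -h1 h2 h3 X0; lra.
Qed.

End Polynomials.

(** * Dominant gradient: combining gain and bias *)

Section SmallCore.
Variable R : realType.

Lemma psd_young n (M : 'M[R]_n) (t : R) x y : psd M -> 0 < t ->
  qf M (x + y) <= (1 + t) * qf M x + (1 + t^-1) * qf M y.
Proof.
move=> hM t0; rewrite qfD ?hM.1 //.
have := hM.2 (t *: x - y); rewrite qfD ?hM.1 // -scaleN1r !qfZ.
rewrite -!scalemxAr dotvZl dotvZr => h.
rewrite -(ler_pM2l t0) -subr_ge0.
suff -> : t * ((1 + t) * qf M x + (1 + t^-1) * qf M y) -
  t * (qf M x + qf M y + 2 * dotv x (M *m y)) =
  t ^+ 2 * qf M x + (- 1) ^+ 2 * qf M y + 2 * (t * (- 1 * dotv x (M *m y))).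
  exact: h.
by field; rewrite gt_eqF.
Qed.

Lemma dotv_young n (t : R) (x y : 'cV[R]_n) : 0 < t ->
  dotv (x + y) (x + y) <= (1 + t) * dotv x x + (1 + t^-1) * dotv y y.
Proof. by move=> t0; have := psd_young x y (psd1 R n) t0; rewrite !qf1. Qed.

(** Rearranges [M x <= 2 M (x + y) + 2 M y]. *)
Lemma psd_half n (M : 'M[R]_n) x y : psd M ->
  qf M x / 2 - qf M y <= qf M (x + y).
Proof.
move=> hM; have := psd_young (x + y) (- y) hM (@ltr01 R).
by rewrite addrK invr1 -scaleN1r qfZ sqrrN expr1n mul1r; lra.
Qed.

Variables (l : nat) (E : 'M[R]_l) (u rX rY : 'cV[R]_l) (k c X Y : R).
Let xi : R := 50/91 + 2/25 * k.
Let lam : R := 4/15 * k.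
(* th i is the deficit of column i: k |s_i|^2 will be at most 328/87 (1 - th i),
   and 268/5 is slightly above the cube of 328/87 *)
Let D := E + xi *: (u *m u^T).
Let a := dotv u u.
Let th (i : 'I_l) := E i i + (xi - lam) * u i 0 ^+ 2.
Hypotheses (hE : psd E) (k0 : 0 <= k) (k1 : k <= 4/5).
Hypothesis (hc : 9/50 + 27/100 * k <= c).
Hypothesis (hD : forall r, qf D r <= dotv r r).
Hypothesis (hE1 : 4 * c <= 2 * a + qf D u + dotv (D *m u) (D *m u)).
Hypothesis (hY : dotv rY rY <= Y ^+ 2).

Let xi0 : 0 <= xi. Proof. by rewrite /xi; move: k0; lra. Qed.
Let xil : 0 <= xi - lam. Proof. by rewrite /xi /lam; move: k0 k1; lra. Qed.

Let hDp : psd D.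
Proof.
split=> [|r]; first by rewrite /D linearD linearZ /= outer_sym hE.1.
by rewrite /D qf_addl qf_scalel qf_outer addr_ge0 ?hE.2 // mulr_ge0 ?sqr_ge0.
Qed.

Let qD r : qf D r = qf E r + xi * dotv u r ^+ 2.
Proof. by rewrite /D qf_addl qf_scalel qf_outer. Qed.

Let a0 : 0 <= a. Proof. exact: dotv_ge0. Qed.

(** As [D <= 1], also [|D u|^2 <= u^T D u], so [sandwich_lower] bounds
    [a + u^T D u] from below. *)
Let small_gain : 13/100 <= a / 2 + qf E u / 4.
Proof.
have h1 := hD u; rewrite qD -/a in h1.
have h2 : dotv (D *m u) (D *m u) <= 1 * qf D u.
  by apply: psd_sqr_le => // r; rewrite mul1r.
apply: (gain_bound (xi := xi) k0 k1 _ hc a0 (hE.2 u)) => //.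
rewrite mul1r qD -/a in h2; have h3 := hE1; rewrite qD -/a in h3.
by move: h2 h3; lra.
Qed.

Let th0 i : 0 <= th i.
Proof. by rewrite addr_ge0 ?psd_diag // mulr_ge0 ?sqr_ge0. Qed.

Let Eth i : E i i <= th i.
Proof. by rewrite /th lerDl mulr_ge0 ?sqr_ge0. Qed.

Let F := (a - dotv (rX + rY) (rX + rY)) / 2 + qf E (u + (rX + rY)) / 2.

(** The form [E (u + r)] is at least half of [E u] minus [E r]; the first part
    is added to the gain [a], the second to the loss [|r|^2].  Young's inequality
    with weight [1/4] then separates bias and noise. *)
Lemma small_of_bias (m : R) : dotv rX rX + qf E rX <= m -> 5/8 * m <= 5 * X ^+ 2 + 1/200 ->
  1/8 - 5 * (X ^+ 2 + Y ^+ 2) <= F.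
Proof.
move=> hm hmX.
have h1 := psd_half u (rX + rY) hE.
have t4 : (0 : R) < 4^-1 by rewrite invr_gt0.
have h2 := psd_young rX rY hE t4; have h3 := dotv_young rX rY t4.
have h4 : qf E rY <= dotv rY rY.
  apply: le_trans (hD rY); rewrite qD lerDl mulr_ge0 ?sqr_ge0 //.
by move: small_gain h1 h2 h3 h4 hY hm hmX; rewrite /F invrK; lra.
Qed.

Lemma small_short_bias : dotv rX rX <= X ^+ 2 -> 1/8 - 5 * (X ^+ 2 + Y ^+ 2) <= F.
Proof.
move=> hX; apply: (small_of_bias (m := 2 * X ^+ 2)).
  have : qf E rX <= dotv rX rX.
    by apply: le_trans (hD rX); rewrite qD lerDl mulr_ge0 ?sqr_ge0.
  lra.
have := sqr_ge0 X; lra.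
Qed.

Hypothesis (hth : forall i, th i <= 1).
Hypothesis hX : forall i,
  rX i 0 ^+ 2 <= 268/5 * X ^+ 2 / l%:R ^+ 3 * (1 - th i) ^+ 3.

Let rXX : dotv rX rX = \sum_i rX i 0 ^+ 2.
Proof. by apply: eq_bigr => i _; rewrite expr2. Qed.

(** The factor [1 + l E_ii] bounds the total loss [|r|^2 + r^T E r]; it grows
    exactly where the columns, hence the coordinates of the bias, are short. *)
Let NX : (0 < l)%N -> dotv rX rX + qf E rX <=
  268/5 * X ^+ 2 / l%:R ^+ 3 * \sum_i (1 - th i) ^+ 3 * (1 + l%:R * th i).
Proof.
move=> l0; rewrite rXX mulr_sumr.
apply: le_trans (_ : \sum_i rX i 0 ^+ 2 * (1 + l%:R * th i) <= _).
  under [leRHS]eq_bigr do rewrite mulrDr mulr1.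
  rewrite big_split lerD2l /=; apply: le_trans (psd_qf_diag _ hE) _.
  rewrite mulr_sumr; apply: ler_sum => i _.
  by rewrite mulrA mulrC ler_wpM2l ?sqr_ge0 // ler_wpM2l.
apply: ler_sum => i _; rewrite mulrA ler_wpM2r //.
by rewrite addr_ge0 // mulr_ge0.
Qed.

(** The bias of [l] columns gains a factor [1 / l^2], which suffices crudely
    for [l >= 4].  For [l = 3] the trade-off between [E_ii] and the column lengths
    is needed. *)
Lemma small_many_columns : (3 <= l)%N -> 1/8 - 5 * (X ^+ 2 + Y ^+ 2) <= F.
Proof.
move=> l3; have X0 := sqr_ge0 X.
have l0 : (0 : R) < l%:R by rewrite ltr0n; apply: leq_trans l3.
have cX : 0 <= 268/5 * X ^+ 2 / l%:R ^+ 3.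
  by apply: divr_ge0; [apply: mulr_ge0; [lra|]|apply: exprn_ge0; exact: ltW].
have [l4|l4] := leqP 4 l.
  apply: (small_of_bias (m := 2 * (268/5 * X ^+ 2 / 16))); last by lra.
  have h1 : qf E rX <= dotv rX rX.
    by apply: le_trans (hD rX); rewrite qD lerDl mulr_ge0 ?sqr_ge0.
  suff : dotv rX rX <= 268/5 * X ^+ 2 / 16 by lra.
  rewrite rXX; apply: le_trans (_ : \sum_(i < l) 268/5 * X ^+ 2 / l%:R ^+ 3 <= _).
    apply: ler_sum => i _; apply: le_trans (hX i) _.
    rewrite ler_piMr //; last by apply: exprn_ile1; have := th0 i; have := hth i; lra.
  rewrite sumr_const card_ord -[_ *+ l]mulr_natr.
  have -> : 268/5 * X ^+ 2 / l%:R ^+ 3 * l%:R = 268/5 * X ^+ 2 / l%:R ^+ 2.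
    by field; rewrite gt_eqF.
  apply: ler_wpM2l; first by apply: mulr_ge0; [lra|].
  rewrite lef_pV2 ?posrE ?exprn_gt0 //.
  have -> : (16 : R) = 4 ^+ 2 by ring.
  by rewrite ler_pXn2r ?nnegrE ?ler_nat // ltW.
have e3 : l = 3%N by apply/eqP; rewrite eqn_leq l3 -ltnS l4.
apply: (small_of_bias (m := 268/5 * X ^+ 2 / 9)); last by lra.
apply: le_trans (NX (leq_trans (isT : (0 < 3)%N) l3)) _.
have h : \sum_i (1 - th i) ^+ 3 * (1 + l%:R * th i) <= l%:R.
  rewrite -[leRHS](_ : \sum_(i < l) 1 = _); last by rewrite sumr_const card_ord.
  by apply: ler_sum => i _; rewrite e3; apply: cubic3_le1.
apply: le_trans (_ : 268/5 * X ^+ 2 / l%:R ^+ 3 * l%:R <= _).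
  by rewrite ler_wpM2l.
by rewrite e3; lra.
Qed.

(** If the columns are markedly shortened, the argument for many columns
    applies.  Otherwise [E] is dropped altogether and the trace of [D] links the
    bias to [|u|^2]. *)
Lemma small_two_columns : l = 2%N -> X ^+ 2 <= 1/25 -> 1/8 - 5 * (X ^+ 2 + Y ^+ 2) <= F.
Proof.
move=> l2 X25; have X0 := sqr_ge0 X; have hl2 : (l%:R : R) = 2 by rewrite l2.
have s2 (f : 'I_l -> R) : exists i j : 'I_l, forall g : 'I_l -> R, \sum_i g i = g i + g j.
  rewrite l2 in f *; exists ord0, (lift ord0 ord0) => g.
  by rewrite big_ord_recl big_ord1.
have [i [j hs]] := s2 (fun=> 0).
have hsum : th i + th j = \tr D - lam * a.
  rewrite -hs /th big_split /= -mulr_sumr /D mxtraceD mxtraceZ.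
  have -> : \tr (u *m u^T) = a by apply: eq_bigr => p _; rewrite mxE big_ord1 mxE.
  have -> : \sum_i u i 0 ^+ 2 = a by apply: eq_bigr => p _; rewrite expr2.
  by rewrite -/(\tr E); ring.
have [ht|ht] := lerP (14/25) (th i + th j).
  (* the columns are shortened enough for cubic_sum_le *)
  apply: (small_of_bias (m := 268/5 * X ^+ 2 / 8 * (61/50))); last by lra.
  have l0 : (0 < l)%N by rewrite l2.
  apply: le_trans (NX l0) _; rewrite hs hl2.
  have -> : (2 : R) ^+ 3 = 8 by ring.
  apply: ler_wpM2l; last exact: cubic_sum_le.
  by apply: divr_ge0; [apply: mulr_ge0; [lra|]|].
have hdots : dotv (D *m u) (D *m u) <= \tr D * qf D u by exact: psd_sqr_tr.
have trD0 : 0 <= \tr D by apply: sumr_ge0 => p _; exact: psd_diag.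
have hqt : qf D u <= \tr D * a.
  have h1 := psd_sqr_tr u hDp.
  have h2 : qf D u ^+ 2 <= a * dotv (D *m u) (D *m u) by rewrite /qf; exact: dotv_CS.
  have h3 : qf D u * qf D u <= (\tr D * a) * qf D u.
    rewrite -expr2; apply: le_trans h2 _.
    have -> : \tr D * a * qf D u = a * (\tr D * qf D u) by ring.
    by apply: ler_wpM2l.
  have [->|h0] := eqVneq (qf D u) 0; first by rewrite mulr_ge0.
  by rewrite -(ler_pM2r (_ : 0 < qf D u)) // lt_def h0 hDp.2.
have hE2 : 4 * c <= a * (2 + \tr D + (\tr D) ^+ 2).
  apply: le_trans hE1 _.
  have : \tr D * qf D u <= \tr D * (\tr D * a) by apply: ler_wpM2l.
  by move: hqt hdots; rewrite mulrDr mulrDr expr2; lra.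
have htD : 50/91 * a <= \tr D.
  have -> : \tr D = \tr E + xi * a.
    rewrite /D mxtraceD mxtraceZ; congr (_ + _ * _).
    by apply: eq_bigr => p _; rewrite mxE big_ord1 mxE.
  have : 0 <= \tr E by apply: sumr_ge0 => p _; exact: psd_diag.
  have : 0 <= 2/25 * k * a by rewrite !mulr_ge0.
  by rewrite /xi; lra.
have h1 : \tr D = (th i + th j) + 4/15 * k * a by rewrite hsum /lam; ring.
have P1 := two_columns_bound k0 k1 hc a0 htD h1 (addr_ge0 (th0 i) (th0 j)) (ltW ht) hE2 X0 X25.
apply: le_trans (_ : a / 2 - 67/18 * X ^+ 2 * (1 + (1 - (th i + th j)) ^+ 3)
    - 5 * Y ^+ 2 <= _); first by lra.
rewrite /F.
have t9 : (0 : R) < 9^-1 by rewrite invr_gt0.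
have h3 := dotv_young rX rY t9; rewrite invrK in h3.
have h4 : dotv rX rX <= 67/10 * X ^+ 2 * (1 + (1 - (th i + th j)) ^+ 3).
  rewrite rXX hs; have := hX i; have := hX j; rewrite hl2.
  have -> : 268/5 * X ^+ 2 / (2 : R) ^+ 3 = 67/10 * X ^+ 2 by field.
  have := th0 i; have := th0 j; have := hth i; have := hth j.
  set p := th i; set q := th j => q1 p1 q0 p0 hi hj.
  have h5 : (1 - p) ^+ 3 + (1 - q) ^+ 3 <= 1 + (1 - (p + q)) ^+ 3.
    rewrite -subr_ge0.
    have -> : 1 + (1 - (p + q)) ^+ 3 - ((1 - p) ^+ 3 + (1 - q) ^+ 3) =
      3 * (p * q) * (2 - p - q) by ring.
    by apply: mulr_ge0; [rewrite !mulr_ge0|lra].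
  have : 67/10 * X ^+ 2 * ((1 - p) ^+ 3 + (1 - q) ^+ 3) <=
    67/10 * X ^+ 2 * (1 + (1 - (p + q)) ^+ 3) by apply: ler_wpM2l => //; rewrite mulr_ge0.
  by move: hi hj; lra.
by have := hE.2 (u + (rX + rY)); move: h3 h4 hY; lra.
Qed.

End SmallCore.

(** * Dominant gradient: curvature and cubic costs *)

Section Projection.
Variables (R : realType) (d : nat).
Implicit Types (v x p : 'cV[R]_d) (H : 'M[R]_d).

Definition perp_mx v : 'M[R]_d := 1%:M - v *m v^T.

Lemma perp_mxE v x : perp_mx v *m x = x - dotv v x *: v.
Proof. by rewrite mulmxBl mul1mx mulmx_outer. Qed.

Lemma perp_mx_sym v : (perp_mx v)^T = perp_mx v.
Proof. by rewrite linearB /= trmx1 outer_sym. Qed.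

Lemma perp_mx_v v : dotv v v = 1 -> perp_mx v *m v = 0.
Proof. by move=> hv; rewrite perp_mxE hv scale1r subrr. Qed.

Lemma qf_perp_mx v x : qf (perp_mx v) x = dotv x x - dotv v x ^+ 2.
Proof. by rewrite qf_addl qf_opp qf1 qf_outer. Qed.

Lemma sqr_perp_mx v x : dotv v v = 1 ->
  dotv (perp_mx v *m x) (perp_mx v *m x) = dotv x x - dotv v x ^+ 2.
Proof.
move=> hv; rewrite perp_mxE dotvBl !dotvBr !dotvZl !dotvZr hv (dotvC x v); ring.
Qed.

(** The curvature seen from [v]: the Hessian is compressed to the complement of
    [v], and the multiple of the projection makes the form definite there. *)
Definition test_form v H (A Z : R) : 'M[R]_d :=
  A *: (perp_mx v *m H *m perp_mx v) + Z *: perp_mx v.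

Lemma qf_test_form v H A Z x : qf (test_form v H A Z) x =
  A * qf H (perp_mx v *m x) + Z * (dotv x x - dotv v x ^+ 2).
Proof.
rewrite qf_addl !qf_scalel qf_perp_mx; congr (_ * _ + _).
by rewrite -{1}(perp_mx_sym v) qf_congr.
Qed.

Lemma test_form_v v H A Z : dotv v v = 1 -> test_form v H A Z *m v = 0.
Proof.
by move=> hv; rewrite mulmxDl -!scalemxAl -mulmxA perp_mx_v // !(mulmx0, scaler0, addr0).
Qed.

Lemma perp_mx_ge0 v x : dotv v v = 1 -> 0 <= dotv x x - dotv v x ^+ 2.
Proof. by move=> hv; rewrite -sqr_perp_mx // dotv_ge0. Qed.

Lemma psd_test_form v H A Z : dotv v v = 1 -> psd H -> 0 <= A -> 0 <= Z ->
  psd (test_form v H A Z).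
Proof.
move=> hv hH A0 Z0; split=> [|x]; last first.
  by rewrite qf_test_form addr_ge0 // mulr_ge0 ?hH.2 // perp_mx_ge0.
by rewrite linearD !linearZ /= !trmx_mul hH.1 perp_mx_sym mulmxA.
Qed.

(** Convexity of the form [H] between the direction [v] and its complement. *)
Lemma qf_split v H (t h : R) p : dotv v v = 1 -> psd H -> 0 < t -> qf H v <= h ->
  qf H p <= (1 + t) * qf H (perp_mx v *m p) + (1 + t^-1) * (dotv v p ^+ 2 * h).
Proof.
move=> hv hH t0 hh.
have {1}-> : p = perp_mx v *m p + dotv v p *: v by rewrite perp_mxE subrK.
apply: le_trans (psd_young _ _ hH t0) _; rewrite lerD2l qfZ.
rewrite ler_wpM2l ?ler_wpM2l ?sqr_ge0 // addr_ge0 // invr_ge0 ltW //.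
Qed.

End Projection.

Lemma dotv_sqD (R : realType) n (x y : 'cV[R]_n) :
  dotv (x + y) (x + y) = dotv x x + dotv y y + 2 * dotv x y.
Proof. by rewrite dotvDl !dotvDr (dotvC y x); ring. Qed.

Section SmallStep.
Variables (R : realType) (d l : nat).
Variables (S : 'M[R]_(d, l)) (v : 'cV[R]_d) (H : 'M[R]_d).
Variables (hn cH k beta : R).
Hypotheses (hv : dotv v v = 1) (hH : psd H) (hn0 : 0 < hn) (hn1 : hn < cH).
Hypothesis (hHn : forall x, qf H x <= hn * dotv x x).
Hypotheses (k0 : 0 < k) (k1 : k <= 4/5).
Let u := S^T *m v.
Let N := test_form v H (41/100 / (cH - hn)) (87/400 * k).
Hypothesis hS : sandwich S v N beta.
Hypothesis (hbeta : beta <= 41/50 - 87/320 * k).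
Variable m : R.
Hypotheses (m0 : 0 <= m) (hm : forall x, qf N x <= m * dotv x x).
Hypothesis (hbm : beta + m <= 41/50).
(* b = 41/50 bounds beta + m, and the weight of the projection is 87/400 k.
   xi is an affine lower bound of 1 / (1 + beta), with 50/91 = 1 / (1 + b);
   lam is slightly above the quotient of 87/400 k by b, and 328/87 is the quotient
   of b by 87/400. *)
Let xi : R := 50/91 + 2/25 * k.
Let lam : R := 4/15 * k.

Let A0 : 0 <= 41/100 / (cH - hn).
Proof. by rewrite divr_ge0 // subr_ge0 ltW. Qed.
Let hN : psd N.
Proof.
have h : 0 <= 87/400 * k by apply: mulr_ge0; [lra|exact: ltW].
exact: psd_test_form hv hH A0 h.
Qed.
Let D : 'M[R]_l := 1%:M - (41/50)^-1 *: (S^T *m N *m S).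
Let E := D - xi *: (u *m u^T).

Let qD r : qf D r = dotv r r - (41/50)^-1 * qf N (S *m r).
Proof. by rewrite qf_addl qf_opp qf1 qf_scalel qf_congr. Qed.

Let DE : D = E + xi *: (u *m u^T).
Proof. by rewrite subrK. Qed.

Let xi_beta : xi * (1 + beta) <= 1.
Proof.
apply: le_trans (_ : xi * (91/50 - 87/320 * k) <= _).
  by apply: ler_wpM2l; [rewrite /xi; move: k0; lra|move: hbeta; lra].
by rewrite /xi; have := mulr_ge0 (ltW k0) (ltW k0); move: k0; lra.
Qed.

(** This is [sandwich_upper] in matrix form. *)
Let hE : psd E.
Proof.
split=> [|r].
  rewrite /E /D !linearB !linearZ /= trmx1 outer_sym !trmx_mul trmxK hN.1.
  by rewrite mulmxA.
rewrite qf_addl qf_opp qf_scalel qf_outer qD.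
have h (x : 'cV[R]_d) : dotv (N *m x) (N *m x) <= m * qf N x by exact: psd_sqr_le.
have b0 : (0 : R) < 41/50 by lra.
have xi0 : 0 <= xi by rewrite /xi; move: k0; lra.
have := sandwich_upper hN hS b0 h hbm r xi0 xi_beta.
by rewrite -/u; lra.
Qed.

Let hD r : qf D r <= dotv r r.
Proof. by rewrite qD gerBl mulr_ge0 ?hN.2 // invr_ge0. Qed.

Let hE1 : 4 * (1 - beta) <= 2 * dotv u u + qf D u + dotv (D *m u) (D *m u).
Proof.
have b0 : (0 : R) < 41/50 by lra.
exact: (sandwich_lower hN hS b0 m0 hbm).
Qed.

(** [1 - beta] is the constant [c] of the scalar inequalities. *)
Let hc : 9/50 + 27/100 * k <= 1 - beta.
Proof. by move: hbeta k0; lra. Qed.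

Variables (G X Y sk : R) (rX rY : 'cV[R]_l).
Hypotheses (hG : 50/19 <= G) (X0 : 0 <= X) (X1 : X <= 1/5) (Y0 : 0 <= Y) (Y1 : Y <= 1/5).
Hypothesis (hsk : 0 <= sk) (hsk2 : sk ^+ 2 = k).
Hypothesis (hY : dotv rY rY <= Y ^+ 2).
Let r := rX + rY.
Let q := u + r.
Let p := S *m q.
Let f := dotv u q.

Let vp : dotv v p = f.
Proof. by rewrite /f /u -dotv_trmx. Qed.

Let alpha := (41/50)^-1 * (41/100 / (cH - hn) * qf H (perp_mx v *m p)).
Let beta_ := (41/50)^-1 * (87/400 * k * (dotv p p - dotv v p ^+ 2)).

Let qNp : (41/50)^-1 * qf N p = alpha + beta_.
Proof. by rewrite qf_test_form mulrDr. Qed.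

(** The weight [hn / (cH - hn)] in the convexity inequality is the one that
    charges [f^2 / 4] exactly to the direction [v]; this dictates the coefficient
    of the compressed Hessian in the test form. *)
Let costH : qf H p / (4 * cH) <= alpha / 2 + f ^+ 2 / 4.
Proof.
have c1 : 0 < cH - hn by rewrite subr_gt0.
have c0 : 0 < cH by exact: lt_trans hn1.
have t0 : 0 < hn / (cH - hn) by rewrite divr_gt0.
have hvn : qf H v <= hn by have := hHn v; rewrite hv mulr1.
have := qf_split p hv hH t0 hvn; rewrite vp => h.
rewrite ler_pdivrMr ?mulr_gt0 //; apply: le_trans h _.
rewrite /alpha le_eqVlt; apply/orP; left; apply/eqP.
by field; rewrite !gt_eqF.
Qed.

Let alpha0 : 0 <= alpha.
Proof.
have h1 : (0 : R) <= (41/50)^-1 by rewrite invf_div; lra.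
exact: mulr_ge0 h1 (mulr_ge0 A0 (hH.2 _)).
Qed.
Let beta_0 : 0 <= beta_.
Proof.
have h1 : (0 : R) <= (41/50)^-1 by rewrite invf_div; lra.
have h2 : 0 <= 87/400 * k by apply: mulr_ge0; [lra|exact: ltW].
exact: mulr_ge0 h1 (mulr_ge0 h2 (perp_mx_ge0 p hv)).
Qed.

Let hU : xi * f ^+ 2 + (alpha + beta_) <= dotv q q.
Proof.
have := hE.2 q; rewrite qf_addl qf_opp qf_scalel qf_outer qD qNp -/f.
by lra.
Qed.

Let P2 : (sk * enorm p) ^+ 2 = k * f ^+ 2 + 328/87 * beta_.
Proof. by rewrite exprMn hsk2 enorm_sqr /beta_ vp; field. Qed.

Let ua : 50/91 * dotv u u <= 1.
Proof.
have h := hE.2 u; rewrite qf_addl qf_opp qf_scalel qf_outer in h.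
have h1 := hD u; have u0 := dotv_ge0 u.
have h2 : xi * dotv u u ^+ 2 <= dotv u u by lra.
have h3 : 50/91 * dotv u u ^+ 2 <= dotv u u.
  apply: le_trans h2; rewrite ler_wpM2r ?sqr_ge0 // /xi; move: k0; lra.
have [->|hz] := eqVneq (dotv u u) 0; first by rewrite mulr0 ler01.
have hp : 0 < dotv u u by rewrite lt_def hz u0.
rewrite expr2 in h3.
by rewrite -(ler_pM2r hp); move: h3; lra.
Qed.

(** By polarization [f = (|u|^2 - |r|^2 + |q|^2) / 2].  The form [D] already
    accounts for the curvature in [|q|^2]; the cubic term is a small multiple
    [psi] of a quadratic one, because [q] is bounded, and is absorbed by the
    margins left in [xi] and in the projection part. *)
Lemma small_absorb : dotv rX rX <= 67/125 ->
  (dotv u u - dotv r r) / 2 + qf E q / 2 <=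
  f - qf H p / (4 * cH) - (sk * enorm p) ^+ 3 / (24 * G).
Proof.
move=> hXX.
have G0 : 0 < G by move: hG; lra.
have G24 : 0 < 24 * G by move: G0; lra.
have hr : dotv r r <= 14/11 * dotv rX rX + 14/3 * dotv rY rY.
  have t0 : (0 : R) < 3/11 by lra.
  have := dotv_young rX rY t0; rewrite invf_div -/r; lra.
have hYY : dotv rY rY <= 1/25.
  apply: le_trans hY _; have := ler_pM Y0 Y0 Y1 Y1; rewrite expr2; lra.
have hq : dotv q q <= 21/4.
  have t0 : (0 : R) < 9/13 by lra.
  have := dotv_young u r t0; rewrite invf_div -/q.
  by move: ua; lra.
have f20 := sqr_ge0 f.
have hP2 : (sk * enorm p) ^+ 2 <= 328/87 * dotv q q.
  rewrite P2; apply: le_trans (_ : 328/87 * (xi * f ^+ 2 + (alpha + beta_)) <= _).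
    have h : k * f ^+ 2 <= 328/87 * (xi * f ^+ 2).
      have h0 : k <= 328/87 * xi by rewrite /xi; move: k0 k1; lra.
      by have := ler_wpM2r f20 h0; lra.
    by move: alpha0; lra.
  by apply: ler_wpM2l; [lra|].
have eP2 := P2; set P := sk * enorm p in eP2 hP2 *.
have P0 : 0 <= P by rewrite mulr_ge0 ?enorm_ge0.
have P1 : P <= 89/20.
  by apply: le_of_sqr_le; [lra|move: hP2 hq; lra].
pose psi := P / (24 * G).
have psi0 : 0 <= psi by apply: divr_ge0 => //; exact: ltW.
have psi1 : psi <= 7/100 + 1/2000.
  rewrite ler_pdivrMr //; apply: le_trans P1 _.
  by move: hG; lra.
have -> : P ^+ 3 / (24 * G) = psi * P ^+ 2 by rewrite /psi; field; rewrite gt_eqF.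
have hpk : psi * k <= 141/2000 * k by apply: ler_wpM2r; [exact: ltW|lra].
have h1 : psi * (k * f ^+ 2) <= (xi / 2 - 1/4) * f ^+ 2.
  have h0 : psi * k <= xi / 2 - 1/4.
    by apply: le_trans hpk _; rewrite /xi; move: k0 k1; lra.
  by have := ler_wpM2r f20 h0; lra.
have h2 : psi * (328/87 * beta_) <= beta_ / 2.
  have h0 : psi * (328/87) <= 1/2 by lra.
  by have := ler_wpM2r beta_0 h0; lra.
rewrite eP2 mulrDr.
have -> : qf E q = dotv q q - (alpha + beta_) - xi * f ^+ 2.
  by rewrite qf_addl qf_opp qf_scalel qf_outer qD qNp.
have hqq : dotv q q = dotv u u + dotv r r + 2 * dotv u r.
  exact: dotv_sqD.
have hf : f = dotv u u + dotv u r by exact: dotvDr.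
move: costH h1 h2; rewrite hqq hf; set ff := (_ + _) ^+ 2.
set z1 := psi * _; set z2 := psi * _; set z3 := qf H p / _.
move: ff z1 z2 z3 => ff z1 z2 z3; lra.
Qed.

(** The diagonal of [D] is one minus the form at the columns, and the projection
    part of the form bounds their length from below. *)
Let col_len i : k * dotv (col i S) (col i S) <=
  328/87 * (1 - (E i i + (xi - lam) * u i 0 ^+ 2)).
Proof.
have hui : u i 0 = dotv v (col i S).
  by rewrite /u mxE; apply: eq_bigr => j _; rewrite !mxE mulrC.
have hDi : D i i = 1 - (41/50)^-1 * qf N (col i S).
  rewrite -qf_delta qD -colE; congr (_ - _).
  by rewrite delta_dotv mxE !eqxx.
have hEi : E i i = D i i - xi * u i 0 ^+ 2.
  by rewrite /E !mxE big_ord1 !mxE expr2.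
have hq : 87/400 * k * (dotv (col i S) (col i S) - u i 0 ^+ 2) <= qf N (col i S).
  rewrite qf_test_form -hui lerDr mulr_ge0 // hH.2 //.
rewrite hEi hDi; have ui0 : 0 <= k * u i 0 ^+ 2 by rewrite mulr_ge0 ?sqr_ge0 // ltW.
move: hq; rewrite /lam; set Q := qf _ _; set ui := u i 0 ^+ 2 in ui0 *; set s := dotv _ _.
have -> : (41 / 50)^-1 * Q = 50/41 * Q by rewrite invf_div.
lra.
Qed.

(** The gradient is normalized to length one here, so that [X] and [Y] are the
    errors relative to the gradient. *)
Lemma small_step :
  dotv rX rX <= X ^+ 2 \/
  ((2 <= l)%N /\ forall i, rX i 0 ^+ 2 <=
      X ^+ 2 / l%:R ^+ 3 * (k * dotv (col i S) (col i S)) ^+ 3) ->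
  1/8 - 5 * (X ^+ 2 + Y ^+ 2) <=
  f - qf H p / (4 * cH) - (sk * enorm p) ^+ 3 / (24 * G).
Proof.
have X25 : X ^+ 2 <= 1/25 by have := ler_pM X0 X0 X1 X1; rewrite expr2; lra.
have hD' : forall r0, qf (E + xi *: (u *m u^T)) r0 <= dotv r0 r0 by rewrite -DE.
have hE1' := hE1; rewrite DE in hE1'.
move=> [hX|[l2 hX]].
  apply: le_trans (small_absorb _); last by lra.
  exact: (small_short_bias hE (ltW k0) k1 hc hD' hE1' hY hX).
have l0 : (0 : R) < l%:R by rewrite ltr0n; apply: leq_trans l2.
pose th i := E i i + (xi - lam) * u i 0 ^+ 2.
have th1 i : th i <= 1.
  have := col_len i; rewrite -/(th i).
  have : 0 <= k * dotv (col i S) (col i S) by rewrite mulr_ge0 ?dotv_ge0 // ltW.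
  lra.
have hX' i : rX i 0 ^+ 2 <= 268/5 * X ^+ 2 / l%:R ^+ 3 * (1 - th i) ^+ 3.
  apply: le_trans (hX i) _.
  have c0 : 0 <= X ^+ 2 / l%:R ^+ 3.
    by rewrite divr_ge0 ?sqr_ge0 // exprn_ge0 // ltW.
  have -> : 268/5 * X ^+ 2 / l%:R ^+ 3 * (1 - th i) ^+ 3 =
    X ^+ 2 / l%:R ^+ 3 * (268/5 * (1 - th i) ^+ 3) by ring.
  apply: ler_wpM2l => //.
  apply: le_trans (_ : (328/87 * (1 - th i)) ^+ 3 <= _).
    have p1 : 0 <= k * dotv (col i S) (col i S) by rewrite mulr_ge0 ?dotv_ge0 // ltW.
    have p2 := le_trans p1 (col_len i).
    by rewrite ler_pXn2r ?nnegrE //; exact: col_len.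
  rewrite exprMn; apply: ler_wpM2r; first by rewrite exprn_ge0 // subr_ge0.
  lra.
have hXX : dotv rX rX <= 67/125.
  apply: le_trans (_ : \sum_(i < l) 268/5 * X ^+ 2 / l%:R ^+ 3 <= _).
    apply: ler_sum => i _; rewrite -expr2; apply: le_trans (hX' i) _.
    have c0 : 0 <= 268/5 * X ^+ 2 / l%:R ^+ 3.
      apply: divr_ge0; first by apply: mulr_ge0; [lra|exact: sqr_ge0].
      by apply: exprn_ge0; exact: ltW.
    rewrite ler_piMr //; apply: exprn_ile1; first by rewrite subr_ge0.
    rewrite gerBl /th addr_ge0 ?psd_diag // mulr_ge0 ?sqr_ge0 //.
    by rewrite /xi /lam; move: k0 k1; lra.
  rewrite sumr_const card_ord -[_ *+ l]mulr_natr.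
  have -> : 268/5 * X ^+ 2 / l%:R ^+ 3 * l%:R = 268/5 * X ^+ 2 / l%:R ^+ 2.
    by field; rewrite gt_eqF.
  rewrite ler_pdivrMr ?exprn_gt0 //.
  have l4 : 4 <= l%:R ^+ 2 :> R.
    have -> : (4 : R) = 2 ^+ 2 by ring.
    by rewrite ler_pXn2r ?nnegrE ?ler_nat // ltW.
  by lra.
apply: le_trans (small_absorb hXX).
have [l3|l3] := leqP 3 l.
  exact: (small_many_columns hE (ltW k0) k1 hc hD' hE1' hY th1 hX' l3).
have e2 : l = 2%N by apply/eqP; rewrite eqn_leq l2 -ltnS l3.
exact: (small_two_columns hE (ltW k0) k1 hc hD' hE1' hY th1 hX' e2 X25).
Qed.

End SmallStep.

(** * Dominant errors *)

Section LargeReal.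
Variable R : realType.

Lemma cube_add_le (x y : R) : 0 <= x -> 0 <= y ->
  (5/4 * x + y) ^+ 3 <= 32/5 * (x ^+ 3 + y ^+ 3).
Proof.
move=> h0 h1.
have h2 : 0 <= x * (x - y) ^+ 2 by apply: mulr_ge0 => //; exact: sqr_ge0.
have h3 : 0 <= y * (x - y) ^+ 2 by apply: mulr_ge0 => //; exact: sqr_ge0.
have h4 : 0 <= x ^+ 3 by exact: exprn_ge0.
have h5 : 0 <= y ^+ 3 by exact: exprn_ge0.
rewrite !exprS expr0 !mulr1 in h2 h3 h4 h5 *; lra.
Qed.

(** For [q <= 1] the cubic cost is at most quadratic.  For [q > 1] the error [r]
    is itself large and the cubic terms in [X] and [Y] pay. *)
Lemma large_scalar1 (n X Y r q w : R) : 0 <= n -> 0 <= X -> 0 <= Y -> 0 <= r -> 0 <= q ->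
  0 <= w -> q <= w + r -> w <= 17/25 -> r <= 5/4 * X + Y -> n <= 19/50 ->
  n ^+ 2 <= 25 * (X ^+ 2 + Y ^+ 2) ->
  n ^+ 2 / 8 - 5 * (X ^+ 2 + Y ^+ 2) - 2/3 * (X ^+ 3 + Y ^+ 3) <=
  w ^+ 2 / 2 + 3/50 * q ^+ 2 - r ^+ 2 / 2 - 83/800 * q ^+ 3.
Proof.
move=> n0 X0 Y0 r0 q0 w0 hq hw hr hn hR.
have hr2 : r ^+ 2 <= 41/16 * (X ^+ 2 + Y ^+ 2).
  apply: le_trans (_ : (5/4 * X + Y) ^+ 2 <= _).
    by rewrite ler_pXn2r ?nnegrE // addr_ge0 // mulr_ge0.
  have := sqr_ge0 (X - 5/4 * Y); rewrite !sqrrD !sqrrN; lra.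
have hr3 : r ^+ 3 <= 32/5 * (X ^+ 3 + Y ^+ 3).
  apply: le_trans (cube_add_le X0 Y0).
  by rewrite ler_pXn2r ?nnegrE // addr_ge0 // mulr_ge0.
have X30 : 0 <= X ^+ 3 by exact: exprn_ge0.
have Y30 : 0 <= Y ^+ 3 by exact: exprn_ge0.
have r20 := sqr_ge0 r; have w20 := sqr_ge0 w; have q20 := sqr_ge0 q.
have [q1|q1] := lerP q 1.
  have h1 : q ^+ 3 <= q ^+ 2 by rewrite exprSr ler_piMr.
  have h2 : q ^+ 2 <= 2 * w ^+ 2 + 2 * r ^+ 2.
    apply: le_trans (_ : (w + r) ^+ 2 <= _).
      by rewrite ler_pXn2r ?nnegrE // addr_ge0.
    by have := sqr_ge0 (w - r); rewrite !sqrrD !sqrrN; lra.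
  set Q3 := q ^+ 3 in h1 *; set Q2 := q ^+ 2 in h1 h2 q20 *.
  set X3 := X ^+ 3 in X30 *; set Y3 := Y ^+ 3 in Y30 *.
  by clear -h1 h2 hR hr2 X30 Y30 w20 r20 q20; lra.
have r8 : 8/25 <= r by lra.
have n2 : n ^+ 2 <= 361/256 * r ^+ 2.
  have : n <= 19/16 * r by lra.
  move=> h; apply: le_trans (_ : (19/16 * r) ^+ 2 <= _).
    by rewrite ler_pXn2r ?nnegrE // mulr_ge0.
  by rewrite exprMn; lra.
have hq3 : q ^+ 3 <= r ^+ 3 + 189/20 * r ^+ 2.
  apply: le_trans (_ : (17/25 + r) ^+ 3 <= _).
    by rewrite ler_pXn2r ?nnegrE //; lra.
  have h1 : 0 <= (r - 8/25) * r by apply: mulr_ge0; lra.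
  rewrite !exprS expr0 !mulr1 in h1 *; lra.
set Q3 := q ^+ 3 in hq3 *; set Q2 := q ^+ 2 in q20 *; set r3 := r ^+ 3 in hq3 hr3 *.
set X3 := X ^+ 3 in X30 hr3 *; set Y3 := Y ^+ 3 in Y30 hr3 *.
by clear -hq3 n2 hr2 hr3 X30 Y30 w20 r20 q20; lra.
Qed.

Lemma large_scalar (G n X Y r q w : R) : 0 < G ->
  0 <= n -> 0 <= X -> 0 <= Y -> 0 <= r -> 0 <= q ->
  0 <= w -> q <= w + r -> w <= 17/25 * G -> r <= 5/4 * X + Y -> n <= 19/50 * G ->
  n ^+ 2 <= 25 * (X ^+ 2 + Y ^+ 2) ->
  n ^+ 2 / 8 - 5 * (X ^+ 2 + Y ^+ 2) - 2/3 * (X ^+ 3 + Y ^+ 3) / G <=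
  w ^+ 2 / 2 + 3/50 * q ^+ 2 - r ^+ 2 / 2 - 83/800 * q ^+ 3 / G.
Proof.
move=> G0 n0 X0 Y0 r0 q0 w0 hq hw hr hn hR.
have G1 : G != 0 by rewrite gt_eqF.
have iG : 0 <= G^-1 by rewrite invr_ge0 ltW.
have d0 x : 0 <= x -> 0 <= x / G by move=> ?; rewrite divr_ge0 // ltW.
have G20 : 0 < G ^+ 2 by rewrite exprn_gt0.
have hq' : q / G <= w / G + r / G by rewrite -mulrDl ler_pM2r ?invr_gt0.
have hw' : w / G <= 17/25 by rewrite ler_pdivrMr.
have hr' : r / G <= 5/4 * (X / G) + Y / G by rewrite mulrA -mulrDl ler_pM2r ?invr_gt0.
have hn' : n / G <= 19/50 by rewrite ler_pdivrMr.
have hR' : (n / G) ^+ 2 <= 25 * ((X / G) ^+ 2 + (Y / G) ^+ 2).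
  by rewrite !expr_div_n -mulrDl mulrA ler_pM2r ?invr_gt0.
have := large_scalar1 (d0 _ n0) (d0 _ X0) (d0 _ Y0) (d0 _ r0) (d0 _ q0) (d0 _ w0)
  hq' hw' hr' hn' hR'.
rewrite -(ler_pM2l G20).
set L := (X in X <= _ -> _); set L' := (X in _ <= X -> _); set M := (X in _ -> X <= _).
set M' := (X in _ -> _ <= X).
have -> : L = M by rewrite /L /M !expr_div_n; field.
by have -> : L' = M' by rewrite /L' /M' !expr_div_n; field.
Qed.

End LargeReal.

Section LargeStep.
Variables (R : realType) (d l : nat).
Variables (S : 'M[R]_(d, l)) (v : 'cV[R]_d) (H : 'M[R]_d).
Variables (hn cH k beta : R).
Hypotheses (hv : dotv v v = 1) (hH : psd H) (hn1 : 5 * hn <= cH).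
Hypotheses (cH0 : 0 < cH) (hHn : forall x, qf H x <= hn * dotv x x).
Hypotheses (k0 : 0 < k) (k1 : k <= 4/5).
Let u := S^T *m v.
Let N := test_form v H (2 / cH) (6/5 * k).
Hypothesis hS : sandwich S v N beta.
Hypothesis (hbeta : beta <= 11/5 - 6/5 * k).
Variable m : R.
Hypothesis hm : forall x, qf N x <= m * dotv x x.
Hypothesis (hbm : beta + m <= 11/5).
Variables (n G X Y sk : R) (rX rY : 'cV[R]_l).
Hypotheses (n0 : 0 <= n) (hG : 0 < G) (hnG : n <= 19/50 * G).
Hypotheses (X0 : 0 <= X) (Y0 : 0 <= Y).
Hypothesis hR : n ^+ 2 <= 25 * (X ^+ 2 + Y ^+ 2).
Hypotheses (hsk : 0 <= sk) (hsk2 : sk ^+ 2 = k).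
Hypothesis (hY : dotv rY rY <= Y ^+ 2).
Hypothesis hX : dotv rX rX <= X ^+ 2 \/
  ((2 <= l)%N /\ forall i, rX i 0 ^+ 2 <=
      X ^+ 2 / l%:R ^+ 3 * (k * dotv (col i S) (col i S)) ^+ 3).
Let r := rX + rY.
Let q := n *: u + r.
Let p := S *m q.
Let f := dotv u q.
(* b = 11/5 bounds beta + m, the weight of the projection is 6/5 k, and g is a lower
   bound of 1 / (1 + beta) *)
Let g : R := (16/5 - 6/5 * k)^-1.

Let den0 : 0 < 16/5 - 6/5 * k.
Proof. by move: k1; lra. Qed.

Let g0 : 0 <= g.
Proof. by rewrite invr_ge0 ltW. Qed.

Let A0 : 0 <= 2 / cH.
Proof. by rewrite divr_ge0 // ltW. Qed.

Let hN : psd N.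
Proof.
have h : 0 <= 6/5 * k by apply: mulr_ge0; [lra|exact: ltW].
exact: psd_test_form hv hH A0 h.
Qed.

Let hU x : g * dotv u x ^+ 2 + (11/5)^-1 * qf N (S *m x) <= dotv x x.
Proof.
have h (y : 'cV[R]_d) : dotv (N *m y) (N *m y) <= m * qf N y by exact: psd_sqr_le.
have b0 : (0 : R) < 11/5 by lra.
apply: (sandwich_upper hN hS b0 h hbm x g0).
rewrite mulrC ler_pdivrMr // mul1r; move: hbeta; lra.
Qed.

Let g5 : 5/16 <= g.
Proof.
have h : (0 : R) < 16/5 by lra.
by rewrite -[5/16]invf_div lef_pV2 ?posrE //; move: k0; lra.
Qed.

Let kg : k <= 11/6 * g.
Proof.
rewrite ler_pdivlMr //.
have : 0 <= (4/5 - k) ^+ 2 by exact: sqr_ge0.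
by rewrite sqrrB; move: k1; lra.
Qed.

Let vp : dotv v p = f.
Proof. by rewrite /f /u -dotv_trmx. Qed.

Let al := (11/5)^-1 * (2 / cH * qf H (perp_mx v *m p)).
Let be := (11/5)^-1 * (6/5 * k * (dotv p p - dotv v p ^+ 2)).

Let qNp : (11/5)^-1 * qf N p = al + be.
Proof. by rewrite qf_test_form mulrDr. Qed.

Let al0 : 0 <= al.
Proof.
have h1 : (0 : R) <= (11/5)^-1 by rewrite invf_div; lra.
exact: mulr_ge0 h1 (mulr_ge0 A0 (hH.2 _)).
Qed.

Let be0 : 0 <= be.
Proof.
have h1 : (0 : R) <= (11/5)^-1 by rewrite invf_div; lra.
have h2 : 0 <= 6/5 * k by apply: mulr_ge0; [lra|exact: ltW].
exact: mulr_ge0 h1 (mulr_ge0 h2 (perp_mx_ge0 p hv)).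
Qed.

Let hUq : g * f ^+ 2 + (al + be) <= dotv q q.
Proof. by have := hU q; rewrite -/p qNp. Qed.

Let costH : qf H p / (4 * cH) <= 11/25 * dotv q q.
Proof.
have t0 : (0 : R) < 3/5 by lra.
have hvn : qf H v <= hn by have := hHn v; rewrite hv mulr1.
have := qf_split p hv hH t0 hvn; rewrite vp invf_div => h.
have f20 := sqr_ge0 f.
have f1 : f ^+ 2 * hn <= f ^+ 2 * (cH / 5).
  by apply: ler_wpM2l => //; move: hn1; lra.
have f2 : 5/16 * f ^+ 2 <= g * f ^+ 2 by apply: ler_wpM2r.
have eH : qf H (perp_mx v *m p) = 11/10 * cH * al by rewrite /al; field; rewrite gt_eqF.
have cH4 : 0 < 4 * cH by move: cH0; lra.
rewrite ler_pdivrMr //.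
have h2 : cH * (5/16 * f ^+ 2 + al) <= cH * dotv q q.
  by apply: ler_wpM2l; [exact: ltW|move: f2 hUq be0; lra].
have h3 : 0 <= cH * f ^+ 2 by apply: mulr_ge0; [exact: ltW|].
move: h h2 f1 h3; rewrite eH; move: (f ^+ 2) (dotv q q) (qf H p) al => F Q P A.
lra.
Qed.

Let P2 : (sk * enorm p) ^+ 2 <= 11/6 * dotv q q.
Proof.
have -> : (sk * enorm p) ^+ 2 = k * f ^+ 2 + 11/6 * be.
  by rewrite exprMn hsk2 enorm_sqr /be vp; field.
have := ler_wpM2r (sqr_ge0 f) kg; move: hUq al0; lra.
Qed.

Let hXX : enorm rX <= 5/4 * X.
Proof.
apply: le_of_sqr_le; first by apply: mulr_ge0 => //; lra.
rewrite enorm_sqr; case: hX => [h|[l2 h]].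
  apply: le_trans h _; rewrite exprMn; have := sqr_ge0 X; lra.
have l0 : (0 : R) < l%:R by rewrite ltr0n; apply: leq_trans l2.
have hcol i : k * dotv (col i S) (col i S) <= 11/6.
  have e1 : dotv u (delta_mx i 0) = u i 0 by rewrite dotvC delta_dotv.
  have e2 : dotv (delta_mx i 0 : 'cV[R]_l) (delta_mx i 0) = 1.
    by rewrite delta_dotv mxE !eqxx.
  have := hU (delta_mx i 0); rewrite e1 e2 -colE qf_test_form.
  have -> : dotv v (col i S) = u i 0.
    by rewrite /u mxE; apply: eq_bigr => j _; rewrite !mxE mulrC.
  have h1 := mulr_ge0 A0 (hH.2 (perp_mx v *m col i S)).
  have h2 := ler_wpM2r (sqr_ge0 (u i 0)) kg.
  rewrite invf_div; move: h1 h2.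
  set a := _ / _ * qf _ _; set s := dotv _ _; set w := u i 0 ^+ 2.
  by lra.
apply: le_trans (_ : \sum_(i < l) X ^+ 2 / l%:R ^+ 3 * (11/6) ^+ 3 <= _).
  apply: ler_sum => i _; rewrite -expr2; apply: le_trans (h i) _.
  apply: ler_wpM2l; first by rewrite divr_ge0 ?sqr_ge0 // exprn_ge0 // ltW.
  have p1 : 0 <= k * dotv (col i S) (col i S) by rewrite mulr_ge0 ?dotv_ge0 // ltW.
  have p2 := le_trans p1 (hcol i).
  by rewrite ler_pXn2r ?nnegrE //; exact: hcol.
rewrite sumr_const card_ord -[_ *+ l]mulr_natr.
have -> : X ^+ 2 / l%:R ^+ 3 * (11/6) ^+ 3 * l%:R = X ^+ 2 * (11/6) ^+ 3 / l%:R ^+ 2.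
  by field; rewrite gt_eqF.
rewrite ler_pdivrMr ?exprn_gt0 //.
have l4 : 4 <= l%:R ^+ 2 :> R.
  have -> : (4 : R) = 2 ^+ 2 by ring.
  by rewrite ler_pXn2r ?nnegrE ?ler_nat // ltW.
have X2 : 0 <= X ^+ 2 by exact: sqr_ge0.
have := ler_wpM2l X2 l4; rewrite [(5/4 * X) ^+ 2]exprMn.
set L := l%:R ^+ 2; set Z := X ^+ 2; move: X2; rewrite -/Z; lra.
Qed.

(** Only a fixed fraction of [|q|^2] has to survive the curvature and cubic
    costs, since the errors may be charged to the additive constant. *)
Lemma large_step :
  n ^+ 2 / 8 - 5 * (X ^+ 2 + Y ^+ 2) - 2/3 * (X ^+ 3 + Y ^+ 3) / G <=
  n * f - qf H p / (4 * cH) - (sk * enorm p) ^+ 3 / (24 * G).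
Proof.
have hr : enorm r <= 5/4 * X + Y.
  apply: le_trans (enormD _ _) _; apply: lerD => //.
  by apply: le_of_sqr_le => //; rewrite enorm_sqr.
have hq : enorm q <= enorm (n *: u) + enorm r by exact: enormD.
have hw : enorm (n *: u) <= 17/25 * G.
  apply: le_of_sqr_le; first by apply: mulr_ge0; [lra|exact: ltW].
  have hu : 5/16 * dotv u u <= 1.
    have h1 := hU u; have h2 := dotv_ge0 u.
    have h3 := hN.2 (S *m u).
    have h4 : 5/16 * dotv u u ^+ 2 <= dotv u u.
      have := ler_wpM2r (sqr_ge0 (dotv u u)) g5.
      move: h1 h3; rewrite invf_div; lra.
    have [->|hz] := eqVneq (dotv u u) 0; first by rewrite mulr0 ler01.
    have hp : 0 < dotv u u by rewrite lt_def hz h2.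
    by rewrite -(ler_pM2r hp); move: h4; lra.
  rewrite enorm_sqr dotvZl dotvZr mulrA -expr2.
  have h1 : n ^+ 2 <= (19/50 * G) ^+ 2.
    by rewrite ler_pXn2r ?nnegrE //; exact: le_trans n0 hnG.
  have h2 := ler_wpM2l (sqr_ge0 n) hu.
  rewrite !exprMn in h1 *; have := sqr_ge0 G; lra.
have := large_scalar hG n0 X0 Y0 (enorm_ge0 r) (enorm_ge0 q) (enorm_ge0 _) hq hw hr hnG hR.
move=> /le_trans; apply.
have -> : n * f = (enorm (n *: u) ^+ 2 + enorm q ^+ 2 - enorm r ^+ 2) / 2.
  rewrite !enorm_sqr {2}/q dotv_sqD /f {1}/q dotvDr dotvZr !dotvZl dotvZr.
  by field.
have P0 : 0 <= sk * enorm p by rewrite mulr_ge0 ?enorm_ge0.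
have q0 := enorm_ge0 q.
have hP : sk * enorm p <= 271/200 * enorm q.
  apply: le_of_sqr_le; first by apply: mulr_ge0; [lra|].
  apply: le_trans P2 _; rewrite exprMn enorm_sqr; have := dotv_ge0 q; lra.
have hP3 : (sk * enorm p) ^+ 3 <= 249/100 * enorm q ^+ 3.
  apply: le_trans (_ : (271/200 * enorm q) ^+ 3 <= _).
    have P1 := le_trans P0 hP; by rewrite ler_pXn2r ?nnegrE.
  by rewrite exprMn; have := exprn_ge0 3 q0; lra.
have hc : (sk * enorm p) ^+ 3 / (24 * G) <= 83/800 * enorm q ^+ 3 / G.
  have G24 : 0 < 24 * G by move: hG; lra.
  rewrite ler_pdivrMr //.
  have -> : 83/800 * enorm q ^+ 3 / G * (24 * G) = 249/100 * enorm q ^+ 3.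
    by field; rewrite gt_eqF.
  by [].
have := costH; rewrite -enorm_sqr; move: hc.
move: (_ / (24 * G)) (_ / G) (qf H p / _) => c1 c2 c3.
lra.
Qed.

End LargeStep.

(** * Choice of the test matrix when the distance to the minimum is small *)

Section CaseTwo.
Variables (R : realType) (d l : nat).
Implicit Types (S : 'M[R]_(d, l)) (v x : 'cV[R]_d) (H B : 'M[R]_d).

Definition sketch_event (kk : R) B S :=
  specnorm (B^T *m S *m S^T *m B - B^T *m B) <=
    1 / 4 * (specnorm B ^+ 2 + fnorm B ^+ 2 / kk).

Lemma unit_dir (hd : (0 < d)%N) (g : 'cV[R]_d) :
  exists v : 'cV[R]_d, dotv v v = 1 /\ g = enorm g *: v.
Proof.
have [->|g0] := eqVneq g 0.
  exists (delta_mx (Ordinal hd) 0); rewrite enorm0 scale0r; split=> //.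
  by rewrite delta_dotv mxE !eqxx.
exists ((enorm g)^-1 *: g); split; first exact: enorm_unit.
rewrite scalerA divff ?scale1r //.
by apply: contra_neq g0; exact: enorm_eq0.
Qed.

(** The largest value of the test form, which enters the spectral norm of its
    factor. *)
Lemma test_form_le v H A Z hn x : dotv v v = 1 -> 0 <= A ->
  (forall y, qf H y <= hn * dotv y y) ->
  qf (test_form v H A Z) x <= (A * hn + Z) * (dotv x x - dotv v x ^+ 2).
Proof.
move=> hv A0 hH; rewrite qf_test_form mulrDl lerD2r -mulrA ler_wpM2l //.
by rewrite -sqr_perp_mx.
Qed.

Lemma test_form_tr v H A Z : dotv v v = 1 -> psd H -> 0 <= A -> 0 <= Z ->
  \tr (test_form v H A Z) <= A * \tr H + Z * d%:R.
Proof.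
move=> hv hH A0 Z0; rewrite mxtraceD !mxtraceZ.
have tr_outer (x y : 'cV[R]_d) : \tr (x *m y^T) = dotv x y.
  by apply: eq_bigr => i _; rewrite mxE big_ord1 mxE.
have idem : perp_mx v *m perp_mx v = perp_mx v.
  rewrite {2}/perp_mx mulmxBr mulmx1 mulmxA perp_mx_v // mul0mx subr0 //.
apply: lerD; apply: ler_wpM2l => //.
  rewrite mxtrace_mulC mulmxA idem mxtrace_mulC /perp_mx mulmxBr mulmx1 mulmxA.
  rewrite linearB /= tr_outer dotvC gerBl; exact: hH.2.
rewrite linearB /= tr_outer hv mxtrace1 gerBl; exact: ler01.
Qed.

Lemma sandwich_exists v H A Z hn mu0 beta kk : dotv v v = 1 -> psd H ->
  0 <= A -> 0 < Z -> (forall y, qf H y <= hn * dotv y y) ->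
  1 <= mu0 -> A * hn + Z <= mu0 -> 0 < kk ->
  1 / 4 * (mu0 + (1 + \tr (test_form v H A Z)) / kk) <= beta ->
  exists B, forall S, sketch_event kk B S -> sandwich S v (test_form v H A Z) beta.
Proof.
move=> hv hH A0 Z0 hHn mu1 hmu kk0 hb.
apply: (@sketch_sandwich _ d l v (test_form v H A Z) mu0 beta kk) => //.
- exact: psd_test_form hv hH A0 (ltW Z0).
- exact: test_form_v.
- move=> x hvx x0; rewrite qf_test_form hvx expr0n subr0.
  apply: ltr_wpDl; first by rewrite mulr_ge0 ?hH.2.
  rewrite mulr_gt0 // lt_def dotv_ge0 andbT.
  by apply: contra_neq x0; exact: dotv_eq0.
- exact: le_trans mu1.
- move=> x; rewrite qf_addl qf_outer.
  have h1 := test_form_le Z x hv A0 hHn; have h2 := perp_mx_ge0 x hv.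
  have h3 : (A * hn + Z) * (dotv x x - dotv v x ^+ 2) <= mu0 * (dotv x x - dotv v x ^+ 2).
    exact: ler_wpM2r.
  have h4 : dotv v x ^+ 2 <= mu0 * dotv v x ^+ 2 by rewrite ler_peMl ?sqr_ge0.
  lra.
Qed.

Lemma test_form_dim1 v H A Z : d = 1%N -> dotv v v = 1 -> test_form v H A Z = 0.
Proof.
move=> d1 hv; suff h : perp_mx v = 0 by rewrite /test_form h mulmx0 !scaler0 addr0.
move: v H hv; rewrite d1 => v H hv; apply/matrixP => i j.
rewrite !mxE big_ord1 !mxE !ord1 eqxx mulr1n -hv /dotv big_ord1; exact: subrr.
Qed.

Variables (H : 'M[R]_d) (g : 'cV[R]_d) (hn cH kk G X Y sk : R).
Hypotheses (hd : (0 < d)%N) (hl : (0 < l)%N).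
Hypotheses (hH : psd H) (hn0 : 0 < hn) (hHn : forall x, qf H x <= hn * dotv x x).
Hypotheses (kk1 : 1 <= kk) (hcH : 5 * hn + \tr H / kk <= cH).
Let k2 := (5/4 + d%:R / (4 * kk))^-1.
Hypotheses (hsk : 0 <= sk) (hsk2 : sk ^+ 2 = k2).
Hypotheses (G0 : 0 < G) (hgG : enorm g <= 19/50 * G) (X0 : 0 <= X) (Y0 : 0 <= Y).

(** The inequality that makes one step near the minimum successful: [g] is
    the gradient, [H] the symmetrized Hessian, [rX] the bias and [rY] the noise. *)
Definition descent2 S (rX rY : 'cV[R]_l) :=
  let q := S^T *m g + (rX + rY) in
  enorm g ^+ 2 / 8 - 5 * (X ^+ 2 + Y ^+ 2) - 2/3 * (X ^+ 3 + Y ^+ 3) / G <=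
  dotv (S^T *m g) q - qf H (S *m q) / (4 * cH) - (sk * enorm (S *m q)) ^+ 3 / (24 * G).

Let kk0 : 0 < kk. Proof. exact: lt_le_trans kk1. Qed.
Let trH0 : 0 <= \tr H / kk.
Proof.
by rewrite divr_ge0 ?(ltW kk0) //; apply: sumr_ge0 => i _; exact: psd_diag.
Qed.
Let dk0 : 0 <= d%:R / (4 * kk).
Proof. by rewrite divr_ge0 // mulr_ge0 // ltW. Qed.
Let k20 : 0 < k2.
Proof. by rewrite invr_gt0; move: dk0; lra. Qed.
Let k2E : k2 * (5/4 + d%:R / (4 * kk)) = 1.
Proof. by rewrite mulVf // gt_eqF //; move: dk0; lra. Qed.
Let k21 : k2 <= 4/5.
Proof.
have h : 0 <= k2 * (d%:R / (4 * kk)) by rewrite mulr_ge0 // ltW.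
by move: k2E; rewrite mulrDr; lra.
Qed.
(** The trace of the projection is of order [d], but is divided by [kk]; this
    identity converts it into a constant, and is why the weight of the projection
    is a multiple of [k2]. *)
Let k2d : k2 * d%:R / (4 * kk) = 1 - 5/4 * k2.
Proof. by move: k2E; rewrite mulrDr mulrA; lra. Qed.
Let ikk : kk^-1 <= 1.
Proof. by rewrite invf_le1. Qed.
Let c50 : 5 * hn <= cH.
Proof. by move: hcH trH0; lra. Qed.
Let hnC : hn < cH.
Proof. by move: c50 hn0; lra. Qed.

(** For [d >= 2] the largest value of [v v^T + N] is one.  In dimension one the
    form vanishes and [beta] can be chosen smaller, with
    [k2 (1 + beta) = 1]; this will bound the columns of [S]. *)
Let small_sandwich v : dotv v v = 1 -> exists B (beta m : R), [/\ 0 <= beta /\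
  beta <= 41/50 - 87/320 * k2, 0 <= m,
  (forall x, qf (test_form v H (41/100 / (cH - hn)) (87/400 * k2)) x <= m * dotv x x),
  beta + m <= 41/50 /\ (d = 1%N -> k2 * (1 + beta) <= 1) &
  forall S, sketch_event kk B S ->
   sandwich S v (test_form v H (41/100 / (cH - hn)) (87/400 * k2)) beta].
Proof.
move=> hv; set A := _ / (cH - hn); set Z := 87/400 * k2.
have c1 : 0 < cH - hn by rewrite subr_gt0.
have A0 : 0 <= A by rewrite divr_ge0 ?(ltW c1) //; lra.
have Z0 : 0 < Z by apply: mulr_gt0; [lra|exact: k20].
have AH : A * (4 * hn + \tr H / kk) <= 41/100.
  rewrite /A mulrAC ler_pdivrMr //; apply: ler_wpM2l; first by lra.
  by move: hcH; lra.
have hAhn : A * hn <= 41/400.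
  have : 0 <= A * (\tr H / kk) by rewrite mulr_ge0.
  by move: AH; rewrite mulrDr; lra.
have [d1|d1] := eqVneq d 1%N.
  pose beta := 1 / 4 * (1 + kk^-1).
  have hb : k2 * (1 + beta) = 1.
    rewrite -[RHS]k2E /beta d1; congr (_ * _); field; by rewrite gt_eqF.
  have hN := test_form_dim1 H A Z d1 hv.
  have ik0 : 0 <= kk^-1 by rewrite invr_ge0 ltW.
  have b0 : 0 <= beta by rewrite /beta; lra.
  have b1 : beta <= 1/2 by rewrite /beta; move: ikk; lra.
  have hmu : A * hn + Z <= 1 by rewrite /Z; move: hAhn k21; lra.
  have [|B hB] := sandwich_exists (beta := beta) hv hH A0 Z0 hHn (lexx 1) hmu kk0.
    by rewrite hN mxtrace0 addr0 (div1r kk); exact: lexx.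
  exists B, beta, 0; split=> //.
  - by split=> //; move: b1 k21; lra.
  - by move=> x; rewrite hN /qf mul0mx dotv0r mul0r.
  - by split; [move: b1; lra|rewrite hb].
pose m := A * hn + Z.
pose beta := 1 / 4 * (1 + (1 + \tr (test_form v H A Z)) / kk).
have htr := test_form_tr hv hH A0 (ltW Z0).
have tr0 : 0 <= \tr (test_form v H A Z).
  by apply: sumr_ge0 => i _; apply: psd_diag; exact: psd_test_form hv hH A0 (ltW Z0).
have htr2 : (1 + \tr (test_form v H A Z)) / kk <=
    1 + A * (\tr H / kk) + 87/100 * (1 - 5/4 * k2).
  apply: le_trans (_ : (1 + (A * \tr H + Z * d%:R)) / kk <= _).
    by rewrite ler_wpM2r ?invr_ge0 ?(ltW kk0) // lerD2l.
  rewrite -k2d /Z (_ : _ / kk = kk^-1 + A * (\tr H / kk)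
    + 87/100 * (k2 * d%:R / (4 * kk))); first by move: ikk; lra.
  by field; rewrite gt_eqF.
have hb0 : 0 <= beta.
  by rewrite mulr_ge0 ?divr_ge0 // addr_ge0 // divr_ge0 ?addr_ge0 // ltW.
have Ahn0 : 0 <= A * hn by rewrite mulr_ge0 // ltW.
have hbm : beta + m <= 41/50 - 87/1600 * k2.
  rewrite /beta /m /Z; move: AH htr2; rewrite mulrDr; lra.
have hmu : m <= 1 by rewrite /m /Z; move: hAhn k21; lra.
have [B hB] := sandwich_exists hv hH A0 Z0 hHn (lexx 1) hmu kk0 (lexx beta).
exists B, beta, m; split=> //.
- by split=> //; rewrite /beta; move: AH Ahn0 htr2; rewrite mulrDr; lra.
- by rewrite addr_ge0 // ltW.
- move=> x; apply: le_trans (test_form_le Z x hv A0 hHn) _.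
  by apply: ler_wpM2l; [rewrite addr_ge0 // ltW|rewrite gerBl sqr_ge0].
- by split=> [|e]; [move: hbm k20; lra|rewrite e in d1].
Qed.

(** The same construction with heavier weights; the largest value is now bounded
    by [1 + m]. *)
Let large_sandwich v : dotv v v = 1 -> exists B (beta m : R), [/\ 0 <= beta /\
  beta <= 11/5 - 6/5 * k2, 0 <= m,
  (forall x, qf (test_form v H (2 / cH) (6/5 * k2)) x <= m * dotv x x),
  beta + m <= 11/5 /\ (d = 1%N -> k2 * (1 + beta) <= 1) &
  forall S, sketch_event kk B S ->
   sandwich S v (test_form v H (2 / cH) (6/5 * k2)) beta].
Proof.
move=> hv; set A := _ / cH; set Z := 6/5 * k2.
have C0 : 0 < cH by exact: lt_trans hn0 hnC.
have A0 : 0 <= A by rewrite divr_ge0 ?(ltW C0).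
have Z0 : 0 < Z by apply: mulr_gt0; [lra|exact: k20].
have AH : A * (5 * hn + \tr H / kk) <= 2.
  by rewrite /A mulrAC ler_pdivrMr // ler_wpM2l.
have Ahn0 : 0 <= A * hn by rewrite mulr_ge0 // ltW.
pose m := A * hn + Z.
have m0 : 0 <= m by rewrite addr_ge0 // ltW.
have [d1|d1] := eqVneq d 1%N.
  pose beta := 1 / 4 * (1 + kk^-1).
  have hb : k2 * (1 + beta) = 1.
    rewrite -[RHS]k2E /beta d1; congr (_ * _); field; by rewrite gt_eqF.
  have hN := test_form_dim1 H A Z d1 hv.
  have ik0 : 0 <= kk^-1 by rewrite invr_ge0 ltW.
  have b0 : 0 <= beta by rewrite /beta; lra.
  have b1 : beta <= 1/2 by rewrite /beta; move: ikk; lra.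
  have [||||B hB] := @sketch_sandwich _ d l v 0 1 beta kk hv _ (mul0mx _ _) _ ler01 _ kk0.
  - by split=> [|x]; rewrite ?trmx0 // /qf mul0mx dotv0r.
  - move=> x hvx x0; exfalso; move/eqP: x0; apply; apply: dotv_eq0.
    have := test_form_dim1 H 0 1 d1 hv => /(congr1 (fun M => qf M x)).
    by rewrite qf_test_form hvx expr0n mul0r mul1r add0r subr0 /qf mul0mx dotv0r.
  - move=> x; rewrite addr0 qf_outer mul1r -subr_ge0; exact: perp_mx_ge0.
  - by rewrite mxtrace0 addr0 (div1r kk); exact: lexx.
  exists B, beta, 0; split=> //.
  - by split=> //; rewrite /Z; move: b1 k21; lra.
  - by move=> x; rewrite hN /qf mul0mx dotv0r mul0r.
  - by split; [move: b1; lra|rewrite hb].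
  - by move=> S hS; rewrite hN; exact: hB.
pose beta := 1 / 4 * (1 + m + (1 + \tr (test_form v H A Z)) / kk).
have htr := test_form_tr hv hH A0 (ltW Z0).
have tr0 : 0 <= \tr (test_form v H A Z).
  by apply: sumr_ge0 => i _; apply: psd_diag; exact: psd_test_form hv hH A0 (ltW Z0).
have htr2 : (1 + \tr (test_form v H A Z)) / kk <=
    1 + A * (\tr H / kk) + 24/5 * (1 - 5/4 * k2).
  apply: le_trans (_ : (1 + (A * \tr H + Z * d%:R)) / kk <= _).
    by rewrite ler_wpM2r ?invr_ge0 ?(ltW kk0) // lerD2l.
  rewrite -k2d /Z (_ : _ / kk = kk^-1 + A * (\tr H / kk)
    + 24/5 * (k2 * d%:R / (4 * kk))); first by move: ikk; lra.
  by field; rewrite gt_eqF.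
have hb0 : 0 <= beta.
  by rewrite mulr_ge0 ?divr_ge0 // !addr_ge0 // divr_ge0 ?addr_ge0 // ltW.
have hbm : beta + m <= 11/5.
  rewrite /beta /m /Z; move: AH htr2; rewrite mulrDr; lra.
have hmu : m <= 1 + m by rewrite lerDr.
have m1 : 1 <= 1 + m by rewrite lerDl.
have [B hB] := sandwich_exists hv hH A0 Z0 hHn m1 hmu kk0 (lexx beta).
exists B, beta, m; split=> //.
- by split=> //; move: hbm Ahn0; rewrite /m /Z; lra.
- move=> x; apply: le_trans (test_form_le Z x hv A0 hHn) _.
  by apply: ler_wpM2l => //; rewrite gerBl sqr_ge0.
- by split=> // e; rewrite e in d1.
Qed.

(** In dimension one the squared length of a column is the square of a coordinate
    of [u], and [beta] was chosen to make it at most [1 / k2]. *)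
Let dim1_bound S v (N : 'M[R]_d) (beta m b : R) (rX : 'cV[R]_l) : d = 1%N -> dotv v v = 1 -> psd N ->
  sandwich S v N beta -> (forall x, qf N x <= m * dotv x x) -> 0 < b ->
  beta + m <= b -> k2 * (1 + beta) <= 1 ->
  (forall i, rX i 0 ^+ 2 <=
      X ^+ 2 / l%:R ^+ 3 * (k2 * dotv (col i S) (col i S)) ^+ 3) ->
  dotv rX rX <= X ^+ 2.
Proof.
move=> d1 hv hN hS hm b0 hbm hk h.
have hNN (x : 'cV[R]_d) : dotv (N *m x) (N *m x) <= m * qf N x by exact: psd_sqr_le.
have l0 : (1 : R) <= l%:R by rewrite ler1n.
have l00 : (0 : R) < l%:R by rewrite ltr0n.
have hcol i : k2 * dotv (col i S) (col i S) <= 1.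
  have := sandwich_upper hN hS b0 hNN hbm (delta_mx i 0) (ltW k20) hk.
  have -> : dotv (S^T *m v) (delta_mx i 0) = dotv v (col i S).
    by rewrite colE -dotv_trmx.
  have -> : dotv (delta_mx i 0 : 'cV[R]_l) (delta_mx i 0) = 1.
    by rewrite delta_dotv mxE !eqxx.
  have : dotv (col i S) (col i S) = dotv v (col i S) ^+ 2.
    have := test_form_dim1 H 0 1 d1 hv => /(congr1 (fun M => qf M (col i S))).
    rewrite qf_test_form mul0r mul1r add0r /qf mul0mx dotv0r => /eqP.
    by rewrite subr_eq0 => /eqP.
  move=> ->; have : 0 <= b^-1 * qf N (S *m delta_mx i 0).
    by rewrite mulr_ge0 ?hN.2 // invr_ge0 ltW.
  lra.
apply: le_trans (_ : \sum_(i < l) X ^+ 2 / l%:R ^+ 3 <= _).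
  apply: ler_sum => i _; rewrite -expr2; apply: le_trans (h i) _.
  rewrite ler_piMr ?divr_ge0 ?sqr_ge0 ?exprn_ge0 ?(ltW l00) //.
  apply: exprn_ile1 => //; by rewrite mulr_ge0 ?dotv_ge0 // ltW.
rewrite sumr_const card_ord -[_ *+ l]mulr_natr.
have -> : X ^+ 2 / l%:R ^+ 3 * l%:R = X ^+ 2 / l%:R ^+ 2.
  by field; rewrite gt_eqF.
by rewrite ler_pdivrMr ?exprn_gt0 // ler_peMr ?sqr_ge0 // exprn_ege1.
Qed.

Theorem case2_event : exists B, forall S, sketch_event kk B S ->
  forall rX rY : 'cV[R]_l, dotv rY rY <= Y ^+ 2 ->
  dotv rX rX <= X ^+ 2 \/
  ((2 <= l)%N \/ d = 1%N) /\
   (forall i, rX i 0 ^+ 2 <=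
      X ^+ 2 / l%:R ^+ 3 * (k2 * dotv (col i S) (col i S)) ^+ 3) ->
  descent2 S rX rY.
Proof.
have [v [hv hg]] := unit_dir hd g; set n := enorm g in hg *.
have n0 : 0 <= n by exact: enorm_ge0.
have C0 : 0 < cH by exact: lt_trans hn0 hnC.
have [hR|hR] := leP (n ^+ 2) (25 * (X ^+ 2 + Y ^+ 2)).
  have [B [beta [m [[b0 b1] m0 hm [hbm hd1] hB]]]] := large_sandwich hv.
  exists B => S hS rX rY hY hX; have hsw := hB S hS.
  have Z0 : 0 <= 6/5 * k2 by apply: mulr_ge0; [lra|exact: ltW].
  have A0 : 0 <= 2 / cH by rewrite divr_ge0 // ltW.
  have hN := psd_test_form hv hH A0 Z0.
  have b110 : (0 : R) < 11/5 by lra.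
  have hX' : dotv rX rX <= X ^+ 2 \/ ((2 <= l)%N /\ forall i, rX i 0 ^+ 2 <=
      X ^+ 2 / l%:R ^+ 3 * (k2 * dotv (col i S) (col i S)) ^+ 3).
    case: hX => [|[[l2|d1] h]]; [by left|by right|left].
    exact: (dim1_bound d1 hv hN hsw hm b110 hbm (hd1 d1) h).
  have := large_step hv hH c50 C0 hHn k20 k21 hsw b1 hm hbm n0 G0
    hgG X0 Y0 hR hsk hsk2 hY hX'.
  by rewrite /descent2 -/n hg -scalemxAr dotvZl.
have [B [beta [m [[b0 b1] m0 hm [hbm hd1] hB]]]] := small_sandwich hv.
exists B => S hS rX rY hY hX; have hsw := hB S hS.
have np : 0 < n.
  rewrite lt_def n0 andbT; apply: contraTneq hR => ->.
  by rewrite expr0n -leNgt mulr_ge0 // addr_ge0 ?sqr_ge0.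
have n1 : n != 0 by rewrite gt_eqF.
have hXn : X ^+ 2 + Y ^+ 2 <= (n / 5) ^+ 2 by move: (ltW hR); lra.
have hX5 : X / n <= 1/5.
  rewrite ler_pdivrMr // mul1r mulrC; apply: le_of_sqr_le; first by rewrite divr_ge0.
  by apply: le_trans hXn; rewrite lerDl sqr_ge0.
have hY5 : Y / n <= 1/5.
  rewrite ler_pdivrMr // mul1r mulrC; apply: le_of_sqr_le; first by rewrite divr_ge0.
  by apply: le_trans hXn; rewrite lerDr sqr_ge0.
have hG : 50/19 <= G / n by rewrite ler_pdivlMr //; move: hgG; rewrite -/n; lra.
have Xn0 : 0 <= X / n by rewrite divr_ge0.
have Yn0 : 0 <= Y / n by rewrite divr_ge0.
have Z0 : 0 <= 87/400 * k2 by apply: mulr_ge0; [lra|exact: ltW].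
have A0 : 0 <= 41/100 / (cH - hn).
  by apply: divr_ge0; [lra|rewrite subr_ge0; exact: ltW].
have hN := psd_test_form hv hH A0 Z0.
have b410 : (0 : R) < 41/50 by lra.
have hX' : dotv rX rX <= X ^+ 2 \/ ((2 <= l)%N /\ forall i, rX i 0 ^+ 2 <=
      X ^+ 2 / l%:R ^+ 3 * (k2 * dotv (col i S) (col i S)) ^+ 3).
  case: hX => [|[[l2|d1] h]]; [by left|by right|left].
  exact: (dim1_bound d1 hv hN hsw hm b410 hbm (hd1 d1) h).
have hYn : dotv (n^-1 *: rY) (n^-1 *: rY) <= (Y / n) ^+ 2.
  rewrite dotvZl dotvZr mulrA -expr2 expr_div_n mulrC exprVn.
  by rewrite ler_wpM2r // invr_ge0 exprn_ge0.
have hXn' : dotv (n^-1 *: rX) (n^-1 *: rX) <= (X / n) ^+ 2 \/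
   ((2 <= l)%N /\ forall i, (n^-1 *: rX) i 0 ^+ 2 <=
      (X / n) ^+ 2 / l%:R ^+ 3 * (k2 * dotv (col i S) (col i S)) ^+ 3).
  case: hX' => [h|[l2 h]]; [left|right; split=> // i].
    rewrite dotvZl dotvZr mulrA -expr2 expr_div_n mulrC exprVn.
    by rewrite ler_wpM2r // invr_ge0 exprn_ge0.
  rewrite mxE exprMn expr_div_n exprVn mulrC.
  have -> : X ^+ 2 / n ^+ 2 / l%:R ^+ 3 * (k2 * dotv (col i S) (col i S)) ^+ 3 =
    X ^+ 2 / l%:R ^+ 3 * (k2 * dotv (col i S) (col i S)) ^+ 3 / n ^+ 2 by ring.
  by rewrite ler_wpM2r // invr_ge0 exprn_ge0.
have := small_step hv hH hn0 hnC hHn k20 k21 hsw b1 m0 hm hbm hG Xn0 hX5 Yn0 hY5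
   hsk hsk2 hYn hXn'.
set u := S^T *m v; rewrite -scalerDr => hmain.
have n2 : 0 < n ^+ 2 by rewrite exprn_gt0.
rewrite /descent2 -/n hg -scalemxAr -/u.
set r := rX + rY in hmain *.
have eq1 : n *: u + r = n *: (u + n^-1 *: r) by rewrite scalerDr scalerA divff // scale1r.
rewrite eq1 -!scalemxAr qfZ enormZ (ger0_norm n0) dotvZl dotvZr.
set q := u + _ in hmain *; set p := S *m q in hmain *.
rewrite -(ler_pM2l n2) in hmain.
have X3 : 0 <= 2/3 * (X ^+ 3 + Y ^+ 3) / G.
  rewrite divr_ge0 ?(ltW G0) // mulr_ge0 ?addr_ge0 ?exprn_ge0 //; lra.
apply: le_trans (_ : n ^+ 2 * (1 / 8 - 5 * ((X / n) ^+ 2 + (Y / n) ^+ 2)) <= _).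
  have -> : n ^+ 2 * (1 / 8 - 5 * ((X / n) ^+ 2 + (Y / n) ^+ 2)) =
    n ^+ 2 / 8 - 5 * (X ^+ 2 + Y ^+ 2) by rewrite !expr_div_n; field.
  by rewrite gerBl.
apply: le_trans hmain _; rewrite le_eqVlt; apply/orP; left; apply/eqP.
have -> : (sk * (n * enorm p)) ^+ 3 / (24 * G) =
  n ^+ 2 * ((sk * enorm p) ^+ 3 / (24 * (G / n))).
  by rewrite !exprMn; field; rewrite n1 gt_eqF.
by ring.
Qed.

End CaseTwo.

(** * Choice of the test matrix when the distance to the minimum is large *)

Section CaseOne.
Variables (R : realType) (d l : nat) (g : 'cV[R]_d) (kk : R).
Hypotheses (hd : (0 < d)%N) (kk1 : 1 <= kk).
Let k2 := (5/4 + d%:R / (4 * kk))^-1.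

(** The test form is a quarter of [k2] times the projection.  Taking [s = 1] and
    [x = 0] in the sandwich bounds [|S^T v|^2] by [1/4] from below; the upper
    bound [k2 |S q|^2 <= 3 |q|^2] controls the curvature, which [L] bounds. *)
Theorem case1_event : exists B, forall S : 'M[R]_(d, l), sketch_event kk B S ->
  forall r q : 'cV[R]_l, q = S^T *m g + r ->
  enorm g ^+ 2 / 8 - dotv r r / 2 <=
    dotv (S^T *m g) q - k2 / 8 * dotv (S *m q) (S *m q).
Proof.
have kk0 : 0 < kk by exact: lt_le_trans kk1.
have dk0 : 0 <= d%:R / (4 * kk) by rewrite divr_ge0 // mulr_ge0 // ltW.
have c20 : 0 < 5/4 + d%:R / (4 * kk) by move: dk0; lra.
have k20 : 0 < k2 by rewrite invr_gt0.
have k2E : k2 * (5/4 + d%:R / (4 * kk)) = 1 by rewrite mulVf // gt_eqF.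
have k2d : k2 * d%:R / (4 * kk) = 1 - 5/4 * k2.
  by move: k2E; rewrite mulrDr mulrA; lra.
have k21 : k2 <= 4/5.
  have h : 0 <= k2 * (d%:R / (4 * kk)) by rewrite mulr_ge0 // ltW.
  by move: k2E; rewrite mulrDr; lra.
have ikk : kk^-1 <= 1 by rewrite invf_le1.
have [v [hv hg]] := unit_dir hd g; set n := enorm g in hg *.
pose N := test_form v 1%:M 0 (k2 / 4).
have Z0 : 0 < k2 / 4 by rewrite divr_gt0.
have hI : psd (1%:M : 'M[R]_d) by exact: psd1.
have hN : psd N by exact: psd_test_form hv hI (lexx 0) (ltW Z0).
have htr := test_form_tr hv hI (lexx 0) (ltW Z0).
have qN x : qf N x = k2 / 4 * (dotv x x - dotv v x ^+ 2).
  by rewrite qf_test_form mul0r add0r.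
pose beta := 1 / 4 * (1 + (1 + \tr N) / kk).
have htr2 : (1 + \tr N) / kk <= 1 + (1 - 5/4 * k2).
  rewrite -k2d; apply: le_trans (_ : (1 + k2 / 4 * d%:R) / kk <= _).
    rewrite ler_wpM2r ?invr_ge0 ?(ltW kk0) // lerD2l.
    by move: htr; rewrite mul0r add0r.
  rewrite (_ : _ / kk = kk^-1 + k2 * d%:R / (4 * kk)) ?lerD2r //.
  by field; rewrite gt_eqF.
have b0 : 0 <= beta.
  have tr0 : 0 <= \tr N by apply: sumr_ge0 => i _; exact: psd_diag.
  by rewrite mulr_ge0 ?divr_ge0 // addr_ge0 // divr_ge0 ?addr_ge0 // ltW.
have b1 : beta <= 3/4 - 5/16 * k2 by rewrite /beta; move: htr2; lra.
have [||B hB] := @sandwich_exists _ d l v 1%:M 0 (k2 / 4) 1 1 beta kk hv hI (lexx 0) Z0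
    _ (lexx 1) _ kk0 (lexx beta).
- by move=> y; rewrite qf1 mul1r.
- by rewrite mul0r add0r; move: k21; lra.
exists B => S hS r q hq; have hsw : sandwich S v N beta by exact: hB.
set u := S^T *m v in hsw.
have a1 : 1/4 <= dotv u u.
  have := hsw 1 0; rewrite !mulmx0 addr0 scale1r dotv0r addr0 expr1n.
  rewrite /qf mulmx0 dotv0r addr0 mulr1 ler_norml => /andP[h _].
  by move: h b1 k20; lra.
have hm x : qf N x <= k2 / 4 * dotv x x.
  by rewrite qN ler_wpM2l ?(ltW Z0) // gerBl sqr_ge0.
have hNN (x : 'cV[R]_d) : dotv (N *m x) (N *m x) <= k2 / 4 * qf N x.
  exact: psd_sqr_le.
have hU : k2 * dotv (S *m q) (S *m q) <= 3 * dotv q q.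
  have b34 : (0 : R) < 3/4 by lra.
  have hb : beta + k2 / 4 <= 3/4 by move: b1 k20; lra.
  have g0 : 0 <= k2 / 3 by rewrite divr_ge0 // ltW.
  have hgb : k2 / 3 * (1 + beta) <= 1.
    apply: le_trans (_ : k2 / 3 * 2 <= _); last by move: k21; lra.
    by apply: ler_wpM2l => //; move: b1 k20; lra.
  have := sandwich_upper hN hsw b34 hNN hb q g0 hgb.
  by rewrite qN -/u -dotv_trmx; lra.
have hSg : S^T *m g = n *: u by rewrite hg -scalemxAr.
set w := S^T *m g in hq hSg *.
have hww : n ^+ 2 / 4 <= dotv w w.
  rewrite hSg dotvZl dotvZr mulrA -expr2.
  by have := ler_wpM2l (sqr_ge0 n) a1; lra.
have hwr : 0 <= dotv (w + r) (w + r) by exact: dotv_ge0.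
move: hU hwr hww; rewrite hq !dotvDl !dotvDr [dotv r w]dotvC; lra.
Qed.

End CaseOne.

(** * Derivatives along lines *)

Section Calculus.
Variables (R : realType) (d : nat).
Implicit Types (x u v : 'cV[R]_d).

Lemma cvec_sum u : u = \sum_(i < d) u i 0 *: delta_mx i 0.
Proof.
apply/matrixP => i j; rewrite summxE (bigD1 i) //= big1 => [|k ki].
  by rewrite !mxE !ord1 !eqxx mulr1 addr0.
by rewrite !mxE eq_sym (negPf ki) mulr0.
Qed.

Lemma derive_delta (h : 'cV[R]_d -> R) x v : differentiable h x ->
  is_derive x v h (\sum_(j < d) 'D_(delta_mx j 0) h x * v j 0).
Proof.
move=> dh; apply: DeriveDef; first exact: diff_derivable.
rewrite deriveE // {1}(cvec_sum v) linear_sum; apply: eq_bigr => j _.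
by rewrite linearZ deriveE // mulrC.
Qed.

Lemma is_derive_line (h : 'cV[R]_d -> R) x v (t a : R) :
  is_derive (x + t *: v) v h a -> is_derive t 1 (fun t : R => h (x + t *: v)) a.
Proof.
have e : (fun s : R => s^-1 *: (((fun t : R => h (x + t *: v)) \o shift t) (s *: 1) -
      h (x + t *: v))) =
    (fun s : R => s^-1 *: ((h \o shift (x + t *: v)) (s *: v) - h (x + t *: v))).
  apply/funext => s /=; congr (_ *: (h _ - _)).
  by rewrite [s *: 1]mulr1 scalerDl addrCA addrC -addrA addrC.
case=> hd <-; apply: DeriveDef; first by rewrite /derivable e.
by rewrite /derive e.
Qed.

(** The difference quotients, not the derivative, are what Lipschitz and convexity
    estimates control. *)
Lemma is_derive_quotient (F : R -> R) (a c : R) : is_derive (0 : R) 1 F a ->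
  (forall h, h != 0 -> h^-1 * (F h - F 0) <= c) -> a <= c.
Proof.
case=> hd <- hc; apply: limr_le => //; near=> h.
have h0 : h != 0 by near: h; exact: nbhs_dnbhs_neq.
by have := hc _ h0; rewrite /= addr0 [h *: 1]mulr1.
Unshelve. all: by end_near. Qed.

Lemma derive_nonpos_le (F F' : R -> R) (a : R) : 0 <= a ->
  (forall t : R, is_derive t 1 F (F' t)) -> (forall t, 0 <= t -> F' t <= 0) ->
  F a <= F 0.
Proof.
move=> a0 hF hF'; have [|c] := @MVT_segment R F F' 0 a a0 (fun t _ => hF t).
  apply: derivable_within_continuous => t _; exact: ex_derive.
rewrite in_itv /= => /andP[c0 _]; rewrite subr0 => e.
by rewrite -subr_le0 e mulr_le0_ge0 ?hF'.
Qed.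

Let scaleRE (a b : R) : a *: (b : R^o) = a * b. Proof. by []. Qed.

Lemma is_derive_mono (c : R) n (s : R) :
  is_derive s 1 (c *: (id : R -> R) ^+ n) (c * (n%:R * s ^+ n.-1)).
Proof. by apply: is_derive_eq; rewrite scaleRE [_%:A]mulr1. Qed.

(** A one-sided bound on the growth of the second derivative is integrated twice
    by comparing derivatives. *)
Lemma taylor2_le (F F1 F2 : R -> R) (M a : R) : 0 <= a ->
  (forall t : R, is_derive t 1 F (F1 t)) -> (forall t : R, is_derive t 1 F1 (F2 t)) ->
  (forall t, 0 <= t -> F2 t <= F2 0 + M * t) ->
  F a <= F 0 + F1 0 * a + F2 0 / 2 * a ^+ 2 + M / 6 * a ^+ 3.
Proof.
move=> a0 h0 h1 h2.
have e1 t : 0 <= t -> F1 t <= F1 0 + F2 0 * t + M / 2 * t ^+ 2.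
  move=> t0; pose E := F1 - (F2 0 *: id ^+ 1 + (M / 2) *: id ^+ 2).
  have dE (s : R) : is_derive s 1 E (F2 s - (F2 0 + M * s)).
    have hp := is_deriveD (is_derive_mono (F2 0) 1 s) (is_derive_mono (M / 2) 2 s).
    apply: is_derive_eq (is_deriveB (h1 s) hp) _; congr (_ - _).
    by rewrite /= expr0 expr1 !mulr1 mulrA; congr (_ + _ * _); field.
  have hE s : 0 <= s -> F2 s - (F2 0 + M * s) <= 0 by move=> /h2; rewrite subr_le0.
  have := derive_nonpos_le t0 dE hE.
  rewrite /E !fctE /= !scaleRE !expr0n /= !expr1 !mulr0 addr0 subr0; lra.
pose E := F - (F1 0 *: id ^+ 1 + (F2 0 / 2) *: id ^+ 2 + (M / 6) *: id ^+ 3).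
have dE (s : R) : is_derive s 1 E (F1 s - (F1 0 + F2 0 * s + M / 2 * s ^+ 2)).
  have hp := is_deriveD (is_deriveD (is_derive_mono (F1 0) 1 s)
    (is_derive_mono (F2 0 / 2) 2 s)) (is_derive_mono (M / 6) 3 s).
  apply: is_derive_eq (is_deriveB (h0 s) hp) _; congr (_ - _).
  by rewrite /= expr0 expr1 !mulr1 !mulrA; congr (_ + _ * _ + _ * _); field.
have hE s : 0 <= s -> F1 s - (F1 0 + F2 0 * s + M / 2 * s ^+ 2) <= 0.
  by move=> /e1; rewrite subr_le0.
have := derive_nonpos_le a0 dE hE.
rewrite /E !fctE /= !scaleRE !expr0n /= !expr1 !mulr0 !addr0 subr0; lra.
Qed.

Variable phi : 'cV[R]_d -> R.
Hypothesis hphi : twice_differentiable phi.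

Lemma grad_line x v (t : R) :
  is_derive t 1 (fun t : R => phi (x + t *: v)) (dotv (grad phi (x + t *: v)) v).
Proof.
apply: is_derive_line; have := derive_delta v (hphi.1 (x + t *: v)).
by congr is_derive; apply: eq_bigr => i _; rewrite mxE.
Qed.

Lemma hess_line x v w (t : R) :
  is_derive t 1 (fun t : R => dotv (grad phi (x + t *: v)) w)
    (dotv w (hess phi (x + t *: v) *m v)).
Proof.
have hi i : is_derive t 1 (fun t : R => grad phi (x + t *: v) i 0)
    ((hess phi (x + t *: v) *m v) i 0).
  apply: (@is_derive_line (fun y => grad phi y i 0)).
  have dg : differentiable (fun y => grad phi y i 0) (x + t *: v).
    apply: (@differentiable_comp _ _ _ _ (grad phi) (fun N : 'cV[R]_d => N i 0)).
      exact: hphi.2.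
    exact: differentiable_coord.
  have := derive_delta v dg; congr is_derive; rewrite mxE; apply: eq_bigr => j _.
  by rewrite mxE.
have -> : (fun t : R => dotv (grad phi (x + t *: v)) w) =
    \sum_(i < d) w i 0 *: (fun t : R => grad phi (x + t *: v) i 0).
  by apply/funext => s; rewrite fct_sumE; apply: eq_bigr => i _; rewrite mulrC.
by apply: is_derive_eq.
Qed.

Lemma grad_continuous i : continuous (fun y => grad phi y i 0).
Proof.
move=> y; apply: differentiable_continuous.
apply: (@differentiable_comp _ _ _ _ (grad phi) (fun N : 'cV[R]_d => N i 0)).
  exact: hphi.2.
exact: differentiable_coord.
Qed.

End Calculus.

(** * Smooth strongly convex functions *)

Lemma enorm_le_norm (R : realType) d (u : 'cV[R]_d) : enorm u <= d%:R * `|u|.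
Proof.
have h i : `|u i 0| <= `|u|.
  rewrite [leRHS]/Num.Def.normr/= mx_normrE.
  exact: (le_bigmax _ (fun ij => `|u ij.1 ij.2|) (i, 0)).
apply: le_of_sqr_le; first by rewrite mulr_ge0.
rewrite enorm_sqr; apply: le_trans (_ : \sum_(i < d) `|u| ^+ 2 <= _).
  apply: ler_sum => i _; rewrite -expr2 -real_normK ?num_real //.
  by rewrite ler_sqr ?nnegrE.
rewrite sumr_const card_ord exprMn -[_ *+ d]mulr_natl ler_wpM2r ?sqr_ge0 //.
by rewrite -natrX ler_nat; case: d {u h} => // n; rewrite leq_pmulr.
Qed.

Lemma enorm_delta (R : realType) d (i : 'I_d) : enorm (delta_mx i 0 : 'cV[R]_d) = 1.
Proof. by rewrite /enorm delta_dotv mxE !eqxx sqrtr1. Qed.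

Lemma entry_le_specnorm (R : realType) d (A B : 'M[R]_d) i j :
  `|A i j - B i j| <= specnorm (A - B).
Proof.
have -> : A i j - B i j = dotv (delta_mx i 0) ((A - B) *m delta_mx j 0).
  by rewrite delta_dotv -colE !mxE.
by apply: le_trans (specnorm_dotv _ _ _) _; rewrite !enorm_delta !mulr1.
Qed.

Section Landscape.
Variables (R : realType) (d : nat) (phi : 'cV[R]_d -> R) (mu L Lh : R).
Hypotheses (hd : (0 < d)%N) (hphi : twice_differentiable phi).
Hypotheses (hmu : 0 < mu) (hconv : strongly_convex phi mu).
Hypothesis (hsmooth : smooth phi L).
Hypotheses (hLh : 0 < Lh) (hhess : lipschitz_hessian phi Lh).
Implicit Types (x y u v : 'cV[R]_d).

(** The symmetric part has the same quadratic form and the same trace, the only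
    features of the Hessian that matter; Schwarz's theorem is avoided. *)
Definition sym_hess x := 2^-1 *: (hess phi x + (hess phi x)^T).

Lemma sym_hess_sym x : (sym_hess x)^T = sym_hess x.
Proof. by rewrite /sym_hess linearZ linearD /= trmxK addrC. Qed.

Lemma qf_sym_hess x u : qf (sym_hess x) u = qf (hess phi x) u.
Proof.
rewrite qf_scalel qf_addl {2}/qf (dotv_trmx _ u) trmxK dotvC -/(qf _ u).
by rewrite -mulr2n -[qf _ u *+ 2]mulr_natr mulrC mulfK.
Qed.

Lemma tr_sym_hess x : \tr (sym_hess x) = \tr (hess phi x).
Proof.
rewrite /sym_hess mxtraceZ mxtraceD mxtrace_tr -mulr2n -[\tr _ *+ 2]mulr_natr.
by rewrite mulrC mulfK.
Qed.

Lemma mu_le_L : mu <= L.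
Proof.
pose e : 'cV[R]_d := delta_mx (Ordinal hd) 0.
have e1 : dotv e e = 1 by rewrite delta_dotv mxE !eqxx.
have := hconv 0 e; have := hsmooth 0 e; rewrite !subr0 !enorm_sqr e1; lra.
Qed.

Lemma L_gt0 : 0 < L. Proof. exact: lt_le_trans mu_le_L. Qed.

(** Compare the lower bound of convexity at [x] and the upper bound of smoothness
    at [y] at the point reached from [y] by a gradient step for [phi] minus its
    tangent at [x]. *)
Lemma smooth_coercive x y : dotv (grad phi y - grad phi x) (grad phi y - grad phi x) <=
  2 * L * (phi y - phi x - dotv (grad phi x) (y - x)).
Proof.
have L0 := L_gt0; set D := grad phi y - grad phi x.
pose z := y - L^-1 *: D.
have h1 := hconv x z; have h2 := hsmooth y z.
have ezx : z - x = (y - x) - L^-1 *: D by rewrite /z addrAC.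
have ezy : z - y = - (L^-1 *: D) by rewrite /z addrAC subrr add0r.
have m0 : 0 <= mu / 2 * enorm (z - x) ^+ 2.
  by rewrite mulr_ge0 ?sqr_ge0 // divr_ge0 // ltW.
have eD : dotv D D = dotv (grad phi y) D - dotv (grad phi x) D by rewrite {1}/D dotvBl.
move: h1 h2 m0; rewrite ezx ezy enormN [enorm (L^-1 *: D) ^+ 2]enorm_sqr dotvNr.
rewrite (dotvBr (grad phi x) (y - x)) !dotvZl !dotvZr => h1 h2 m0.
have h3 : 0 <= phi y - phi x - dotv (grad phi x) (y - x) - L^-1 * (dotv D D) / 2.
  have e : L / 2 * (L^-1 * (L^-1 * dotv D D)) = L^-1 * dotv D D / 2.
    by field; rewrite gt_eqF.
  by move: h1 h2 m0; rewrite e eD; lra.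
have -> : dotv D D = 2 * L * (L^-1 * dotv D D / 2) by field; rewrite gt_eqF.
by rewrite ler_wpM2l ?mulr_ge0 ?(ltW L0) // -subr_ge0.
Qed.

Lemma grad_lipschitz x y : enorm (grad phi y - grad phi x) <= L * enorm (y - x).
Proof.
have L0 := L_gt0; set D := grad phi y - grad phi x.
have h : dotv D D <= L * dotv D (y - x).
  have h1 := smooth_coercive x y; have := smooth_coercive y x.
  rewrite -/D -(opprB _ _ : - D = _) -(opprB y x) !dotvNr dotvNl opprK.
  move: h1; rewrite -/D /D !dotvBl; lra.
have h2 : enorm D * enorm D <= (L * enorm (y - x)) * enorm D.
  rewrite -expr2 enorm_sqr; apply: le_trans h _; rewrite -mulrA ler_pM2l //.
  by rewrite [leRHS]mulrC; exact: dotv_le.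
have [->|D0] := eqVneq (enorm D) 0; first by rewrite mulr_ge0 ?enorm_ge0 // ltW.
by rewrite -(ler_pM2r (_ : 0 < enorm D)) // lt_def D0 enorm_ge0.
Qed.

(** The inner product of the gradient with [hess phi x *m u] has difference
    quotients bounded by the Lipschitz constant of the gradient. *)
Lemma hess_specnorm x : specnorm (hess phi x) <= L.
Proof.
have L0 := L_gt0; apply: specnorm_le => [|u]; first exact: ltW.
set w := hess phi x *m u.
have h : dotv w w <= L * enorm u * enorm w.
  have := hess_line hphi x u w 0; rewrite scale0r addr0 -/w => hw.
  apply: (is_derive_quotient hw) => h h0; rewrite scale0r addr0 -dotvBl.
  have h1 : 0 < `|h| by rewrite normr_gt0.
  apply: le_trans (ler_norm _) _; rewrite normrM normfV mulrC ler_pdivrMr //.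
  apply: le_trans (dotv_abs_le _ _) _.
  rewrite mulrAC ler_wpM2r ?enorm_ge0 //; apply: le_trans (grad_lipschitz _ _) _.
  by rewrite addrAC subrr add0r enormZ mulrA mulrAC.
rewrite -!enorm_sqr -exprMn; move: h; rewrite -enorm_sqr expr2 => h.
rewrite ler_sqr ?nnegrE ?mulr_ge0 ?enorm_ge0 ?(ltW L0) //.
have [->|w0] := eqVneq (enorm w) 0; first by rewrite mulr_ge0 ?enorm_ge0 // ltW.
by rewrite -(ler_pM2r (_ : 0 < enorm w)) // lt_def w0 enorm_ge0.
Qed.

Lemma hess_ge x u : mu * dotv u u <= qf (hess phi x) u.
Proof.
rewrite -lerN2; have := hess_line hphi x u (- u) 0.
rewrite scale0r addr0 dotvNl => hw.
apply: (is_derive_quotient hw) => h h0; rewrite scale0r addr0 -dotvBl dotvNr.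
have := hconv x (x + h *: u); have := hconv (x + h *: u) x.
have -> : x - (x + h *: u) = - (h *: u) by rewrite opprD addNKr.
rewrite [x + _ - x]addrAC subrr add0r enormN enorm_sqr dotvNr !dotvZl !dotvZr => h1 h2.
rewrite mulrN lerN2 dotvBl.
have h3 : h ^+ 2 * (mu * dotv u u) <=
    h ^+ 2 * (h^-1 * (dotv (grad phi (x + h *: u)) u - dotv (grad phi x) u)).
  have -> : h ^+ 2 * (h^-1 * (dotv (grad phi (x + h *: u)) u - dotv (grad phi x) u)) =
     h * dotv (grad phi (x + h *: u)) u - h * dotv (grad phi x) u by field.
  by move: h1 h2; lra.
by rewrite ler_pM2l ?exprn_even_gt0 in h3.
Qed.

(** The sign [s] covers the upper and the lower bound at once. *)
Lemma hess_taylor x u (s : R) : s ^+ 2 = 1 ->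
  s * (phi (x + u) - phi x - dotv (grad phi x) u - qf (hess phi x) u / 2) <=
    Lh / 6 * enorm u ^+ 3.
Proof.
move=> s2; have h0 := grad_line hphi x u; have h1 := hess_line hphi x u u.
have h2 (t : R) : 0 <= t ->
    s * dotv u (hess phi (x + t *: u) *m u) <=
    s * dotv u (hess phi (x + 0 *: u) *m u) + (Lh * enorm u ^+ 3) * t.
  move=> t0; rewrite -lerBlDl -mulrBr -dotvBr -mulmxBl -/(qf _ u).
  apply: le_trans (ler_norm _) _.
  have s1 : `|s| = 1 by apply/eqP; rewrite -sqr_norm_eq1 s2.
  rewrite normrM s1 mul1r; apply: le_trans (specnorm_qf _ _) _.
  rewrite -enorm_sqr; apply: le_trans (_ : Lh * (t * enorm u) * enorm u ^+ 2 <= _).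
    rewrite ler_wpM2r ?sqr_ge0 //; apply: le_trans (hhess _ _) _.
    rewrite scale0r addr0 [x + _ - x]addrAC subrr add0r enormZ ger0_norm //.
  by rewrite le_eqVlt; apply/orP; left; apply/eqP; ring.
have d0 (t : R) : is_derive t 1 (fun t : R => s * phi (x + t *: u))
   (s * dotv (grad phi (x + t *: u)) u) by exact: is_deriveZ (h0 t).
have d1 (t : R) : is_derive t 1 (fun t : R => s * dotv (grad phi (x + t *: u)) u)
   (s * dotv u (hess phi (x + t *: u) *m u)) by exact: is_deriveZ (h1 t).
have := taylor2_le ler01 d0 d1 h2.
rewrite !scale0r addr0 scale1r expr1n !mulr1 /qf; lra.
Qed.

Lemma taylor_upper x u :
  phi (x + u) <= phi x + dotv (grad phi x) u + qf (hess phi x) u / 2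
    + Lh / 6 * enorm u ^+ 3.
Proof. by have := hess_taylor x u (expr1n _ 2); lra. Qed.

Lemma central_difference x u :
  `|phi (x + u) - phi (x - u) - 2 * dotv (grad phi x) u| <= Lh / 3 * enorm u ^+ 3.
Proof.
have h1 := hess_taylor x u (expr1n _ 2).
have N2 : (-1 : R) ^+ 2 = 1 by rewrite sqrrN expr1n.
have h2 := hess_taylor x u N2.
have h3 := hess_taylor x (- u) (expr1n _ 2); have h4 := hess_taylor x (- u) N2.
have e : qf (hess phi x) (- u) = qf (hess phi x) u.
  by rewrite /qf mulmxN dotvNl dotvNr opprK.
rewrite ler_norml; move: h1 h2 h3 h4; rewrite e enormN dotvNr; lra.
Qed.

Variables (xs : 'cV[R]_d).
Hypothesis hxs : forall x, phi xs <= phi x.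

Lemma grad_sqr_ge x : 2 * mu * (phi x - phi xs) <= dotv (grad phi x) (grad phi x).
Proof.
have h := hconv x xs; set g := grad phi x in h *; set u := xs - x in h.
have : 0 <= dotv (g + mu *: u) (g + mu *: u) by exact: dotv_ge0.
rewrite !dotvDl !dotvDr !dotvZl !dotvZr [dotv u g]dotvC.
have := ler_wpM2l (ltW hmu) h; rewrite enorm_sqr; lra.
Qed.

Lemma grad_sqr_le x : dotv (grad phi x) (grad phi x) <= 2 * L * (phi x - phi xs).
Proof.
have L0 := L_gt0; set g := grad phi x.
have := hsmooth x (x - L^-1 *: g); have := hxs (x - L^-1 *: g).
rewrite [x - _ - x]addrAC subrr add0r enormN enorm_sqr dotvNr !dotvZl !dotvZr -/g.
move=> h1 h2.
have h3 : dotv g g / (2 * L) <= phi x - phi xs.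
  have e1 : L / 2 * (L^-1 * (L^-1 * dotv g g)) = dotv g g / (2 * L).
    by field; rewrite gt_eqF.
  have e2 : L^-1 * dotv g g = dotv g g / (2 * L) + dotv g g / (2 * L).
    by field; rewrite gt_eqF.
  by move: h2 h1; rewrite e1 e2; lra.
by move: h3; rewrite ler_pdivrMr ?mulr_gt0 // mulrC.
Qed.

Lemma hess_entry_continuous i j : continuous (fun y => hess phi y i j).
Proof.
have eij x y : `|hess phi x i j - hess phi y i j| <= Lh * (d%:R * `|x - y|).
  apply: le_trans (entry_le_specnorm _ _ _ _) _; apply: le_trans (hhess _ _) _.
  by rewrite ler_pM2l // enorm_le_norm.
have M0 : 0 < Lh * d%:R + 1 by rewrite ltr_wpDl // mulr_ge0 // ltW.
move=> y; apply/(@cvgrPdist_le _ _ _ (nbhs y) (nbhs_filter y)) => e e0.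
near=> x; apply: le_trans (eij y x) _; rewrite mulrA.
apply: le_trans (_ : (Lh * d%:R + 1) * `|y - x| <= _).
  by rewrite ler_wpM2r // lerDl.
rewrite -ler_pdivlMl // mulrC.
near: x; have e1 : 0 < e / (Lh * d%:R + 1) by exact: divr_gt0.
by have /(@cvgrPdist_le _ _ _ (nbhs y) (nbhs_filter y))/(_ _ e1) := @cvg_id _ (nbhs y).
Unshelve. all: by end_near. Qed.

Lemma specnorm_hess_gt0 x : 0 < specnorm (hess phi x).
Proof.
apply: lt_le_trans hmu _.
pose e : 'cV[R]_d := delta_mx (Ordinal hd) 0.
have e1 : dotv e e = 1 by rewrite delta_dotv mxE !eqxx.
have := hess_ge x e; have := specnorm_qf (hess phi x) e; rewrite e1 !mulr1.
by move=> h1 h2; apply: le_trans h2 (le_trans (ler_norm _) h1).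
Qed.

Lemma psd_sym_hess x : psd (sym_hess x).
Proof.
split=> [|u]; first exact: sym_hess_sym.
rewrite qf_sym_hess; apply: le_trans (hess_ge x u).
by rewrite mulr_ge0 ?dotv_ge0 // ltW.
Qed.

(** The supremum is finite because both the spectral norm and the diagonal of the
    Hessian are bounded by [L]. *)
Lemma C1_ge x (k : R) : 0 < k ->
  5 * specnorm (hess phi x) + \tr (hess phi x) / k <= C1 phi k.
Proof.
move=> k0; apply: ub_le_sup; last by exists x.
exists (5 * L + d%:R * L / k) => _ [y _ <-].
apply: lerD; first by rewrite ler_wpM2l // hess_specnorm.
rewrite ler_wpM2r ?invr_ge0 ?(ltW k0) //.
apply: le_trans (_ : \sum_(i < d) L <= _); last by rewrite sumr_const card_ord mulr_natl.
apply: ler_sum => i _; rewrite -qf_delta.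
apply: le_trans (ler_norm _) _; apply: le_trans (specnorm_qf _ _) _.
by rewrite delta_dotv mxE !eqxx mulr1 hess_specnorm.
Qed.

End Landscape.

(** * Continuity of matrix expressions and measurability *)

Section MatrixContinuity.
Variables (R : realType) (V : topologicalType).

(** Continuity is stated entrywise, which is what sums and products of matrices
    preserve. *)
Definition mcont m n (a : V -> 'M[R]_(m, n)) :=
  forall i j, continuous (fun y => a y i j).

Lemma continuous_sum (I : Type) (r : seq I) (F : I -> V -> R) :
  (forall i, continuous (F i)) -> continuous (fun y => \sum_(i <- r) F i y).
Proof. by move=> hF; apply: continuous_big => //; exact: add_continuous. Qed.

Lemma continuous_mul (f g : V -> R) : continuous f -> continuous g ->
  continuous (fun y => f y * g y).
Proof. by move=> hf hg y; apply: continuousM; [exact: hf|exact: hg]. Qed.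

Lemma continuous_add (f g : V -> R) : continuous f -> continuous g ->
  continuous (fun y => f y + g y).
Proof. by move=> hf hg y; apply: continuousD; [exact: hf|exact: hg]. Qed.

Lemma continuous_opp (f : V -> R) : continuous f -> continuous (fun y => - f y).
Proof. by move=> hf y; apply: continuousN; exact: hf. Qed.

Lemma continuous_const (c : R) : continuous (fun _ : V => c).
Proof. by move=> y; exact: cvg_cst. Qed.

Lemma continuous_exp n (f : V -> R) : continuous f ->
  continuous (fun y => f y ^+ n).
Proof.
move=> hf; elim: n => [|n IH]; first exact: continuous_const.
under [X in continuous X]funext do rewrite exprS.
exact: continuous_mul.
Qed.

Lemma continuous_sqrt (f : V -> R) : continuous f ->
  continuous (fun y => Num.sqrt (f y)).
Proof.
move=> hf y; apply: (@continuous_comp _ _ _ f Num.sqrt); first exact: hf.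
exact: sqrt_continuous.
Qed.

Lemma mcont_cst m n (A : 'M[R]_(m, n)) : mcont (fun _ => A).
Proof. by move=> i j; exact: continuous_const. Qed.

Lemma mcont_add m n (a b : V -> 'M[R]_(m, n)) : mcont a -> mcont b ->
  mcont (fun y => a y + b y).
Proof.
move=> ha hb i j; under [X in continuous X]funext do rewrite mxE.
exact: continuous_add.
Qed.

Lemma mcont_scale m n (f : V -> R) (a : V -> 'M[R]_(m, n)) : continuous f ->
  mcont a -> mcont (fun y => f y *: a y).
Proof.
move=> hf ha i j; under [X in continuous X]funext do rewrite mxE.
exact: continuous_mul.
Qed.

Lemma mcont_tr m n (a : V -> 'M[R]_(m, n)) : mcont a -> mcont (fun y => (a y)^T).
Proof.
by move=> ha i j; under [X in continuous X]funext do rewrite mxE; exact: ha.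
Qed.

Lemma mcont_mul m n p (a : V -> 'M[R]_(m, n)) (b : V -> 'M[R]_(n, p)) :
  mcont a -> mcont b -> mcont (fun y => a y *m b y).
Proof.
move=> ha hb i j; under [X in continuous X]funext do rewrite mxE.
by apply: continuous_sum => k; exact: continuous_mul.
Qed.

Lemma continuous_dotv n (a b : V -> 'cV[R]_n) : mcont a -> mcont b ->
  continuous (fun y => dotv (a y) (b y)).
Proof. by move=> ha hb; apply: continuous_sum => k; exact: continuous_mul. Qed.

Lemma continuous_enorm n (a : V -> 'cV[R]_n) : mcont a ->
  continuous (fun y => enorm (a y)).
Proof. by move=> ha; apply: continuous_sqrt; exact: continuous_dotv. Qed.

Lemma continuous_qf n (A : V -> 'M[R]_n) (a : V -> 'cV[R]_n) : mcont A ->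
  mcont a -> continuous (fun y => qf (A y) (a y)).
Proof. by move=> hA ha; apply: continuous_dotv => //; exact: mcont_mul. Qed.

Lemma continuous_fnorm m n (A : V -> 'M[R]_(m, n)) : mcont A ->
  continuous (fun y => fnorm (A y)).
Proof.
move=> hA; apply: continuous_sqrt.
by apply: continuous_sum => i; apply: continuous_sum => j; exact: continuous_exp.
Qed.

Lemma closed_preimage (f : V -> R) c : continuous f -> closed [set y | f y <= c].
Proof.
move=> hf; apply: (@preimage_closed _ _ f [set x | x <= c]); last exact: closed_le.
by move=> y _; exact: hf.
Qed.

Lemma open_preimage (f : V -> R) c : continuous f -> open [set y | c < f y].
Proof.
move=> hf; apply: (@open_comp _ _ f [set x | c < x]); last exact: open_gt.
by move=> y _; exact: hf.
Qed.

End MatrixContinuity.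

Lemma mcont_id (R : realType) m n : mcont (fun A : 'M[R]_(m, n) => A).
Proof. by move=> i j; exact: coord_continuous. Qed.

(** The spectral norm is a supremum, so its sublevel sets are intersections of
    closed sets. *)
Lemma closed_specnorm_le (R : realType) m n (V : topologicalType)
    (A : V -> 'M[R]_(m, n)) (c : R) :
  mcont A -> closed [set y | specnorm (A y) <= c].
Proof.
move=> hA; have -> : [set y | specnorm (A y) <= c] =
    \bigcap_(u in [set u : 'cV[R]_n | enorm u <= 1]) [set y | enorm (A y *m u) <= c].
  apply/seteqP; split=> y /=.
    move=> h u /= u1; apply: le_trans (specnorm_ub _ _) (le_trans _ h).
    by rewrite ler_piMr ?specnorm_ge0.
  move=> h; apply: ge_sup.
    by exists (enorm (A y *m 0)); exists 0 => //=; rewrite enorm0.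
  by move=> _ [u u1 <-]; exact: h.
apply: closed_bigI => u _; apply: closed_preimage; apply: continuous_enorm.
by apply: mcont_mul => //; exact: mcont_cst.
Qed.

Lemma frequently_le_lim (R : realType) (u : nat -> R) (a c : R) :
  u @ \oo --> a -> (forall N, exists2 m, (N <= m)%N & u m <= c) -> a <= c.
Proof.
move=> hu hf; rewrite leNgt; apply/negP => ca.
have [N _ hN] := @cvgr_gt _ _ _ _ u a hu c ca.
have [m Nm] := hf N; rewrite leNgt => /negP; apply; exact: hN.
Qed.

Section RealRV.
Context (disp : measure_display) (W : measurableType disp) (R : realType).
Implicit Types (T : topologicalType).

Lemma borel_rv_continuous T (X : W -> T) (h : T -> R) :
  borel_rv X -> continuous h -> measurable_fun setT (h \o X).
Proof.
move=> hX hh; apply: (measurability (@measurable_realfun.RGenOInfty.G R)).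
  exact: measurable_realfun.RGenOInfty.measurableE.
move=> _ [_ [c ->] <-]; rewrite setTI.
have -> : (h \o X) @^-1` `]c, +oo[ = X @^-1` [set y | c < h y].
  by apply/seteqP; split=> w /=; rewrite in_itv /= andbT.
by apply: hX; apply: sub_sigma_algebra; exact: open_preimage.
Qed.

End RealRV.

(** * Conditioning on the current point *)

Section Conditioning.
Context (disp : measure_display) (W : measurableType disp) (R : realType).
Variables (P : probability W R) (d : nat) (M : topologicalType).
Variables (S : W -> M) (X : W -> 'cV[R]_d) (p : R) (G : 'cV[R]_d -> set M).
Hypotheses (hS : borel_rv S) (hX : borel_rv X) (hSX : independent_rv P S X).
Hypothesis hG : forall y, borel_set (G y).
Hypothesis hp : forall y, (p%:E <= P (S @^-1` G y))%E.

(** The half-open cells of the grid of step [1 / (m + 1)]; [pt m z] is the corner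
    of the cell of index [z]. *)
Let cell (m : nat) (z : 'cV[int]_d) : set 'cV[R]_d :=
  [set y | forall i, Num.floor (m.+1%:R * y i 0) = z i 0].
Let pt (m : nat) (z : 'cV[int]_d) : 'cV[R]_d := \col_i ((z i 0)%:~R / m.+1%:R).
Let index (m : nat) (y : 'cV[R]_d) : 'cV[int]_d :=
  \col_i Num.floor (m.+1%:R * y i 0).

Let borelT := g_sigma_algebraType [set U : set 'cV[R]_d | open U].
Let measurable_borel (C : set 'cV[R]_d) : borel_set C = measurable (C : set borelT).
Proof. by []. Qed.

Let borel_cell m z : borel_set (cell m z).
Proof.
have hc i : continuous (fun y : 'cV[R]_d => m.+1%:R * y i 0).
  by apply: continuous_mul; [exact: continuous_const|exact: mcont_id].
have -> : cell m z = \bigcap_(i in [set: 'I_d])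
    ((~` [set y : 'cV[R]_d | - (z i 0)%:~R < - (m.+1%:R * y i 0)]) `&`
     [set y : 'cV[R]_d | - (z i 0 + 1)%:~R < - (m.+1%:R * y i 0)]).
  apply/seteqP; split=> y.
    move=> h i _; rewrite /= !ltrN2 -(h i).
    by split; [apply/negP; rewrite -leNgt floor_le|exact: floorD1_gt].
  move=> h i; have [] := h i I; rewrite /= !ltrN2 => /negP; rewrite -leNgt.
  by move=> h1 h2; apply: floor_def; rewrite h1.
rewrite measurable_borel; apply: fin_bigcap_measurable; first exact: finite_finset.
move=> i _; apply: measurableI.
  apply: measurableC; apply: sub_sigma_algebra; apply: open_preimage.
  exact: continuous_opp.
apply: sub_sigma_algebra; apply: open_preimage; exact: continuous_opp.
Qed.

Let cell_index m y : cell m (index m y) y.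
Proof. by move=> i; rewrite mxE. Qed.

Let cell_inj m z y : cell m z y -> z = index m y.
Proof. by move=> h; apply/matrixP => i j; rewrite mxE !ord1 h. Qed.

Let pt_cvg y : (fun m => pt m (index m y)) @ \oo --> y.
Proof.
have hm m : `|y - pt m (index m y)| <= harmonic m.
  rewrite /Num.Def.normr/= mx_normrE; apply: bigmax_le => // -[i j] _ /=.
  rewrite !mxE ord1; have m0 : (0 : R) < m.+1%:R by rewrite ltr0n.
  have := floor_le (m.+1%:R * y i 0); have := floorD1_gt (m.+1%:R * y i 0).
  rewrite intrD; set f := (Num.floor _)%:~R => h1 h2.
  have -> : y i 0 - f / m.+1%:R = (m.+1%:R * y i 0 - f) / m.+1%:R.
    by rewrite mulrBl [_ * y i 0]mulrC mulfK // gt_eqF.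
  rewrite /harmonic normrM normfV (gtr0_norm m0) ler_piMl ?invr_ge0 ?(ltW m0) //.
  by rewrite ger0_norm ?subr_ge0 // lerBlDl; apply: ltW.
apply/cvgrPdist_le => e e0; have /cvgrPdist_le/(_ _ e0) := @cvg_harmonic R.
apply: filterS => m /=; rewrite sub0r normrN => h.
by apply: le_trans (hm m) _; rewrite ger0_norm in h.
Qed.

Variables (A : set 'cV[R]_d) (hA : borel_set A).

Let E m := [set w | A (X w) /\ G (pt m (index m (X w))) (S w)].

(** Countable unions are indexed by natural numbers for countable additivity. *)
Let piece (C : 'cV[int]_d -> set W) (n : nat) : set W :=
  if pickle_inv n is Some z then C z else set0.

Let bigcup_piece C : \bigcup_n piece C n = \bigcup_z C z.
Proof.
apply/seteqP; split=> w [].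
  by rewrite /piece => n _; case: pickle_inv => // z hz; exists z.
by move=> z _ hz; exists (pickle z) => //; rewrite /piece pickleK_inv.
Qed.

Let XA m z := X @^-1` (A `&` cell m z).

Let borel_Acell m z : borel_set (A `&` cell m z).
Proof. by rewrite measurable_borel; apply: measurableI => //; exact: borel_cell. Qed.

Let measurable_piece C : (forall z, measurable (C z)) -> forall n, measurable (piece C n).
Proof. by move=> hC n; rewrite /piece; case: pickle_inv. Qed.

Let trivIset_piece C : (forall z z' w, C z w -> C z' w -> z = z') ->
  trivIset setT (piece C).
Proof.
move=> hC i j _ _ [w []]; rewrite /piece.
case ei : (pickle_inv i) => [z|//]; case ej : (pickle_inv j) => [z'|//].
move=> h h'; have e := hC _ _ _ h h'.
have := pickle_invK (T := 'cV[int]_d) i; have := pickle_invK (T := 'cV[int]_d) j.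
by rewrite ei ej /= e => -> ->.
Qed.

Let measurable_XA m z : measurable (XA m z).
Proof. by apply: hX; exact: borel_Acell. Qed.

Let measurable_SX m z : measurable (S @^-1` G (pt m z) `&` XA m z).
Proof. by apply: measurableI => //; apply: hS; exact: hG. Qed.

Let XA_inj m z z' w : XA m z w -> XA m z' w -> z = z'.
Proof. by move=> [_ /cell_inj ->] [_ /cell_inj ->]. Qed.

Let bigcup_XA m : \bigcup_z XA m z = X @^-1` A.
Proof.
apply/seteqP; split=> w; first by case=> z _ [].
by move=> h; exists (index m (X w)).
Qed.

Let bigcup_E m : \bigcup_z (S @^-1` G (pt m z) `&` XA m z) = E m.
Proof.
apply/seteqP; split=> w.
  by case=> z _ [hg [h hz]]; split=> //; rewrite -(cell_inj hz).
by case=> h hg; exists (index m (X w)).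
Qed.

Let measurable_E m : measurable (E m).
Proof.
rewrite -bigcup_E -bigcup_piece; apply: bigcupT_measurable => n.
exact: measurable_piece.
Qed.

(** On each cell the event is attached to a fixed point of the grid, and
    independence applies. *)
Let E_ge m : 0 <= p -> (p%:E * P (X @^-1` A) <= P (E m))%E.
Proof.
move=> p0; rewrite -bigcup_E -(bigcup_XA m) -!bigcup_piece.
rewrite !measure_bigcup; last 4 first.
- by move=> n _; exact: measurable_piece.
- by apply: trivIset_piece => z z' w [_ h] [_ h']; exact: XA_inj h h'.
- by move=> n _; exact: measurable_piece.
- by apply: trivIset_piece => z z' w; exact: XA_inj.
rewrite -nneseriesZl; last by move=> n _; exact: measure_ge0.
apply: lee_nneseries => n _; first by rewrite mule_ge0 // lee_fin.
rewrite /piece; case: pickle_inv => [z|]; last by rewrite measure0 mule0.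
apply: le_trans (_ : (P (S @^-1` G (pt m z)) * P (XA m z) <= _)%E).
  by apply: lee_wpmul2r.
by have := hSX (hG (pt m z)) (borel_Acell m z) => <-.
Qed.

(** A point-dependent event [G y] of probability at least [p] for every fixed [y]
    is used at the random point [X].  Its version [E m] on the grid of step
    [1 / (m + 1)] has probability at least [p] times that of [X] in [A], and so
    does the superior limit of these events; there, [G] holds at infinitely many
    points of a sequence converging to the actual point. *)
Lemma conditioning (Q : set W) : measurable Q ->
  (forall w (u : nat -> 'cV[R]_d), A (X w) -> u @ \oo --> X w ->
    (forall N, exists2 m, (N <= m)%N & G (u m) (S w)) -> Q w) ->
  (p%:E * P (X @^-1` A) <= P (X @^-1` A `&` Q))%E.
Proof.
move=> mQ hQ; have mA : measurable (X @^-1` A) by exact: hX.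
have [p0|p0] := leP p 0.
  by apply: le_trans (measure_ge0 _ _); rewrite mule_le0_ge0 // lee_fin.
suff hlim : (P (lim_sup_set E) <= P (X @^-1` A `&` Q))%E.
  apply: le_trans hlim.
  have h1 := lim_sup_set_cvg P E measurable_E.
  have /h1 hcvg : (P (\bigcup_(k in [set k | (0 <= k)%N]) E k) < +oo)%E.
    apply: le_lt_trans (ltry 1); apply: probability_le1.
    by apply: bigcup_measurable => n _.
  rewrite -(cvg_lim _ hcvg) //; apply: lime_ge.
    by apply/cvg_ex; exists (P (lim_sup_set E)).
  apply: nearW => n; apply: le_trans (E_ge n (ltW p0)) _.
  apply: le_measure; rewrite ?inE //.
    by apply: bigcup_measurable => k _.
  by move=> w hw; exists n => /=.
apply: le_measure; rewrite ?inE.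
- by apply: bigcapT_measurable => n; apply: bigcup_measurable => k _.
- exact: measurableI.
move=> w hw; have [n _ [hA' _]] := hw 0%N I.
split=> //; apply: (hQ w (fun m => pt m (index m (X w)))) => // N.
by have [m hm [_ hg]] := hw N I; exists m.
Qed.

End Conditioning.

(** * Particular sketches *)

Section SketchColumns.
Variables (R : realType) (d l : nat).

(** One column annihilates some vector [u] of a plane.  For the projection [B] on
    this plane the form tested by the event is [- |u|^2], while the event
    only allows absolute values up to [3/4 |u|^2]. *)
Lemma sketch_one_column kk : 1 <= kk -> (1 < d)%N -> l = 1%N ->
  exists B : 'M[R]_d, forall S : 'M[R]_(d, l), ~ sketch_event kk B S.
Proof.
move=> kk1 d2 l1; have kk0 : 0 < kk by exact: lt_le_trans kk1.
pose i0 := Ordinal (ltnW d2); pose i1 := Ordinal d2.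
pose D : 'rV[R]_d := \row_j (j < 2)%N%:R; pose B := diag_mx D.
have Bsym : B^T = B by rewrite tr_diag_mx.
have D2 j : D 0 j ^+ 2 = D 0 j by rewrite mxE; case: (_ < _)%N; rewrite ?expr1n ?expr0n.
have D1 j : 0 <= D 0 j <= 1 by rewrite mxE; case: (_ < _)%N; rewrite ?ler01 ?lexx.
have hB1 : specnorm B <= 1.
  apply: specnorm_le => // u; rewrite expr1n mul1r; apply: ler_sum => j _.
  rewrite mul_diag_mx mxE -!expr2 exprMn D2 ler_piMl ?sqr_ge0 //.
  by have /andP[] := D1 j.
have hB2 : fnorm B ^+ 2 <= 2.
  rewrite fnorm_sqr (eq_bigr (fun i => D 0 i)) => [|i _].
    have -> : \sum_(i < d) D 0 i = \sum_(i < d | (i < 2)%N) 1.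
      rewrite [RHS]big_mkcond; apply: eq_bigr => i _; rewrite mxE.
      by case: (_ < _)%N.
    by rewrite (big_ord_narrow d2) sumr_const card_ord.
  rewrite (bigD1 i) //= big1 ?addr0 => [|j ji]; first by rewrite mxE eqxx mulr1n D2.
  by rewrite mxE eq_sym (negPf ji) mulr0n expr0n.
exists B => S; rewrite /sketch_event => hS.
have h34 : specnorm (B^T *m S *m S^T *m B - B^T *m B) <= 3/4.
  apply: le_trans hS _.
  have h1 : specnorm B ^+ 2 <= 1 by rewrite expr_le1 ?specnorm_ge0.
  have h2 : fnorm B ^+ 2 / kk <= 2.
    by rewrite ler_pdivrMr //; apply: le_trans hB2 _; rewrite ler_peMr.
  by move: h1 h2; lra.
pose j0 : 'I_l := cast_ord (esym l1) ord0.
have [u [u0 Bu Su]] : exists u : 'cV[R]_d, [/\ 0 < dotv u u, B *m u = u & S^T *m u = 0].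
  pose a := S i0 j0; pose c := S i1 j0.
  have hu (a' c' : R) : (a' != 0) || (c' != 0) -> a' * a + c' * c = 0 ->
      exists u : 'cV[R]_d, [/\ 0 < dotv u u, B *m u = u & S^T *m u = 0].
    move=> h0 h; exists (a' *: delta_mx i0 0 + c' *: delta_mx i1 0).
    have n01 : (i1 == i0) = false by [].
    split.
    - rewrite !dotvDl !dotvDr !dotvZl !dotvZr !delta_dotv !mxE !eqxx [i0 == i1]eq_sym.
      rewrite n01 /= !mulr0 !mulr1 addr0 add0r -!expr2.
      case/orP: h0 => h0; [apply: ltr_pwDl|apply: ltr_wpDl]; rewrite ?sqr_ge0 //.
        by rewrite exprn_even_gt0.
      by rewrite exprn_even_gt0.
    - apply/matrixP => i j; rewrite mul_diag_mx !mxE.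
      have [->|h1] := eqVneq i i0; first by rewrite mul1r.
      have [->|h2] := eqVneq i i1; first by rewrite mul1r.
      by rewrite /= !mulr0 addr0 mulr0.
    - apply/matrixP => i j; rewrite mulmxDr -!scalemxAr -!colE !mxE -[RHS]h.
      have -> : i = j0 by apply/eqP; rewrite -val_eqE -leqn0 -ltnS -[X in (_ < X)%N]l1 ltn_ord.
      by [].
  have [c0|c0] := eqVneq c 0; last by apply: (hu c (- a)); [rewrite c0|ring].
  have [a0|a0] := eqVneq a 0; last by apply: (hu c (- a)); [rewrite oppr_eq0 a0 orbT|ring].
  by apply: (hu 1 0); [rewrite oner_neq0|rewrite a0 mulr0 mul0r addr0].
have := specnorm_qf (B^T *m S *m S^T *m B - B^T *m B) u.
have -> : qf (B^T *m S *m S^T *m B - B^T *m B) u = - dotv u u.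
  rewrite /qf mulmxBl -!mulmxA Bu Su !mulmx0 sub0r dotvNr.
  by rewrite dotv_trmx trmxK Bu.
rewrite normrN ger0_norm ?dotv_ge0 // => h.
by have := ler_wpM2r (ltW u0) h34; move: h u0; lra.
Qed.

End SketchColumns.

Section UnitColumns.
Context (disp : measure_display) (W : measurableType disp) (R : realType).
Variables (P : probability W R) (d l : nat) (S : W -> 'M[R]_(d, l)).
Hypothesis hl : (0 < l)%N.

Lemma sgn_sqr (b : bool) : (sgn b : R) ^+ 2 = 1.
Proof. by rewrite /sgn -exprM mulnC exprM sqrrN !expr1n. Qed.

Lemma sqr_entry w i j : rademacher_sketch P S \/ srht_sketch P S ->
  S w i j ^+ 2 = l%:R^-1.
Proof.
have l0 : (0 : R) <= l%:R by [].
case=> [[eps _ ->]|[_ [eps [r [_ _ _ hS]]]]].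
  by rewrite !mxE exprMn sgn_sqr mulr1 exprVn sqr_sqrtr.
have -> : S w i j = ((S w)^T) j i by rewrite mxE.
rewrite hS mxE exprMn exprVn sqr_sqrtr // -[RHS]mulr1; congr (_ * _).
rewrite mul_mx_diag mxE exprMn [(\row__ _) _ _]mxE sgn_sqr mulr1 mxE.
rewrite (bigD1 (r w j)) //= big1 ?addr0 => [|k hk].
  by rewrite !mxE eqxx mul1r -exprM mulnC exprM sqrrN !expr1n.
by rewrite !mxE eq_sym (negPf hk) mul0r.
Qed.

Lemma col_sqr w i : rademacher_sketch P S \/ srht_sketch P S ->
  dotv (col i (S w)) (col i (S w)) = d%:R / l%:R.
Proof.
move=> h; rewrite /dotv (eq_bigr (fun _ => l%:R^-1)) => [|k _].
  by rewrite sumr_const card_ord -[_ *+ d]mulr_natl.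
by rewrite mxE -expr2 sqr_entry.
Qed.

End UnitColumns.

(** * Decrease of the function in one step *)

(** Applied to squared lengths, bounds the sum of the sixth powers of the column
    lengths by the sixth power of the Frobenius norm. *)
Lemma sum_cube_le (R : realType) n (a : 'I_n -> R) : (forall i, 0 <= a i) ->
  \sum_i a i ^+ 3 <= (\sum_i a i) ^+ 3.
Proof.
move=> a0; rewrite [leRHS]exprSr mulr_sumr; apply: ler_sum => i _.
rewrite exprSr ler_wpM2r //; have h : a i <= \sum_j a j.
  by rewrite (bigD1 i) //= lerDl sumr_ge0.
by rewrite ler_sqr ?nnegrE ?sumr_ge0.
Qed.

Lemma norm_le_sqr (R : realType) (x y : R) : `|x| <= y -> x ^+ 2 <= y ^+ 2.
Proof.
move=> h; have y0 : 0 <= y by exact: le_trans (normr_ge0 x) h.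
by rewrite -real_normK ?num_real // ler_sqr ?nnegrE.
Qed.

Lemma dotv_half (R : realType) n (b c : 'cV[R]_n) :
  dotv (b + c) (b + c) / 2 <= dotv b b + dotv c c.
Proof.
have : 0 <= dotv (b - c) (b - c) by exact: dotv_ge0.
rewrite !dotvBl !dotvBr !dotvDl !dotvDr [dotv c b]dotvC; lra.
Qed.

Section Step.
Variables (R : realType) (d l : nat) (phi f : 'cV[R]_d -> R) (mu L Lh : R).
Variables (xs : 'cV[R]_d) (sigma alpha kk : R).
Hypotheses (hd : (0 < d)%N) (hl : (0 < l)%N) (hphi : twice_differentiable phi).
Hypotheses (hmu : 0 < mu) (hconv : strongly_convex phi mu).
Hypothesis (hsmooth : smooth phi L).
Hypotheses (hLh : 0 < Lh) (hhess : lipschitz_hessian phi Lh).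
Hypothesis hnoise : forall x, `|f x - phi x| <= sigma.
Hypotheses (halpha : 0 < alpha) (kk1 : 1 <= kk).
Implicit Types (S : 'M[R]_(d, l)) (y : 'cV[R]_d).

Definition fin_diff (h : 'cV[R]_d -> R) S y : 'cV[R]_l :=
  \col_i ((h (y + alpha *: col i S) - h (y - alpha *: col i S)) / (2 * alpha)).

Lemma zo_gradE S y : zo_grad f alpha S y = S *m fin_diff f S y.
Proof.
apply/matrixP => i j; rewrite summxE mxE; apply: eq_bigr => k _.
by rewrite !mxE mulrC.
Qed.

Let bias S y := fin_diff phi S y - S^T *m grad phi y.
Let noise S y := fin_diff (fun z => f z - phi z) S y.

Let fin_diff_split S y : fin_diff f S y = S^T *m grad phi y + (bias S y + noise S y).
Proof.
rewrite /bias addrA [_ + (_ - _)]addrC subrK.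
apply/matrixP => i j; rewrite ord1 !mxE -mulrDl; congr (_ / _); ring.
Qed.

Let bias_le S y i : bias S y i 0 ^+ 2 <=
  (Lh * alpha ^+ 2 / 6) ^+ 2 * dotv (col i S) (col i S) ^+ 3.
Proof.
have a2 : 0 < 2 * alpha by rewrite mulr_gt0.
have h := central_difference hphi hhess y (alpha *: col i S).
have e0 : 0 <= enorm (col i S) by exact: enorm_ge0.
have -> : dotv (col i S) (col i S) ^+ 3 = (enorm (col i S) ^+ 3) ^+ 2.
  by rewrite -exprM mulnC exprM enorm_sqr.
rewrite -exprMn; apply: norm_le_sqr.
have -> : bias S y i 0 = (phi (y + alpha *: col i S) - phi (y - alpha *: col i S) -
    2 * dotv (grad phi y) (alpha *: col i S)) / (2 * alpha).
  have -> : bias S y i 0 = (phi (y + alpha *: col i S) - phi (y - alpha *: col i S)) /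
      (2 * alpha) - dotv (grad phi y) (col i S).
    have mxBE (u v : 'cV[R]_l) : (u - v) i 0 = u i 0 - v i 0 by rewrite !mxE.
    rewrite /bias mxBE [fin_diff _ _ _ _ _]mxE; congr (_ - _).
    by rewrite mxE /dotv; apply: eq_bigr => j _; rewrite !mxE mulrC.
  by rewrite dotvZr; field; rewrite gt_eqF.
rewrite normrM normfV (gtr0_norm a2) ler_pdivrMr //; apply: le_trans h _.
rewrite enormZ (gtr0_norm halpha) le_eqVlt; apply/orP; left; apply/eqP.
by field.
Qed.

Let noise_le S y : dotv (noise S y) (noise S y) <= (Num.sqrt l%:R * sigma / alpha) ^+ 2.
Proof.
have h i : noise S y i 0 * noise S y i 0 <= (sigma / alpha) ^+ 2.
  rewrite -expr2; apply: norm_le_sqr.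
  have a2 : 0 < 2 * alpha by rewrite mulr_gt0.
  rewrite mxE normrM normfV (gtr0_norm a2) ler_pdivrMr //.
  have -> : sigma / alpha * (2 * alpha) = sigma + sigma by field; rewrite gt_eqF.
  by apply: le_trans (ler_normB _ _) _; apply: lerD.
apply: le_trans (ler_sum _ (fun i _ => h i)) _.
rewrite sumr_const card_ord -[_ *+ l]mulr_natl -mulrA [leRHS]exprMn sqr_sqrtr //.
Qed.

(** With this step size [L / 2] times the squared step is [C2^-2 / 8] times the
    step, so the inequality on [S] is exactly what the smoothness bound needs. *)
Lemma descent_case1 S y :
  (forall r q : 'cV[R]_l, q = S^T *m grad phi y + r ->
    enorm (grad phi y) ^+ 2 / 8 - dotv r r / 2 <=
    dotv (S^T *m grad phi y) q -
      (5 / 4 + d%:R / (4 * kk))^-1 / 8 * dotv (S *m q) (S *m q)) ->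
  phi (y - ((5 + d%:R / kk)^-1 * L^-1) *: zo_grad f alpha S y) - phi xs <=
    (1 - mu / (4 * L) * (5 + d%:R / kk)^-1) * (phi y - phi xs)
    + 3 / (2 * L) * (5 + d%:R / kk)^-1
      * (Lh ^+ 2 * alpha ^+ 4 / 36 * fnorm S ^+ 6
         + l%:R * sigma ^+ 2 / alpha ^+ 2).
Proof.
move=> hev; have L0 := L_gt0 hd hmu hconv hsmooth.
have kk0 : 0 < kk by exact: lt_le_trans kk1.
set r := bias S y + noise S y; set q := fin_diff f S y.
have hq : q = S^T *m grad phi y + r by exact: fin_diff_split.
have := hev r q hq; rewrite enorm_sqr; set g := grad phi y => {}hev.
set D := (5 + d%:R / kk)^-1.
have D0 : 0 < D by rewrite invr_gt0 ltr_wpDr // divr_ge0 // ltW.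
have e4 : (5 / 4 + d%:R / (4 * kk))^-1 = 4 * D.
  rewrite /D; have -> : 5 / 4 + d%:R / (4 * kk) = (5 + d%:R / kk) / 4.
    by field; rewrite gt_eqF.
  by rewrite invfM invrK mulrC.
rewrite e4 in hev.
have rr : dotv r r / 2 <= dotv (bias S y) (bias S y) + dotv (noise S y) (noise S y).
  exact: dotv_half.
have hn := noise_le S y.
have hb : dotv (bias S y) (bias S y) <= (Lh * alpha ^+ 2 / 6) ^+ 2 * fnorm S ^+ 6.
  have -> : fnorm S ^+ 6 = (\sum_i dotv (col i S) (col i S)) ^+ 3.
    by rewrite -fnorm_sqr_col -exprM.
  apply: le_trans (_ : \sum_i (Lh * alpha ^+ 2 / 6) ^+ 2 *
      dotv (col i S) (col i S) ^+ 3 <= _).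
    by apply: ler_sum => i _; rewrite -expr2; exact: bias_le.
  rewrite -mulr_sumr ler_wpM2l ?sqr_ge0 //; apply: sum_cube_le => i; exact: dotv_ge0.
rewrite zo_gradE -/q; set p := S *m q in hev *; set e := D * L^-1.
have hup := hsmooth y (y - e *: p).
have ep : y - e *: p - y = - (e *: p) by rewrite addrAC subrr add0r.
rewrite ep enormN dotvNr enorm_sqr !dotvZr !dotvZl -/g in hup.
have hgp : dotv (S^T *m g) q = dotv g p by rewrite -dotv_trmx.
have e0 : 0 < e by rewrite mulr_gt0 // invr_gt0.
have eE : L / 2 * (e * (e * dotv p p)) = e * (4 * D / 8 * dotv p p).
  by rewrite /e; field; rewrite gt_eqF.
have hmain := ler_wpM2l (ltW e0) hev.
have hgrad := grad_sqr_ge hmu hconv xs y; rewrite -/g in hgrad.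
have hgrad' := ler_wpM2l (ltW e0) hgrad.
have hrr := ler_wpM2l (ltW e0) rr.
have hbe := ler_wpM2l (ltW e0) hb; have hne := ler_wpM2l (ltW e0) hn.
have -> : mu / (4 * L) * D = e * mu / 4 by rewrite /e; field; rewrite gt_eqF.
have -> : 3 / (2 * L) * D = 3 / 2 * e by rewrite /e; field; rewrite gt_eqF.
have -> : Lh ^+ 2 * alpha ^+ 4 / 36 * fnorm S ^+ 6 =
   (Lh * alpha ^+ 2 / 6) ^+ 2 * fnorm S ^+ 6 by congr (_ * _); field.
have -> : l%:R * sigma ^+ 2 / alpha ^+ 2 = (Num.sqrt l%:R * sigma / alpha) ^+ 2.
  by rewrite -{1}(sqr_sqrtr (_ : 0 <= l%:R :> R)) // !exprMn exprVn.
move: hup hmain hgrad' hrr hbe hne; rewrite hgp eE.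
set B1 := (Lh * alpha ^+ 2 / 6) ^+ 2 * fnorm S ^+ 6; set B2 := (_ / alpha) ^+ 2.
have B10 : 0 <= e * B1.
  apply: mulr_ge0; first exact: ltW.
  by apply: mulr_ge0; [exact: sqr_ge0|apply: exprn_ge0; exact: sqrtr_ge0].
have B20 : 0 <= e * B2 by apply: mulr_ge0; [exact: ltW|exact: sqr_ge0].
lra.
Qed.

Let x0 := Lh * alpha ^+ 2 / 6.
(** A bound on the norm of the bias when all columns have squared length [d / l] and [c3] is
    [d]; for other sketches, the scale of the column by column bound. *)
Definition bias_bound (c3 : R) := x0 * Num.sqrt c3 ^+ 3.
Definition noise_bound := Num.sqrt l%:R * sigma / alpha.

(** The constant [C4] is, up to [mu / 4], the loss in [descent2]. *)
Lemma C4E (c1 c2 c3 : R) : 0 < c1 -> 0 < c2 -> 0 <= c3 ->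
  let G := c1 ^+ 2 / (Lh * c2 ^+ 3) in
  mu / 4 * C4 l mu Lh alpha sigma c1 c2 c3 =
    5 * (bias_bound c3 ^+ 2 + noise_bound ^+ 2) +
    2 / 3 * (bias_bound c3 ^+ 3 + noise_bound ^+ 3) / G.
Proof.
move=> c10 c20 c30 G; rewrite /C4 /G.
have pw n (a : R) : 0 <= a -> a `^ (n%:R / 2) = Num.sqrt a ^+ n.
  by move=> a0; rewrite mulrC powRrM powR12_sqrt // powR_mulrn // sqrtr_ge0.
rewrite (pw 9) // (pw 3) //.
have e3 : c3 ^+ 3 = (Num.sqrt c3 ^+ 3) ^+ 2 by rewrite -exprM mulnC exprM sqr_sqrtr.
have el : l%:R = Num.sqrt l%:R ^+ 2 :> R by rewrite sqr_sqrtr.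
have e9 : Num.sqrt c3 ^+ 9 = (Num.sqrt c3 ^+ 3) ^+ 3 by rewrite -exprM.
rewrite e3 e9 /bias_bound /noise_bound /x0.
set s := Num.sqrt l%:R in el *; rewrite el; set b := _ ^+ 3.
by field; rewrite !gt_eqF.
Qed.

(** Taylor's formula to third order with step [1 / (2 C1)] turns the loss of the
    step into the right hand side of [descent2], and strong convexity turns the
    squared gradient into the distance to the minimum. *)
Lemma descent_case2 S y (c1 c2 c3 : R) :
  let G := c1 ^+ 2 / (Lh * c2 ^+ 3) in
  let X := bias_bound c3 in let Y := noise_bound in
  0 < c1 -> 0 < c2 -> c2 ^+ 2 = 5 / 4 + d%:R / (4 * kk) -> 0 <= c3 ->
  (c3 = d%:R /\ (forall i, dotv (col i S) (col i S) = d%:R / l%:R)) \/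
  (c3 = l%:R * c2 ^+ 2 /\ ((1 < l)%N \/ d = 1%N)) ->
  (forall rX rY : 'cV[R]_l, dotv rY rY <= Y ^+ 2 ->
    dotv rX rX <= X ^+ 2 \/
    ((1 < l)%N \/ d = 1%N) /\
    (forall i, rX i 0 ^+ 2 <= X ^+ 2 / l%:R ^+ 3 *
      ((5 / 4 + d%:R / (4 * kk))^-1 * dotv (col i S) (col i S)) ^+ 3) ->
    descent2 (sym_hess phi y) (grad phi y) c1 G X Y c2^-1 S rX rY) ->
  forall c4, c4 = C4 l mu Lh alpha sigma c1 c2 c3 ->
  phi (y - (2 * c1)^-1 *: zo_grad f alpha S y) - phi xs - c4 <=
    (1 - mu / (8 * c1)) * (phi y - phi xs - c4).
Proof.
move=> G X Y c10 c20 c2E c30 hcase hev c4 c4E.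
have l0 : (0 : R) < l%:R by rewrite ltr0n.
have l1 : (1 : R) <= l%:R by rewrite ler1n.
have XE : X ^+ 2 = x0 ^+ 2 * c3 ^+ 3.
  by rewrite /X /bias_bound exprMn -exprM mulnC exprM sqr_sqrtr.
have hX : dotv (bias S y) (bias S y) <= X ^+ 2 \/
    ((1 < l)%N \/ d = 1%N) /\
    (forall i, bias S y i 0 ^+ 2 <= X ^+ 2 / l%:R ^+ 3 *
      ((5 / 4 + d%:R / (4 * kk))^-1 * dotv (col i S) (col i S)) ^+ 3).
  case: hcase => [[c3E hcol]|[c3E hld]]; [left|right; split=> // i].
    apply: le_trans (_ : \sum_(i < l) X ^+ 2 / l%:R ^+ 3 <= _).
      apply: ler_sum => i _; rewrite -expr2; apply: le_trans (bias_le S y i) _.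
      have -> : X ^+ 2 / l%:R ^+ 3 = x0 ^+ 2 * (d%:R / l%:R) ^+ 3.
        by rewrite XE c3E (expr_div_n d%:R) -[LHS]mulrA.
      by rewrite hcol.
    rewrite sumr_const card_ord -[_ *+ l]mulr_natr.
    have -> : X ^+ 2 / l%:R ^+ 3 * l%:R = X ^+ 2 / l%:R ^+ 2.
      by field; rewrite gt_eqF.
    by rewrite ler_pdivrMr ?exprn_gt0 // ler_peMr ?sqr_ge0 // exprn_ege1.
  apply: le_trans (bias_le S y i) _; rewrite -c2E -/x0 XE c3E le_eqVlt.
  by apply/orP; left; apply/eqP; field; rewrite !gt_eqF.
have := hev _ _ (noise_le S y) hX; rewrite /descent2 -fin_diff_split.
set q := fin_diff f S y; set g := grad phi y.
rewrite zo_gradE -/q; set p := S *m q; set e := (2 * c1)^-1 => hmain.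
have e0 : 0 < e by rewrite invr_gt0 mulr_gt0.
have hup := taylor_upper hphi hhess y (- (e *: p)).
rewrite dotvNr dotvZr enormN enormZ (gtr0_norm e0) -/g in hup.
rewrite -(qf_sym_hess phi y) in hup.
have qfN (H : 'M[R]_d) u : qf H (- u) = qf H u by rewrite -scaleN1r qfZ sqrrN expr1n mul1r.
rewrite qfN qfZ in hup.
have hgp : dotv (S^T *m g) q = dotv g p by rewrite -dotv_trmx.
rewrite hgp -/p in hmain.
set Q := qf _ p in hup hmain; set n3 := enorm p in hup hmain.
have cub : (c2^-1 * n3) ^+ 3 / (24 * G) = Lh / (24 * c1 ^+ 2) * n3 ^+ 3.
  by rewrite /G; field; rewrite !gt_eqF.
rewrite cub in hmain.
have hgrad := ler_wpM2l (ltW e0) (grad_sqr_ge hmu hconv xs y); rewrite -/g in hgrad.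
have hm := ler_wpM2l (ltW e0) hmain.
have hc4 := C4E c10 c20 c30; rewrite -/G -/X -/Y -c4E in hc4.
rewrite enorm_sqr in hm.
have e1 : e ^+ 2 * Q / 2 = e * (Q / (4 * c1)) by rewrite /e; field; rewrite gt_eqF.
have e2 : Lh / 6 * (e * n3) ^+ 3 = e * (Lh / (24 * c1 ^+ 2) * n3 ^+ 3).
  by rewrite /e; field; rewrite gt_eqF.
rewrite e1 e2 in hup.
have -> : mu / (8 * c1) = e * mu / 4 by rewrite /e; field; rewrite gt_eqF.
have hec : e * (mu / 4 * c4) = e * (5 * (X ^+ 2 + Y ^+ 2)) +
    e * (2 / 3 * (X ^+ 3 + Y ^+ 3) / G) by rewrite hc4 mulrDr.
move: hup hm hgrad hec.
move: (phi (y - e *: p)) (X ^+ 2 + Y ^+ 2) (_ / G) => a1 a2 a3; lra.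
Qed.

End Step.

(** * Passage to the limit and conclusion *)

Section Limits.
Variables (R : realType) (d l : nat) (phi : 'cV[R]_d -> R) (mu L Lh : R).
Hypotheses (hd : (0 < d)%N) (hphi : twice_differentiable phi).
Hypotheses (hmu : 0 < mu) (hconv : strongly_convex phi mu) (hsmooth : smooth phi L).
Hypotheses (hLh : 0 < Lh) (hhess : lipschitz_hessian phi Lh).

Lemma mcont_grad : mcont (grad phi).
Proof. by move=> i j; rewrite (ord1 j); exact: grad_continuous. Qed.

Lemma mcont_sym_hess : mcont (sym_hess phi).
Proof.
have h : mcont (hess phi) by move=> i j; exact: hess_entry_continuous hLh hhess i j.
apply: (@mcont_scale _ _ _ _ (fun _ => 2^-1)); first exact: continuous_const.
by apply: mcont_add => //; exact: mcont_tr.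
Qed.

Lemma frequently_le (psi : 'cV[R]_d -> R) (u : nat -> 'cV[R]_d) y :
  continuous psi -> u @ \oo --> y ->
  (forall N, exists2 m, (N <= m)%N & psi (u m) <= 0) -> psi y <= 0.
Proof.
move=> hpsi hu; apply: frequently_le_lim.
exact: (@cvg_comp _ _ _ u psi _ _ _ hu (hpsi y)).
Qed.

Lemma descent2_closed (c1 G X Y sk : R) (S : 'M[R]_(d, l)) rX rY u y :
  u @ \oo --> y ->
  (forall N, exists2 m, (N <= m)%N &
    descent2 (sym_hess phi (u m)) (grad phi (u m)) c1 G X Y sk S rX rY) ->
  descent2 (sym_hess phi y) (grad phi y) c1 G X Y sk S rX rY.
Proof.
move=> hu hf; have hg := mcont_grad; have hH := mcont_sym_hess.
pose q z := S^T *m grad phi z + (rX + rY).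
have hSg : mcont (fun z => S^T *m grad phi z).
  by apply: mcont_mul => //; exact: mcont_cst.
have hq : mcont q by apply: mcont_add => //; exact: mcont_cst.
have hp : mcont (fun z => S *m q z) by apply: mcont_mul => //; exact: mcont_cst.
pose psi z := (enorm (grad phi z) ^+ 2 / 8 - 5 * (X ^+ 2 + Y ^+ 2)
    - 2/3 * (X ^+ 3 + Y ^+ 3) / G) -
  (dotv (S^T *m grad phi z) (q z) - qf (sym_hess phi z) (S *m q z) / (4 * c1)
    - (sk * enorm (S *m q z)) ^+ 3 / (24 * G)).
have psiE z : (psi z <= 0) =
   descent2 (sym_hess phi z) (grad phi z) c1 G X Y sk S rX rY.
  by rewrite /psi subr_le0.
have hpsi : continuous psi.
  apply: continuous_add; last apply: continuous_opp.
    apply: continuous_add; last exact: continuous_const.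
    apply: continuous_add; last exact: continuous_const.
    apply: continuous_mul; last exact: continuous_const.
    by apply: continuous_exp; exact: continuous_enorm.
  apply: continuous_add; last first.
    apply: continuous_opp; apply: continuous_mul; last exact: continuous_const.
    apply: continuous_exp; apply: continuous_mul; first exact: continuous_const.
    exact: continuous_enorm.
  apply: continuous_add; first exact: continuous_dotv.
  apply: continuous_opp; apply: continuous_mul; last exact: continuous_const.
  exact: continuous_qf.
rewrite -psiE; apply: (frequently_le hpsi hu) => N.
by have [m Nm h] := hf N; exists m => //; rewrite psiE.
Qed.

Lemma case1_closed (c : R) (S : 'M[R]_(d, l)) u y :
  u @ \oo --> y ->
  (forall N, exists2 m, (N <= m)%N & forall r q : 'cV[R]_l,
    q = S^T *m grad phi (u m) + r ->
    enorm (grad phi (u m)) ^+ 2 / 8 - dotv r r / 2 <=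
    dotv (S^T *m grad phi (u m)) q - c * dotv (S *m q) (S *m q)) ->
  forall r q : 'cV[R]_l, q = S^T *m grad phi y + r ->
    enorm (grad phi y) ^+ 2 / 8 - dotv r r / 2 <=
    dotv (S^T *m grad phi y) q - c * dotv (S *m q) (S *m q).
Proof.
move=> hu hf r _ ->; have hg := mcont_grad.
pose q z := S^T *m grad phi z + r.
have hSg : mcont (fun z => S^T *m grad phi z).
  by apply: mcont_mul => //; exact: mcont_cst.
have hq : mcont q by apply: mcont_add => //; exact: mcont_cst.
have hp : mcont (fun z => S *m q z) by apply: mcont_mul => //; exact: mcont_cst.
pose psi z := (enorm (grad phi z) ^+ 2 / 8 - dotv r r / 2) -
  (dotv (S^T *m grad phi z) (q z) - c * dotv (S *m q z) (S *m q z)).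
have hpsi : continuous psi.
  apply: continuous_add; last apply: continuous_opp.
    apply: continuous_add; last exact: continuous_const.
    apply: continuous_mul; last exact: continuous_const.
    by apply: continuous_exp; exact: continuous_enorm.
  apply: continuous_add; first exact: continuous_dotv.
  apply: continuous_opp; apply: continuous_mul; first exact: continuous_const.
  exact: continuous_dotv.
rewrite -subr_le0 -/(psi y); apply: (frequently_le hpsi hu) => N.
by have [m Nm h] := hf N; exists m => //; rewrite /psi subr_le0; exact: h.
Qed.

End Limits.

Lemma borel_sketch_event (R : realType) d l (kk : R) (B : 'M[R]_d) :
  borel_set [set S : 'M[R]_(d, l) | sketch_event kk B S].
Proof.
have hA : mcont (fun S : 'M[R]_(d, l) => B^T *m S *m S^T *m B - B^T *m B).
  apply: mcont_add; last exact: mcont_cst.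
  apply: mcont_mul; last exact: mcont_cst.
  apply: mcont_mul; last by apply: mcont_tr; exact: mcont_id.
  by apply: mcont_mul; [exact: mcont_cst|exact: mcont_id].
have hc := closed_specnorm_le (c := 1 / 4 * (specnorm B ^+ 2 + fnorm B ^+ 2 / kk)) hA.
rewrite -[X in borel_set X]setCK.
apply: (@measurableC _ (g_sigma_algebraType [set U : set 'M[R]_(d, l) | open U])).
by apply: sub_sigma_algebra; exact: closed_openC.
Qed.

Theorem theorem3
  (R : realType) (d l T : nat) (hd : (0 < d)%N) (hl : (0 < l)%N)
  (disp : measure_display) (W : measurableType disp) (P : probability W R)
  (phi f : 'cV[R]_d -> R) (xs : 'cV[R]_d)
  (mu L Lh sigma alpha k delta : R)
  (hphi : twice_differentiable phi)
  (hmu : 0 < mu) (hconv : strongly_convex phi mu)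
  (hsmooth : smooth phi L)
  (hLh : 0 < Lh) (hhess : lipschitz_hessian phi Lh)
  (hxs : forall x, phi xs <= phi x)
  (hsigma : 0 <= sigma) (hnoise : forall x, `|f x - phi x| <= sigma)
  (halpha : 0 < alpha) (hk : 1 <= k) (hdelta : 0 < delta)
  (S : nat -> W -> 'M[R]_(d, l)) (eta : nat -> 'cV[R]_d -> R)
  (x : nat -> W -> 'cV[R]_d)
  (hS : forall t, (t < T)%N ->
     oblivious_sketch P (S t) (1 / 4) k (delta / T%:R))
  (hx : forall t, (t <= T)%N -> borel_rv (x t))
  (hindep : forall t, (t < T)%N -> independent_rv P (S t) (x t))
  (hstep : forall t w, (t < T)%N ->
     x t.+1 w = x t w - eta t (x t w) *: zo_grad f alpha (S t w) (x t w)) :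
  let c1 := C1 phi k in
  let c2 := C2 d k in
  let thr := 3 * Num.sqrt 2 * c1 ^+ 2 / (16 * Num.sqrt L * Lh * c2 ^+ 3) in
  forall t, (t < T)%N ->
    let eta1 := (5 + d%:R / k)^-1 * L^-1 in
    let c4 := C4 l mu Lh alpha sigma c1 c2 (C3 P (S t) k) in
    cond_prob_ge P (x t)
      [set y | thr < Num.sqrt (phi y - phi xs) /\ eta t y = eta1]
      (1 - delta / T%:R)
      [set w | phi (x t.+1 w) - phi xs <=
         (1 - mu / (4 * L) * (5 + d%:R / k)^-1) * (phi (x t w) - phi xs)
         + 3 / (2 * L) * (5 + d%:R / k)^-1
           * (Lh ^+ 2 * alpha ^+ 4 / 36 * fnorm (S t w) ^+ 6
              + l%:R * sigma ^+ 2 / alpha ^+ 2)]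
    /\
    cond_prob_ge P (x t)
      [set y | Num.sqrt (phi y - phi xs) <= thr /\ eta t y = (2 * c1)^-1]
      (1 - delta / T%:R)
      [set w | phi (x t.+1 w) - phi xs - c4 <=
         (1 - mu / (8 * c1)) * (phi (x t w) - phi xs - c4)].
Proof.
move=> c1 c2 thr t tT eta1 c4.
have k0 : 0 < k by exact: lt_le_trans hk.
have L0 := L_gt0 hd hmu hconv hsmooth.
have [bS obl] := hS _ tT.
have bx : borel_rv (x t) by apply: hx; exact: ltnW.
have bx1 : borel_rv (x t.+1) by exact: hx.
have hind := hindep _ tT.
have cphi : continuous phi by move=> y; apply: differentiable_continuous; exact: hphi.1.
have mphi : measurable_fun setT (phi \o x t) by exact: borel_rv_continuous.
have mphi1 : measurable_fun setT (phi \o x t.+1) by exact: borel_rv_continuous.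
have mS : measurable_fun setT ((fun s => fnorm s ^+ 6) \o S t).
  apply: borel_rv_continuous => //; apply: continuous_exp.
  by apply: continuous_fnorm; exact: mcont_id.
have c20 : 0 <= 5 / 4 + d%:R / (4 * k).
  by rewrite addr_ge0 ?divr_ge0 ?mulr_ge0 // ltW.
have c2E : c2 ^+ 2 = 5 / 4 + d%:R / (4 * k) by rewrite /c2 /C2 sqr_sqrtr.
have c2p : 0 < c2.
  rewrite sqrtr_gt0; apply: ltr_pwDl; first by lra.
  by rewrite divr_ge0 ?mulr_ge0 // ltW.
split.
  move=> A bA AD.
  have [B hB] := choice (fun y => case1_event l (grad phi y) hd hk).
  apply: (@conditioning _ _ _ P d _ (S t) (x t) (1 - delta / T%:R)
    (fun y => [set s | sketch_event k (B y) s])) => //.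
  - by move=> y; exact: borel_sketch_event.
  - by move=> y; exact: obl.
  - rewrite -[X in measurable X]setTI; apply: measurable_fun_le => //.
      by apply: measurable_funB => //; exact: measurable_cst.
    apply: measurable_funD; apply: measurable_funM => //.
    - by apply: measurable_funB => //; exact: measurable_cst.
    - apply: measurable_funD; last exact: measurable_cst.
      by apply: measurable_funM => //; exact: measurable_cst.
  move=> w u Aw hu hfr /=.
  have [_ heta] := AD _ Aw; rewrite hstep // heta.
  apply: (descent_case1 xs hd hphi hmu hconv hsmooth hhess hnoise halpha hk).
  apply: (case1_closed hphi hu) => N; have [m Nm hm] := hfr N.
  by exists m => //; exact: hB hm.
move=> A bA AD.
have c1p : 0 < c1.
  apply: lt_le_trans (C1_ge hd hphi hmu hconv hsmooth 0 k0).
  apply: ltr_pwDl; first by rewrite mulr_gt0 // (specnorm_hess_gt0 hd hphi hmu hconv 0).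
  rewrite divr_ge0 ?(ltW k0) // -tr_sym_hess; apply: sumr_ge0 => i _.
  by apply: psd_diag; exact: psd_sym_hess hphi hmu hconv 0.
pose c3 := C3 P (S t) k.
have c30 : 0 <= c3.
  rewrite /c3 /C3; case: asboolP => _ //.
  by rewrite addr_ge0 // divr_ge0 ?mulr_ge0 // ltW.
(* with one column in dimension at least 2 the announced probability is not positive *)
have [[d2 l1]|hdl] := pselect ((1 < d)%N /\ l = 1%N).
  have [B hB] := sketch_one_column hk d2 l1.
  have p0 : 1 - delta / T%:R <= 0.
    have := obl B; rewrite (_ : [set w | _] = set0) ?measure0 ?lee_fin //.
    by apply/seteqP; split=> // w /=; exact: hB.
  by apply: le_trans (measure_ge0 _ _); rewrite mule_le0_ge0 // lee_fin.
have hcase w :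
  (c3 = d%:R /\ (forall i, dotv (col i (S t w)) (col i (S t w)) = d%:R / l%:R)) \/
  (c3 = l%:R * c2 ^+ 2 /\ ((1 < l)%N \/ d = 1%N)).
  rewrite /c3 /C3; case: asboolP => h; [left|right]; split=> //.
  - by move=> i; exact: col_sqr h.
  - by rewrite c2E; field; rewrite gt_eqF.
  - case: (ltnP 1 l) => [|l1]; [by left|right; apply/eqP].
    rewrite eqn_leq hd andbT leqNgt; apply/negP => d2; apply: hdl; split=> //.
    by apply/eqP; rewrite eqn_leq l1.
pose G := c1 ^+ 2 / (Lh * c2 ^+ 3).
have G0 : 0 < G by rewrite divr_gt0 ?exprn_gt0 ?mulr_gt0 ?exprn_gt0.
pose X := bias_bound Lh alpha c3; pose Y := noise_bound l sigma alpha.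
have X0 : 0 <= X.
  by rewrite mulr_ge0 ?exprn_ge0 ?sqrtr_ge0 // divr_ge0 // mulr_ge0 ?sqr_ge0 // ltW.
have Y0 : 0 <= Y by rewrite divr_ge0 ?mulr_ge0 ?sqrtr_ge0 // ltW.
have hevent y : exists B : 'M[R]_d, enorm (grad phi y) <= 19/50 * G ->
    forall s : 'M[R]_(d, l), sketch_event k B s ->
    forall rX rY : 'cV[R]_l, dotv rY rY <= Y ^+ 2 ->
    dotv rX rX <= X ^+ 2 \/
    ((1 < l)%N \/ d = 1%N) /\
    (forall i, rX i 0 ^+ 2 <= X ^+ 2 / l%:R ^+ 3 *
      ((5 / 4 + d%:R / (4 * k))^-1 * dotv (col i s) (col i s)) ^+ 3) ->
    descent2 (sym_hess phi y) (grad phi y) c1 G X Y c2^-1 s rX rY.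
  have [hy|hy] := pselect (enorm (grad phi y) <= 19/50 * G); last by exists 0.
  have hq u : qf (sym_hess phi y) u <= specnorm (hess phi y) * dotv u u.
    by rewrite qf_sym_hess; apply: le_trans (ler_norm _) (specnorm_qf _ _).
  have hC : 5 * specnorm (hess phi y) + \tr (sym_hess phi y) / k <= c1.
    by have := C1_ge hd hphi hmu hconv hsmooth y k0; rewrite tr_sym_hess.
  have hsk : 0 <= c2^-1 by rewrite invr_ge0 ltW.
  have hsk2 : c2^-1 ^+ 2 = (5 / 4 + d%:R / (4 * k))^-1 by rewrite exprVn c2E.
  have [B hB] := case2_event hd hl (psd_sym_hess hphi hmu hconv y)
    (specnorm_hess_gt0 hd hphi hmu hconv y) hq hk hC hsk hsk2 G0 hy X0 Y0.
  by exists B.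
have [B hB] := choice hevent.
apply: (@conditioning _ _ _ P d _ (S t) (x t) (1 - delta / T%:R)
  (fun y => [set s | sketch_event k (B y) s])) => //.
- by move=> y; exact: borel_sketch_event.
- by move=> y; exact: obl.
- rewrite -[X in measurable X]setTI; apply: measurable_fun_le => //.
    apply: measurable_funB; last exact: measurable_cst.
    by apply: measurable_funB => //; exact: measurable_cst.
  apply: measurable_funM; first exact: measurable_cst.
  apply: measurable_funB; last exact: measurable_cst.
  by apply: measurable_funB => //; exact: measurable_cst.
move=> w u Aw hu hfr /=.
have [hthr heta] := AD _ Aw; rewrite hstep // heta; set y := x t w in hthr hu *.
apply: (descent_case2 xs hl hphi hmu hconv hLh hhess hnoise halpha
  c1p c2p c2E c30 (hcase w)) => // rX rY hY hX.
have hn : enorm (grad phi y) < 19/50 * G.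
  have s0 : 0 <= phi y - phi xs by rewrite subr_ge0.
  (* the regime gives 3/8; the margin up to 19/50 covers nearby points of the grid *)
  apply: le_lt_trans (_ : 3/8 * G < _); last by move: G0; lra.
  apply: le_of_sqr_le; first by rewrite mulr_ge0 ?(ltW G0).
  rewrite enorm_sqr; apply: le_trans (grad_sqr_le hd hmu hconv hsmooth hxs y) _.
  rewrite -(sqr_sqrtr s0).
  apply: le_trans (_ : 2 * L * thr ^+ 2 <= _).
    rewrite ler_wpM2l ?mulr_ge0 ?(ltW L0) // ler_sqr ?nnegrE ?sqrtr_ge0 //.
    by apply: le_trans (sqrtr_ge0 _) hthr.
  have sL0 : 0 < Num.sqrt L by rewrite sqrtr_gt0.
  have -> : thr = 3 / 16 * (Num.sqrt 2 / Num.sqrt L) * G.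
    by rewrite /thr /G; field; rewrite !gt_eqF.
  have h2L : (Num.sqrt 2 / Num.sqrt L) ^+ 2 = 2 / L.
    by rewrite expr_div_n !sqr_sqrtr ?(ltW L0).
  have -> : 2 * L * (3 / 16 * (Num.sqrt 2 / Num.sqrt L) * G) ^+ 2 =
      2 * L * (Num.sqrt 2 / Num.sqrt L) ^+ 2 * (3 / 16 * G) ^+ 2 by ring.
  by rewrite h2L le_eqVlt; apply/orP; left; apply/eqP; field; rewrite gt_eqF.
apply: (descent2_closed hphi hLh hhess hu) => N.
have hnu : (fun m => enorm (grad phi (u m))) @ \oo --> enorm (grad phi y).
  have cg : continuous (fun z => enorm (grad phi z)).
    by apply: continuous_enorm; exact: mcont_grad.
  exact: (@cvg_comp _ _ _ u (fun z => enorm (grad phi z)) _ _ _ hu (cg y)).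
have [N0 _ hN0] := @cvgr_lt _ _ _ _ _ _ hnu _ hn.
have [m Nm hm] := hfr (maxn N N0); exists m.
  by apply: leq_trans Nm; exact: leq_maxl.
apply: (hB (u m) _ _ hm) => //; apply: ltW; apply: hN0.
by apply: leq_trans Nm; exact: leq_maxr.
Qed.
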